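(* Let $f \in \mathbb{Z}[z]$ be a monic polynomial of degree at least $2$, and assume that $\mathrm{PrePer}(f) \subseteq \mathcal{J}_f$. If $P(x,y) \in \mathbb{Z}[x,y]$ with $\mathrm{m}_f(P) = 0$, then the graph of $P(x,y)=0$ passes through infinitely many points $(\alpha,\beta)$ for which $\alpha$ and $\beta$ are both preperiodic for $f$.
   Context: For a polynomial $f\in\mathbb{C}[z]$ of degree at least $2$, $f^n$ denotes the $n$-fold composition. A point $\alpha\in\mathbb{C}$ is preperiodic for $f$ if $f^n(\alpha)=f^m(\alpha)$ for some $n>m\ge 0$; $\mathrm{PrePer}(f)$ is the set of all preperiodic points of $f$ in $\mathbb{C}$. The filled Julia set is $\mathcal{K}_f=\{z\in\mathbb{C} : f^n(z)\not\to\infty \text{ as } n\to\infty\}$ and the Julia set is its boundary $\mathcal{J}_f=\partial\mathcal{K}_f$. The equilibrium measure $\mu_f$ is the unique Borel probability measure on $\mathcal{J}_f$ maximizing the energy $I(\mu)=\int\int\log|z-w|\,d\mu(z)\,d\mu(w)$ among Borel probability measures on $\mathcal{J}_f$. For a nonzero $P\in\mathbb{C}(x_1,\dots,x_n)$, the $f$-dynamical Mahler measure is $$\mathrm{m}_f(P)=\int_{\mathcal{J}_f}\cdots\int_{\mathcal{J}_f}\log|P(z_1,\dots,z_n)|\,d\mu_f(z_1)\cdots d\mu_f(z_n).$$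
   Formalization: The polynomial P is additionally assumed to be non-constant: for P = 1 or P = -1 one has m_f(P) = 0 but P(x,y) = 0 has no points, so the statement as printed fails; these are the only cases excluded. *)

(* Defs.v *)
From HB Require Import structures.
From mathcomp Require Import all_boot all_order all_algebra.
From mathcomp Require Import all_classical all_reals all_analysis.
From mathcomp.real_closed Require Import complex.
Set Implicit Arguments.
Unset Strict Implicit.
Unset Printing Implicit Defensive.
Import Order.TTheory GRing.Theory Num.Theory.
Import numFieldNormedType.Exports.
Local Open Scope classical_set_scope.
Local Open Scope ring_scope.

(* The real-valued complex modulus; `|z| in [R[i]] is itself a complex number. *)
Notation cmod := ComplexField.Normc.normc.

Section Dynamics.
Variable R : realType.

(* [R[i]^o] carries the usual norm topology of the plane. *)
Definition Cplx : normedModType R[i] := R[i]^o.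

Definition borelC : measurableType _ := g_sigma_algebraType (@open Cplx).

Variable f : {poly int}.

Definition poly_fun (z : R[i]) : R[i] := (map_poly intr f).[z].

Definition preperiodic (z : R[i]) : Prop :=
  exists m n : nat, (m < n)%N /\ iter n poly_fun z = iter m poly_fun z.

Definition filled_julia : set Cplx :=
  [set z | ~ ((fun n : nat => cmod (iter n poly_fun z)) @ \oo --> +oo)].

Definition julia : set Cplx := closure filled_julia `\` interior filled_julia.

(* [lne] is the extended logarithm, with [lne 0 = -oo]. *)
Definition energy (mu : probability borelC R) : \bar R :=
  (\int[mu]_(z in julia) \int[mu]_(w in julia) lne (cmod (z - w : R[i]))%:E)%E.

Definition maximizes_energy (mu : probability borelC R) : Prop :=
  mu julia = 1%E /\
  forall nu : probability borelC R,
    nu julia = 1%E -> (energy nu <= energy mu)%E.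

Definition is_equilibrium_measure (mu : probability borelC R) : Prop :=
  maximizes_energy mu /\
  forall nu : probability borelC R, maximizes_energy nu ->
    forall A : set borelC, measurable A -> nu A = mu A.

(* The outer indeterminate of [P] is the first variable x, as in [polyXY]. *)
Definition eval2 (P : {poly {poly int}}) (x y : R[i]) : R[i] :=
  (map_poly (map_poly intr) P).[x, y].

Definition mahler2 (mu : probability borelC R) (P : {poly {poly int}}) : \bar R :=
  (\int[mu]_(y in julia) \int[mu]_(x in julia) lne (cmod (eval2 P x y))%:E)%E.

End Dynamics.

(* Main.v *)
Require Import Defs.
From HB Require Import structures.
From mathcomp Require Import all_boot all_order all_algebra.
From mathcomp Require Import all_classical all_reals all_analysis.
From mathcomp Require Import measurable_realfun.
From mathcomp Require Import separable.
From mathcomp.real_closed Require Import complex.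
From mathcomp Require Import ring lra zify.
Set Implicit Arguments.
Unset Strict Implicit.
Unset Printing Implicit Defensive.
Import Order.TTheory GRing.Theory Num.Theory.
Import numFieldNormedType.Exports.
Local Open Scope classical_set_scope.
Local Open Scope ring_scope.

(** The proof studies the logarithmic potential
    [p z = \int log |z - w| d mu(w)] of the equilibrium measure, and its mean
    [V = \int p d mu], the Robin constant.

    Finiteness of [V].  If the maximal energy were [-oo], every probability on the
    Julia set would maximize it, among them Dirac masses at two distinct
    preperiodic points, against uniqueness ([energy_ltNy]).

    Invariance.  Averaging over the fibres of [f] turns [mu] into a probability
    [f^* mu] on the Julia set; because [f] is monic,
    [\prod_(f r = u) (z - r) = f z - u], so its potential is [p (f z) / d] and its
    energy is [V / d] ([pot_pullback], [energy_pullbackE]).  Maximality gives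
    [V / d <= V], hence [0 <= V].  When [V = 0] the pullback is a maximizer too,
    so it equals [mu], and [p (f z) = d * p z] ([log_pot_poly_fun]).

    Frostman's theorem, [V <= p] on the whole plane ([log_pot_ge_robin]).  Comparing
    the energy of [mu] with that of [mu] plus a small multiple of its restriction
    to a set gives [V <= p] almost everywhere, and then, by semicontinuity, on a
    closed set of full measure.  The inequality persists up to an arbitrarily small
    error near that set, and spreads to the plane by a minimum principle, whose
    engine is a mean value inequality over the [n] rotations [s] of a vector [v],
    obtained from [\prod_s (x - s) = x ^+ n - v ^+ n] ([discrete_mean_value]).

    Consequences when [V = 0].  Since [p] is positive far away and multiplies by
    [d] under [f], its zeros have bounded orbits
    ([log_pot_eq0_filled_julia]).  On the filled Julia set [p = 0].  Every disc
    about a Julia point is charged by [mu] ([julia_ball_mass]), for otherwise the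
    mean value inequality would make [p] vanish on the disc and put it inside the
    filled Julia set.

    The Mahler measure.  Write [P = b(y) x^n + ...], where [b] has leading
    coefficient [c].  Factoring first in [x] and then [b] gives
    [m_f(P) = log |c| + \sum_(b g = 0) p g
      + \int \sum_(P(a, y) = 0) p a d mu(y)],
    where no term is negative, because [0 <= V <= p].  So if it vanishes, then [c]
    is [1] or [-1], the roots of [b] are zeros of [p], and for almost every [y] so
    are the roots of [P(., y)] ([mahler_zero]).  Since [P] is not constant such a root exists, and
    then [V <= p] and [0 <= V] give [V = 0].  As [mu] charges every disc about a
    Julia point, continuity of roots extends the conclusion on the roots of
    [P(., y)] from almost every [y] to every Julia point [y], in the form that
    they lie in the filled Julia set.

    Arithmetic.  By Kronecker's argument, an integer polynomial with leading
    coefficient [1] or [-1] and all roots in the filled Julia set has only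
    preperiodic roots ([kronecker_filled_julia]).  If [b] is not constant, it has
    a root [g], which is therefore preperiodic, hence a Julia point; there the
    leading coefficient vanishes while the roots over nearby points stay bounded, so
    [P(x, g) = 0] for every [x] ([leading_root_vertical]).  If [b] is constant and
    [y] is preperiodic, then [y] is a root of a monic integer polynomial [g] with
    preperiodic roots, and the norm of [P(x, .)] along [g] is an integer polynomial
    in [x] to which Kronecker's argument applies; so [y] has a preperiodic partner
    ([preperiodic_fiber]).  Both cases give infinitely many points, because [f]
    has infinitely many preperiodic points ([infinite_preperiodic]). *)


(** * Norms of integer polynomials *)

(** The eigenvalues of [h(A)] are the values of [h] at those of [A]. Splitting [h]
    into linear factors reduces this to the characteristic polynomial itself, and
    spares triangularizing [A]. *)
Lemma det_horner_mx (F : closedFieldType) n (A : 'M[F]_n.+1) (bs : seq F)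
    (h : {poly F}) :
  char_poly A = \prod_(b <- bs) ('X - b%:P) ->
  \det (horner_mx A h) = \prod_(b <- bs) h.[b].
Proof.
move=> cA.
have szbs : size bs = n.+1.
  by have := size_char_poly A; rewrite cA size_prod_XsubC => -[].
have powbs (c : F) : \prod_(b <- bs) c = c ^+ n.+1.
  by rewrite big_const_seq count_predT szbs -Monoid.iteropE.
have detX (s : F) : \det (A - s%:M) = \prod_(b <- bs) (b - s).
  have -> : A - s%:M = -1 *: (s%:M - A) by rewrite scaleN1r opprB.
  have -> : s%:M - A = map_mx (horner_eval s) (char_poly_mx A).
    by apply/matrixP => i j; rewrite !mxE /= horner_evalE !hornerE hornerMn hornerX.
  rewrite detZ det_map_mx /= -/(char_poly A) cA horner_evalE horner_prod -powbs.
  rewrite -big_split /=.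
  by apply: eq_bigr => b _; rewrite !hornerE mulN1r opprB.
have [rs ->] := closed_field_poly_normal h.
have hX r : horner_mx A ('X - r%:P) = A - r%:M.
  by rewrite rmorphB /= horner_mx_X horner_mx_C.
have dp : \det (horner_mx A (\prod_(z <- rs) ('X - z%:P))) =
    \prod_(z <- rs) \prod_(b <- bs) (b - z).
  elim: rs => [|r rs IH]; first by rewrite !big_nil rmorph1 det1.
  rewrite !big_cons rmorphM -[X in \det X]/(horner_mx A _ *m horner_mx A _).
  by rewrite det_mulmx IH hX detX.
rewrite linearZ /= detZ dp -powbs.
rewrite exchange_big /= -big_split /=.
apply: eq_bigr => b _; rewrite hornerZ horner_prod; congr (_ * _).
by apply: eq_bigr => r _; rewrite !hornerE.
Qed.

(** The product over the roots [b] of [g] is the norm of [Q(x, .)] from [Z[X]/(g)],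
    that is, the determinant of [Q(x, .)] at the companion matrix of [g], whose
    entries are integers. *)
Lemma norm_poly_int (F : closedFieldType) (g : {poly int}) (bs : seq F)
    (Q : {poly {poly int}}) :
  g \is monic -> map_poly intr g = \prod_(b <- bs) ('X - b%:P) ->
  exists T : {poly int}, forall x,
    (map_poly intr T).[x] = \prod_(b <- bs) (map_poly (map_poly intr) Q).[x, b].
Proof.
move=> gm gbs.
have szg : size g = (size bs).+1.
  rewrite -(size_prod_XsubC _ id) -gbs.
  by rewrite size_map_poly_id0// (monicP gm) rmorph1 oner_neq0.
case: bs gbs szg => [|b0 bs] gbs szg.
  by exists 1 => x; rewrite big_nil rmorph1 hornerC.
pose n := size bs; have [A cA] : exists A : 'M[int]_n.+1, char_poly A = g.
  have := companionmxK gm; move: (companionmx g).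
  by rewrite szg /= => A cA; exists A.
exists (\det (horner_mx (map_mx polyC A) (swapXY Q))) => x.
pose e : {rmorphism {poly int} -> F} := horner_eval x \o map_poly intr.
have -> : forall q, (map_poly intr q).[x] = e q by [].
rewrite -det_map_mx map_horner_mx -map_mx_comp.
rewrite (_ : map_mx (e \o polyC) A = map_mx intr A); last first.
  by apply/matrixP => i j; rewrite !mxE /e /= map_polyC horner_evalE hornerC.
rewrite (@det_horner_mx _ _ _ (b0 :: bs)) -?gbs -?cA ?map_char_poly//.
apply: eq_bigr => b _; rewrite /e map_poly_comp -horner_swapXY.
by rewrite -swapXY_map swapXYK.
Qed.

(** * Kronecker's theorem for orbits *)

Section Kronecker.
Variable R : realType.
Implicit Types (f g q T : {poly int}) (z w a : R[i]) (zs : seq R[i]).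

Lemma cmod_ge0 z : 0 <= cmod z.
Proof. by case: z => a b /=; exact: sqrtr_ge0. Qed.

Lemma normcE_cmod z : `|z| = (cmod z)%:C%C.
Proof. by []. Qed.

Lemma cmod_int (m : int) : cmod (m%:~R : R[i]) = `|m|%:~R.
Proof.
have -> : m%:~R = (m%:~R)%:C%C :> R[i] by rewrite rmorph_int.
by rewrite /= expr0n addr0 sqrtr_sqr intr_norm.
Qed.

Lemma cmod0 : cmod (0 : R[i]) = 0.
Proof. exact: ComplexField.Normc.normc0. Qed.

Lemma cmod1 : cmod (1 : R[i]) = 1.
Proof. exact: ComplexField.Normc.normc1. Qed.

Lemma cmodM z w : cmod (z * w) = cmod z * cmod w.
Proof. exact: ComplexField.Normc.normcM. Qed.

Lemma cmodN z : cmod (- z) = cmod z.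
Proof. exact: normcN. Qed.

Lemma cmodBC z w : cmod (z - w) = cmod (w - z).
Proof. by rewrite -cmodN opprB. Qed.

Lemma cmod_triangle z w : cmod (z + w) <= cmod z + cmod w.
Proof. exact: le_normcD. Qed.

Lemma cmod_triangleB x z w : cmod (z - w) <= cmod (z - x) + cmod (x - w).
Proof. by rewrite (le_trans _ (cmod_triangle _ _))// addrA subrK. Qed.

Lemma cmod_eq0 z : (cmod z == 0) = (z == 0).
Proof.
by apply/eqP/eqP => [/ComplexField.Normc.eq0_normc//|->]; rewrite cmod0.
Qed.

Lemma cmod_gt0 z : (0 < cmod z) = (z != 0).
Proof. by rewrite lt_def cmod_ge0 andbT cmod_eq0. Qed.

Lemma cmodX z n : cmod (z ^+ n) = cmod z ^+ n.
Proof.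
elim: n => [|n IH]; first by rewrite !expr0 cmod1.
by rewrite !exprS cmodM IH.
Qed.

Lemma cmod_prod (I : Type) (r : seq I) (F : I -> R[i]) :
  cmod (\prod_(i <- r) F i) = \prod_(i <- r) cmod (F i).
Proof.
elim: r => [|i r IH]; first by rewrite !big_nil cmod1.
by rewrite !big_cons cmodM IH.
Qed.

Lemma cmod_coef_prod_XsubC (B : R) zs i : 0 <= B ->
  (forall z, z \in zs -> cmod z <= B) ->
  cmod (\prod_(z <- zs) ('X - z%:P))`_i <= (1 + B) ^+ size zs.
Proof.
move=> B0; elim: zs i => [|z zs IH] i zB.
  rewrite big_nil coef1 expr0; case: (i == 0)%N.
    by rewrite mulr1n cmod1.
  by rewrite mulr0n cmod0.
have {}IH j := IH j (fun w h => zB w (mem_behead (s := z :: zs) h)).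
rewrite big_cons mulrBl coefB coefXM coefCM /= exprS.
rewrite (le_trans (cmod_triangle _ _))// cmodN cmodM mulrDl mul1r.
rewrite lerD//; last first.
  by rewrite ler_pM ?cmod_ge0// zB ?mem_head.
by case: eqP => _; rewrite ?IH// cmod0 exprn_ge0// addr_ge0.
Qed.

(** Encoding coefficients in [-K, K] by ordinals makes these polynomials a finite
    family, as the pigeonhole step of Kronecker's argument requires. *)
Definition small_poly N K (c : {ffun 'I_N.+1 -> 'I_(K + K).+1}) : {poly int} :=
  \poly_(i < N.+1) (if insub i is Some j then (c j)%:Z - K%:Z else 0).

Lemma small_polyP N K q : (size q <= N.+1)%N -> (forall i, `|q`_i| <= K%:Z) ->
  exists c, @small_poly N K c = q.
Proof.
move=> sq cq; exists [ffun i : 'I_N.+1 => inord (absz (q`_i + K%:Z))].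
apply/polyP => i; rewrite coef_poly.
case: ltnP => [iN|Ni]; last by rewrite nth_default// (leq_trans sq Ni).
rewrite insubT ffunE /= inordK.
  rewrite gez0_abs ?addrK// -lerBlDr sub0r.
  by have := cq i; rewrite ler_norml => /andP[].
have := cq i; rewrite ler_norml => /andP[h1 h2].
by move: (q`_i) h1 h2 => m; lia.
Qed.

Lemma iter_poly f k : exists fk : {poly int},
  forall z, (map_poly intr fk).[z] = iter k (poly_fun f) z :> R[i].
Proof.
elim: k => [|k [fk IH]]; first by exists 'X => z; rewrite map_polyX hornerX.
by exists (f \Po fk) => z; rewrite map_comp_poly horner_comp IH.
Qed.

Lemma poly_eq_horner (p q : {poly R[i]}) : (forall x, p.[x] = q.[x]) -> p = q.
Proof.
move=> pq; apply/eqP; rewrite -subr_eq0; apply/eqP.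
apply: (@roots_geq_poly_eq0 _ _ [seq (i%:R : R[i]) | i <- iota 0 (size (p - q)).+1]).
- by apply/allP => x _; rewrite rootE hornerD hornerN pq subrr.
- by rewrite map_inj_uniq ?iota_uniq// => i j /eqP; rewrite eqr_nat => /eqP.
- by rewrite size_map size_iota.
Qed.

(** The images of the roots of [T] under [f^k] are the roots of a monic integer
    polynomial of the same degree, with coefficients bounded independently of [k].
    Finitely many such polynomials exist, so the orbit of [z] takes finitely many
    values. *)
Lemma kronecker f T zs (B : R) :
  T \is monic -> map_poly intr T = \prod_(z <- zs) ('X - z%:P) ->
  (forall k z, z \in zs -> cmod (iter k (poly_fun f) z) <= B) ->
  forall z, z \in zs -> preperiodic f z.
Proof.
move=> Tm Tzs bd z zzs.
have B0 : 0 <= B by rewrite (le_trans _ (bd 0 z zzs))// cmod_ge0.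
pose N := size zs; pose K := Num.truncn ((1 + B) ^+ N).
(* All the roots of the finitely many admissible polynomials. *)
pose L := flatten [seq sval (closed_field_poly_normal
   (map_poly intr (small_poly c) : {poly R[i]})) | c : {ffun 'I_N.+1 -> 'I_(K + K).+1}].
have inL k : iter k (poly_fun f) z \in L.
  have [fk fkE] := iter_poly f k.
  have [Tk TkE] := norm_poly_int ('X - fk%:P) Tm Tzs.
  have {}TkE : map_poly intr Tk =
      \prod_(w <- map (iter k (poly_fun f)) zs) ('X - w%:P).
    apply: poly_eq_horner => x; rewrite TkE horner_prod big_map.
    apply: eq_bigr => w _.
    rewrite rmorphB /= map_polyX map_polyC /= -fkE.
    by rewrite !hornerE.
  have szTk : size Tk = N.+1.
    rewrite /N -(size_map (iter k (poly_fun f)) zs) -(size_prod_XsubC _ id) -TkE.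
    by rewrite size_map_inj_poly ?rmorph0//; exact: intr_inj.
  have cTk i : `|Tk`_i| <= K%:Z.
    have h : cmod ((map_poly intr Tk)`_i : R[i]) <= (1 + B) ^+ N.
      rewrite TkE /N -(size_map (iter k (poly_fun f)) zs).
      by apply: cmod_coef_prod_XsubC => // _ /mapP[w wzs ->]; exact: bd.
    rewrite coef_map /= cmod_int in h.
    have a0 : (0 <= `|Tk`_i|)%R by rewrite normr_ge0.
    rewrite -(gez0_abs a0) lez_nat /K.
    rewrite truncn_ge_nat ?exprn_ge0 ?addr_ge0//.
  have [c cE] := @small_polyP N K Tk (eq_leq szTk) cTk.
  apply/flattenP; exists (sval (closed_field_poly_normal
     (map_poly intr (small_poly c) : {poly R[i]}))).
    by apply/mapP; exists c; rewrite ?mem_enum.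
  case: closed_field_poly_normal => rs /= rsE.
  rewrite -root_prod_XsubC -(@rootZ _ _ (lead_coef (map_poly intr (small_poly c) : {poly R[i]}))).
    rewrite -rsE cE TkE root_prod_XsubC; exact: map_f.
  by rewrite cE TkE (monicP (monic_prod_XsubC _ _ _)) oner_eq0.
have /uniqPn : ~~ uniq [seq iter k (poly_fun f) z | k <- iota 0 (size L).+1].
  apply/negP => /uniq_leq_size-/(_ L); rewrite size_map size_iota ltnn.
  suff h : {subset [seq iter k (poly_fun f) z | k <- iota 0 (size L).+1] <= L} by move/(_ h).
  by move=> _ /mapP[k _ ->].
move=> /(_ 0)[i [j [ij jL ijE]]]; rewrite size_map size_iota in jL.
exists i, j; split => //.
rewrite !(nth_map 0) ?size_iota ?(ltn_trans ij)// !nth_iota ?(ltn_trans ij)// in ijE.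
Qed.
End Kronecker.

(** * Topology of the plane *)

Section PlaneTopology.
Variable R : realType.
Implicit Types (z w a u : R[i]) (rs : seq R[i]) (A : set (Cplx R)).

Lemma nbhs_CplxP (z : Cplx R) A :
  nbhs z A <-> exists2 e : R, 0 < e & forall w : R[i], cmod (w - z) < e -> A w.
Proof.
split=> [/nbhs_ballP[e /= e0 eA]|[e e0 eA]].
  exists (complex.Re e).
    by move: e0; rewrite ltcE => /andP[].
  move=> w wz; apply: eA; rewrite -ball_normE /= normcE_cmod.
  move: e0; rewrite !ltcE /= => /andP[/eqP -> _]; rewrite eqxx /=.
  by rewrite cmodBC.
apply/nbhs_ballP; exists (e%:C%C); first by rewrite /= ltcR.
by move=> w; rewrite -ball_normE /= normcE_cmod ltcR cmodBC => /eA.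
Qed.

Lemma open_CplxP A : open A <->
  forall z, A z -> exists2 e : R, 0 < e & forall w : R[i], cmod (w - z) < e -> A w.
Proof.
rewrite openE; split=> [oA z /oA/nbhs_CplxP//|oA z /oA h].
exact/nbhs_CplxP.
Qed.

Lemma closed_CplxP A : closed A <->
  forall z : R[i], (forall e : R, 0 < e -> exists2 w, A w & cmod (w - z) < e) -> A z.
Proof.
split=> [cA z zA|cA z zA].
  apply: cA => B /nbhs_CplxP[e /zA[w Aw wz] eB]; exists w; split => //.
  exact: eB.
apply: cA => e e0; have [|w [Aw wB]] := zA [set w : Cplx R | cmod ((w : R[i]) - z) < e].
  by apply/nbhs_CplxP; exists e.
by exists w.
Qed.

Lemma open_ballC z (e : R) : open ([set w | cmod (w - z) < e] : set (Cplx R)).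
Proof.
apply/open_CplxP => w /= wz; exists (e - cmod (w - z)); first by rewrite subr_gt0.
move=> v vw; rewrite (le_lt_trans (cmod_triangleB w _ _))//.
by rewrite -ltrBrDr.
Qed.

(** If all roots were at distance at least [e], the product of the distances would
    be at least [e ^+ size rs]. *)
Lemma near_root (p : {poly R[i]}) rs z (e : R) : (0 < size rs)%N -> 0 <= e ->
  p = \prod_(r <- rs) ('X - r%:P) -> cmod p.[z] < e ^+ size rs ->
  exists2 r, r \in rs & cmod (z - r) < e.
Proof.
move=> rs0 e0 ->; rewrite horner_prod cmod_prod => h.
apply: contrapT => hn; move: h; apply/negP; rewrite -leNgt.
have {}hn r : r \in rs -> e <= cmod (z - r).
  by move=> rrs; rewrite leNgt; apply/negP => re; apply: hn; exists r.
elim: rs hn {rs0} => [|r rs IH] hn; first by rewrite big_nil expr0.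
rewrite big_cons exprS !hornerE ler_pM ?exprn_ge0//.
  by rewrite hn ?mem_head.
by apply: IH => s srs; apply: hn; rewrite inE srs orbT.
Qed.

Lemma horner_cmod_continuous (p : {poly R[i]}) z (e : R) : 0 < e ->
  exists2 dl : R, 0 < dl & forall w, cmod (w - z) < dl -> cmod (p.[w] - p.[z]) < e.
Proof.
elim/poly_ind: p e => [|p c IH] e e0.
  by exists 1 => // w _; rewrite !horner0 subrr cmod0.
have [d1 d10 h1] := IH 1 ltr01.
pose M := 1 + cmod p.[z]; have M0 : 0 < M by rewrite ltr_pwDl ?cmod_ge0.
pose N := 1 + cmod z; have N0 : 0 < N by rewrite ltr_pwDl ?cmod_ge0.
have [|d2 d20 h2] := IH (e / 2 / N); first by rewrite !divr_gt0.
exists (Num.min d1 (Num.min d2 (e / 2 / M))).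
  by rewrite !lt_min d10 d20 !divr_gt0.
move=> w; rewrite !lt_min => /and3P[/h1 w1 /h2 w2 w3].
rewrite !hornerE.
have -> : p.[w] * w + c - (p.[z] * z + c) = p.[w] * (w - z) + (p.[w] - p.[z]) * z.
  by ring.
rewrite (le_lt_trans (cmod_triangle _ _))// (splitr e) !cmodM ltr_leD//.
  rewrite (@le_lt_trans _ _ (M * cmod (w - z)))//; last first.
    by rewrite mulrC -ltr_pdivlMr.
  rewrite ler_wpM2r ?cmod_ge0// -(subrK p.[z] p.[w]) (le_trans (cmod_triangle _ _))//.
  by rewrite lerD2r ltW.
rewrite (@le_trans _ _ (e / 2 / N * cmod z))//.
  by rewrite ler_wpM2r ?cmod_ge0// ltW.
by rewrite mulrAC ler_pdivrMr// ler_pM2l ?divr_gt0// lerDr.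
Qed.

End PlaneTopology.

(** * Filled Julia set and Julia set *)

Section PolynomialDynamics.
Variables (R : realType) (f : {poly int}).
Hypotheses (fm : f \is monic) (fd : (2 <= (size f).-1)%N).
Implicit Types (z w a u : R[i]) (rs : seq R[i]).
Local Notation F := (@poly_fun R f).
Local Notation d := (size f).-1.
Local Notation K := (@filled_julia R f).
Local Notation J := (@julia R f).

Lemma poly_fun_fiber u : exists rs : seq R[i],
  size rs = d /\ map_poly intr f - u%:P = \prod_(r <- rs) ('X - r%:P).
Proof.
have [rs rsE] := closed_field_poly_normal (map_poly intr f - u%:P).
have su : (size (- u%:P) < size (map_poly intr f : {poly R[i]}))%N.
  rewrite size_polyN size_polyC size_map_inj_poly ?rmorph0//; last exact: intr_inj.
  by rewrite (leq_ltn_trans (leq_b1 _))// (leq_trans fd) ?leq_pred.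
have lc : lead_coef (map_poly intr f - u%:P) = 1 :> R[i].
  by rewrite lead_coefDl// lead_coef_map_inj ?rmorph0// ?(monicP fm)//; exact: intr_inj.
rewrite lc scale1r in rsE; exists rs; split => //.
have := size_prod_XsubC rs id; rewrite -rsE size_polyDl// size_map_inj_poly ?rmorph0//.
  by move=> -> .
exact: intr_inj.
Qed.

Lemma fiberP u rs z : map_poly intr f - u%:P = \prod_(r <- rs) ('X - r%:P) ->
  (z \in rs) = (F z == u).
Proof.
move=> rsE; rewrite -root_prod_XsubC -rsE rootE !hornerE subr_eq0.
by rewrite /poly_fun.
Qed.

Lemma fiber_cmod u rs z : map_poly intr f - u%:P = \prod_(r <- rs) ('X - r%:P) ->
  cmod (F z - u) = \prod_(r <- rs) cmod (z - r).
Proof.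
move=> rsE; rewrite -cmod_prod; congr cmod.
have -> : F z - u = (map_poly intr f - u%:P).[z] by rewrite !hornerE.
by rewrite rsE horner_prod; apply: eq_bigr => r _; rewrite !hornerE.
Qed.

(** Beyond twice the largest root of [f] every linear factor is at least half of
    [cmod z], and two such factors already give [2 * cmod z] once [8 <= cmod z]. *)
Lemma escape_radius : exists2 B : R, 1 <= B &
  forall z, B < cmod z -> 2 * cmod z <= cmod (F z).
Proof.
have [rs [srs rsE]] := poly_fun_fiber 0.
pose rho := \sum_(r <- rs) cmod r.
have rho0 : 0 <= rho by rewrite sumr_ge0// => r _; exact: cmod_ge0.
have rrho r : r \in rs -> cmod r <= rho.
  move=> rrs; rewrite /rho (big_rem r)//= lerDl sumr_ge0// => s _; exact: cmod_ge0.
exists (2 * rho + 8); first by lra.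
move=> z hz.
have -> : cmod (F z) = cmod (F z - 0) by rewrite subr0.
rewrite (fiber_cmod z rsE).
have h r : r \in rs -> cmod z / 2 <= cmod (z - r).
  move=> /rrho rr; have := cmod_triangle (z - r) r; rewrite subrK; lra.
apply: (@le_trans _ _ ((cmod z / 2) ^+ d)).
  apply: (@le_trans _ _ ((cmod z / 2) ^+ 2)); last first.
    by rewrite ler_weXn2l//; lra.
  rewrite expr2; nra.
rewrite -srs; clear rsE srs; clearbody rho; clear rrho.
elim: rs h => [|r rs IH] h; first by rewrite big_nil expr0.
rewrite exprS big_cons ler_pM ?exprn_ge0//; try lra.
  by rewrite h ?mem_head.
by apply: IH => s srs; rewrite h// inE srs orbT.
Qed.

Definition escape_bound := sval (cid2 escape_radius).
Local Notation B := escape_bound.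

Lemma escape_bound_ge1 : 1 <= B.
Proof. by rewrite /B; case: cid2. Qed.

Lemma escape_boundP z : B < cmod z -> 2 * cmod z <= cmod (F z).
Proof. by rewrite /B; case: cid2 => b _ /= h; exact: h. Qed.

(** An orbit that leaves the disc of radius [escape_bound] doubles in size from then
    on. *)
Lemma filled_juliaP z : K z <-> forall n, cmod (iter n F z) <= B.
Proof.
split=> [Kz n|bd].
  rewrite leNgt; apply/negP => hn; apply: Kz.
  have h k : 2 ^+ k * B < cmod (iter (k + n) F z).
    elim: k => [|k IH]; first by rewrite expr0 mul1r.
    have B1 := escape_bound_ge1.
    have hk : B < cmod (iter (k + n) F z).
      rewrite (le_lt_trans _ IH)// ler_peMl ?(le_trans ler01)//.
      by rewrite exprn_ege1// ler1n.
    rewrite addSn iterS (lt_le_trans _ (escape_boundP hk))//.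
    by rewrite exprS -mulrA ltr_pM2l.
  apply/cvgryPge => A.
  have [k Ak] : exists k, A <= 2 ^+ k * B.
    exists (Num.truncn `|A|).+1.
    have B1 := escape_bound_ge1.
    have hk k : (k%:R <= 2 ^+ k :> R) by rewrite -natrX ler_nat ltnW// ltn_expl.
    apply: (le_trans (ler_norm A)); apply: (le_trans (ltW (truncnS_gt _))).
    by apply: (le_trans (hk _)); rewrite ler_peMr// exprn_ge0.
  exists (k + n)%N => //= m knm.
  have -> : m = ((m - (k + n)) + k + n)%N by rewrite -addnA subnK.
  apply: (le_trans Ak); apply: (le_trans _ (ltW (h _))).
  have B1 := escape_bound_ge1.
  rewrite ler_wpM2r ?(le_trans ler01)// exprD ler_peMl ?exprn_ge0//.
  by rewrite exprn_ege1// ler1n.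
move=> /cvgryPge/(_ (B + 1))[n _ /(_ n (leqnn n))] /=.
by rewrite leNgt => /negP; apply; rewrite (le_lt_trans (bd n))// ltrDl.
Qed.

Lemma filled_julia_bounded z : K z -> cmod z <= B.
Proof. by move=> /filled_juliaP/(_ 0%N). Qed.

Lemma filled_julia_poly_fun z : K (F z) <-> K z.
Proof.
split => /filled_juliaP h; apply/filled_juliaP => n.
  have [B1 hB] := (escape_bound_ge1, @escape_boundP).
  case: n => [|n]; last by rewrite iterSr.
  rewrite /= leNgt; apply/negP => zB; have := hB _ zB; have := h 0%N => /=; lra.
by rewrite -iterSr.
Qed.

Lemma poly_fun_iter n : exists p : {poly R[i]}, forall z, iter n F z = p.[z].
Proof.
by have [fk h] := iter_poly R f n; exists (map_poly intr fk) => z; rewrite h.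
Qed.

Lemma filled_julia_closed : closed K.
Proof.
apply/closed_CplxP => z zK; apply/filled_juliaP => n.
have [p pE] := poly_fun_iter n.
apply/ler_addgt0Pr => e e0; rewrite pE.
have [dl dl0 hdl] := horner_cmod_continuous p z e0.
have [w /filled_juliaP/(_ n) Kw /hdl] := zK _ dl0.
rewrite pE in Kw; rewrite cmodBC => h.
have := cmod_triangle (p.[z] - p.[w]) p.[w]; rewrite subrK; lra.
Qed.

Lemma juliaP z : J z <->
  K z /\ forall e : R, 0 < e -> exists2 w : R[i], cmod (w - z) < e & ~ K w.
Proof.
rewrite /julia -(proj1 (closure_id _) filled_julia_closed).
split=> [[Kz nz]|[Kz hz]]; split => //.
  move=> e e0; apply: contrapT => h; apply: nz.
  apply/nbhs_CplxP; exists e => // w wz; apply: contrapT => Kw.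
  by apply: h; exists w.
by move=> /nbhs_CplxP[e e0 he]; have [w /he] := hz _ e0.
Qed.

Lemma julia_filled z : J z -> K z.
Proof. by case/juliaP. Qed.

Lemma julia_closed : closed J.
Proof.
apply/closed_CplxP => z zJ; apply/juliaP; split.
  have /closed_CplxP cK := filled_julia_closed; apply: cK => e /zJ[w /julia_filled Kw wz].
  by exists w.
move=> e e0; have e20 : 0 < e / 2 by rewrite divr_gt0.
have [w /juliaP[_ /(_ _ e20)[v vw Kv]] wz] := zJ _ e20.
exists v => //; rewrite (le_lt_trans (cmod_triangleB w _ _))// (splitr e).
exact: ltrD.
Qed.

(** Points escaping near [F z] pull back to points escaping near [z]. *)
Lemma julia_preimage z : J (F z) -> J z.
Proof.
move=> /juliaP[KFz hz]; apply/juliaP; split; first exact/filled_julia_poly_fun.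
move=> e e0; have [u uz Ku] := hz (e ^+ d) (exprn_gt0 _ e0).
have [rs [srs rsE]] := poly_fun_fiber u.
have [||r rrs zr] := @near_root R _ rs z e _ (ltW e0) rsE.
- by rewrite srs (leq_trans _ fd).
- by rewrite srs !hornerE cmodBC.
exists r; first by rewrite cmodBC.
move: rrs; rewrite (fiberP _ rsE) => /eqP ru.
by rewrite -filled_julia_poly_fun ru.
Qed.

End PolynomialDynamics.

(** * Existence of infinitely many preperiodic points *)

Section Preperiodic.
Variables (R : realType) (f : {poly int}).
Hypotheses (fm : f \is monic) (fd : (2 <= (size f).-1)%N).
Implicit Types (z w a u : R[i]) (rs : seq R[i]).
Local Notation F := (@poly_fun R f).
Local Notation d := (size f).-1.

Lemma preperiodic_preimage z : preperiodic f (F z) -> preperiodic f z.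
Proof.
move=> [m [n [mn h]]]; exists m.+1, n.+1; split => //.
by rewrite !iterSr.
Qed.

Lemma preperiodic_fixed z : F z = z -> preperiodic f z.
Proof. by move=> h; exists 0%N, 1%N. Qed.

Lemma fixed_point_exists : exists z, F z = z.
Proof.
have s : size (map_poly intr f - 'X : {poly R[i]}) = size f.
  have sf : size (map_poly intr f : {poly R[i]}) = size f.
    by rewrite size_map_inj_poly ?rmorph0//; exact: intr_inj.
  by rewrite size_polyDl// sf size_polyN size_polyX; case: (size f) fd.
have /closed_rootP[z] : size (map_poly intr f - 'X : {poly R[i]}) != 1%N.
  by rewrite s; case: (size f) fd => [//|[]].
by rewrite rootE !hornerE subr_eq0 => /eqP h; exists z.
Qed.

(** On a finite set of preperiodic points, closed under preimages, [f] would be a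
    bijection, so [f - u] would be a [d]-th power for each preperiodic [u]. The
    derivative of [f] then has a single root, which leaves one preperiodic point
    [z], and [f] is [('X - z) ^+ d + z]; but that polynomial also fixes [z + 1]. *)
Lemma infinite_preperiodic : infinite_set [set z : R[i] | preperiodic f z].
Proof.
move=> /finite_seqP[s0 s0E]; pose s := undup s0.
have us : uniq s := undup_uniq s0.
have sP z : z \in s <-> preperiodic f z.
  rewrite mem_undup.
  by have := congr1 (fun A : set R[i] => A z) s0E => /= ->.
have root_ex u : exists r, F r = u.
  have [rs [srs rsE]] := poly_fun_fiber fm fd u.
  case: rs srs rsE => [/= h|r rs _ rsE]; first by move: fd; rewrite -h.
  by exists r; apply/eqP; rewrite -(fiberP _ rsE) mem_head.
pose r u := sval (cid (root_ex u)).
have rE u : F (r u) = u by rewrite /r; case: cid.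
have rs u : u \in s -> r u \in s.
  by move=> /sP us'; apply/sP; apply: preperiodic_preimage; rewrite rE.
have rinj : injective r by move=> u v uv; rewrite -(rE u) uv rE.
have rsurj z : z \in s -> z = r (F z).
  have [_ h] : (size (map r s) = size s) * (map r s =i s).
    apply: uniq_min_size; rewrite ?map_inj_uniq ?size_map//.
    by move=> _ /mapP[u us' ->]; exact: rs.
  by rewrite -h => /mapP[u _ ->]; rewrite rE.
(* [f] is injective on the finite set, so its fibres there are full powers. *)
have fpow u : u \in s -> map_poly intr f = ('X - (r u)%:P) ^+ d + u%:P.
  move=> us'; have [zs [szs zsE]] := poly_fun_fiber fm fd u.
  rewrite -[LHS](subrK u%:P) zsE; congr (_ + _).
  rewrite -szs -iter_mulr_1 -(count_predT zs) -big_const_seq /=.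
  apply: eq_big_seq => z; rewrite (fiberP _ zsE) => /eqP zu.
  rewrite [in LHS](rsurj z) ?zu//.
  by apply/sP; apply: preperiodic_preimage; rewrite zu; exact/sP.
have inS1 u v : u \in s -> v \in s -> u = v.
  move=> /fpow fu /fpow; rewrite {1}fu => /(congr1 (fun p => p^`().[r v])).
  rewrite /= !derivD !derivC !addr0 !deriv_exp !derivXsubC !mul1r.
  rewrite !(hornerMn, horner_exp, hornerE) subrr.
  have d1 : (0 < d.-1)%N by case: d fd => [|[]].
  rewrite expr0n (gtn_eqF d1) mul0rn => /eqP; rewrite mulrn_eq0.
  rewrite (gtn_eqF (leq_trans _ fd))//= expf_eq0 d1 /= subr_eq0 => /eqP/rinj.
  by [].
have [z Fz] := fixed_point_exists.
have zs : z \in s by apply/sP; exact: preperiodic_fixed.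
have zE : r z = z by have := rsurj z zs; rewrite Fz.
have Fz1 : F (z + 1) = z + 1.
  rewrite /poly_fun (fpow z zs) !(horner_exp, hornerE) zE addrAC subrr add0r.
  by rewrite expr1n addrC.
have : z + 1 = z by apply: inS1 => //; apply/sP; exact: preperiodic_fixed.
by move/eqP; rewrite -subr_eq0 addrAC subrr add0r oner_eq0.
Qed.
End Preperiodic.

(** * Preperiodic points on curves *)

Section Specialization.
Variable R : realType.
Implicit Types (P : {poly {poly int}}) (x y : R[i]).

(** [P] read as a polynomial in its first variable, the second being set to [y]. *)
Definition specialize P y : {poly R[i]} :=
  map_poly (horner_eval y \o map_poly intr) P.

Lemma eval2E P x y : eval2 P x y = (specialize P y).[x].
Proof.
rewrite /eval2 /specialize map_poly_comp.
by rewrite -(horner_swapXY (map_poly _ P)) horner2_swapXY.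
Qed.

Lemma specialize_coef P y i : (specialize P y)`_i = (map_poly intr P`_i).[y].
Proof. by rewrite coef_map. Qed.

Lemma size_specialize P y : (map_poly intr (lead_coef P)).[y] != 0 ->
  size (specialize P y) = size P.
Proof. by move=> h; rewrite size_map_poly_id0. Qed.

Lemma lead_coef_specialize P y : (map_poly intr (lead_coef P)).[y] != 0 ->
  lead_coef (specialize P y) = (map_poly intr (lead_coef P)).[y].
Proof.
by move=> h; rewrite lead_coefE size_specialize// specialize_coef -lead_coefE.
Qed.

End Specialization.

Section KroneckerFilledJulia.
Variables (R : realType) (f : {poly int}).
Hypotheses (fm : f \is monic) (fd : (2 <= (size f).-1)%N).
Implicit Types (z w a u x y : R[i]) (T b : {poly int}) (P : {poly {poly int}}).
Local Notation F := (@poly_fun R f).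
Local Notation d := (size f).-1.
Local Notation K := (@filled_julia R f).

Lemma kronecker_filled_julia T : `|lead_coef T| = 1 ->
  (forall z, root (map_poly intr T) z -> K z) ->
  forall z, root (map_poly intr T) z -> preperiodic f z.
Proof.
move=> lT TK z Tz; pose c := lead_coef T.
have cc : c * c = 1 by rewrite -expr2 -(@real_normK _ c) ?num_real// lT expr1n.
have cm : c *: T \is monic by rewrite monicE lead_coefZ cc.
have rcT w : root (map_poly intr (c *: T)) w = root (map_poly intr T : {poly R[i]}) w.
  rewrite map_polyZ rootZ// intr_eq0; apply/eqP => c0.
  by move: cc; rewrite c0 mul0r => /eqP; rewrite eq_sym oner_eq0.
have [zs zsE] := closed_field_poly_normal (map_poly intr (c *: T) : {poly R[i]}).
rewrite lead_coef_map_inj ?rmorph0// ?(monicP cm) ?scale1r in zsE; last exact: intr_inj.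
have := @kronecker R f _ zs (escape_bound R fm fd) cm zsE; apply => [k w|].
  rewrite -root_prod_XsubC -zsE rcT => /TK/(filled_juliaP fm fd); exact.
by rewrite -root_prod_XsubC -zsE rcT.
Qed.

Lemma iter_poly_monic k : exists fk : {poly int}, [/\ fk \is monic,
  (size fk).-1 = (d ^ k)%N & forall z, (map_poly intr fk).[z] = iter k F z].
Proof.
elim: k => [|k [fk [fkm sfk IH]]].
  by exists 'X; rewrite monicX size_polyX; split => // z; rewrite map_polyX hornerX.
exists (f \Po fk); split.
- rewrite monicE lead_coef_comp; first by rewrite (monicP fm) (monicP fkm) expr1n mulr1.
  have : (0 < d ^ k)%N by rewrite expn_gt0 (leq_trans _ fd).
  by rewrite -sfk; case: (size fk) => [|[]].
- by rewrite size_comp_poly sfk expnS.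
- by move=> z; rewrite map_comp_poly horner_comp IH.
Qed.

(** The equation [f^n y = f^m y] is monic with integer coefficients, because [f^n]
    has larger degree than [f^m]. *)
Lemma preperiodic_poly y : preperiodic f y -> exists g : {poly int},
  [/\ g \is monic, root (map_poly intr g) y &
      forall z, root (map_poly intr g) z -> preperiodic f z].
Proof.
move=> [m [n [mn h]]].
have [fm' [fmm sfm fmE]] := iter_poly_monic m.
have [fn [fnm sfn fnE]] := iter_poly_monic n.
have gE z : (map_poly intr (fn - fm')).[z] = iter n F z - iter m F z.
  by rewrite rmorphB /= !hornerE fnE fmE.
exists (fn - fm'); split.
- rewrite monicE lead_coefDl ?(monicP fnm)// size_polyN.
  have : ((size fm').-1 < (size fn).-1)%N by rewrite sfn sfm ltn_exp2l.
  by case: (size fm') => [|?]; case: (size fn).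
- by rewrite rootE gE h subrr.
- by move=> z; rewrite rootE gE subr_eq0 => /eqP zmn; exists m, n.
Qed.

(** The norm [T] of [P(x, .)] along the roots of a monic integer polynomial killing
    [y] has leading coefficient [1] or [-1], and all its roots lie over preperiodic
    points, hence in the filled Julia set; Kronecker's argument applies to [T]. *)
Lemma preperiodic_fiber P y : (1 < size P)%N ->
  (exists2 c : int, lead_coef P = c%:P & `|c| = 1) ->
  (forall x z, preperiodic f z -> eval2 P x z = 0 -> K x) ->
  preperiodic f y -> exists x, eval2 P x y = 0 /\ preperiodic f x.
Proof.
move=> sP [c lP c1] PK py.
have [g [gm gy gpre]] := preperiodic_poly py.
have [ys ysE] := closed_field_poly_normal (map_poly intr g : {poly R[i]}).
rewrite lead_coef_map_inj ?rmorph0// ?(monicP gm) ?scale1r in ysE; last exact: intr_inj.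
have [T TE] := norm_poly_int P gm ysE.
have c0 : (c%:~R : R[i]) != 0.
  by rewrite intr_eq0; apply/eqP => c0; move: c1; rewrite c0 normr0.
have lPy z : (map_poly intr (lead_coef P)).[z] = c%:~R :> R[i].
  by rewrite lP map_polyC hornerC.
have TP : map_poly intr T = \prod_(z <- ys) specialize P z.
  apply: poly_eq_horner => x; rewrite TE horner_prod.
  by apply: eq_bigr => z _; rewrite -eval2E.
have lT : `|lead_coef T| = 1.
  apply: (@intr_inj R); rewrite -cmod_int.
  rewrite -[X in cmod X](lead_coef_map_inj intr_inj) ?rmorph0// TP lead_coef_prod cmod_prod.
  rewrite big1 ?rmorph1// => z _.
  by rewrite lead_coef_specialize lPy// cmod_int c1.
have rT x : root (map_poly intr T) x -> exists2 z, z \in ys & eval2 P x z = 0.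
  rewrite rootE TE prodf_seq_eq0 => /hasP[z zys /eqP h]; by exists z.
have ypre z : z \in ys -> preperiodic f z.
  by move=> zys; apply: gpre; rewrite ysE root_prod_XsubC.
have [x Px] : exists x, root (specialize P y) x.
  by apply/closed_rootP; rewrite size_specialize ?lPy//; case: (size P) sP => [|[]].
exists x; split; first by rewrite eval2E; exact/eqP.
apply: (kronecker_filled_julia lT).
  by move=> w /rT[z zys]; apply: PK; exact: ypre.
rewrite rootE TE prodf_seq_eq0; apply/hasP; exists y.
  by rewrite -root_prod_XsubC -ysE.
by apply/eqP; rewrite -/(eval2 P x y) eval2E; exact/eqP.
Qed.

End KroneckerFilledJulia.

(** * Borel measurability in the plane *)

Section BorelPlane.
Variable R : realType.
Implicit Types (z w a u : R[i]) (A : set (borelC R)).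

Lemma open_borelC A : open (A : set (Cplx R)) -> measurable A.
Proof. by move=> oA; exact: sub_sigma_algebra. Qed.

Lemma closed_borelC A : closed (A : set (Cplx R)) -> measurable A.
Proof.
by move=> cA; rewrite -(setCK A); apply: measurableC; apply: open_borelC; exact: closed_openC.
Qed.

Lemma closed_set1C a : closed ([set a] : set (Cplx R)).
Proof.
apply/closed_CplxP => z za; apply: contrapT => /eqP; rewrite -subr_eq0 -cmod_gt0 => h.
by have [w /= ->] := za _ h; rewrite cmodBC ltxx.
Qed.

Lemma measurable_set1C a : measurable ([set a] : set (borelC R)).
Proof. by apply: closed_borelC; exact: closed_set1C. Qed.

Lemma measurable_fun_contraction (h : borelC R -> R) :
  (forall z w, `|h z - h w| <= cmod (z - w)) -> measurable_fun setT h.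
Proof.
move=> hc; apply: (measurability _ (RGenOpens.measurableE R)) => //.
move=> _ [_ [a [b ->]] <-]; rewrite setTI; apply: open_borelC.
apply/open_CplxP => z /=; rewrite in_itv/= => /andP[az zb].
exists (Num.min (h z - a) (b - h z)); first by rewrite lt_min !subr_gt0 az.
move=> w; rewrite lt_min => /andP[w1 w2]; rewrite in_itv/=.
by have := hc w z; rewrite ler_norml; lra.
Qed.

Lemma normr_Re_le z : `|complex.Re z| <= cmod z.
Proof. by rewrite -lecR; exact: normc_ge_Re. Qed.

Lemma normr_Im_le z : `|complex.Im z| <= cmod z.
Proof.
case: z => a b /=; rewrite -[leLHS]sqrtr_sqr ler_sqrt ?addr_ge0 ?sqr_ge0//.
by rewrite lerDr sqr_ge0.
Qed.

Lemma measurable_Re : measurable_fun setT (@complex.Re R : borelC R -> R).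
Proof.
apply: measurable_fun_contraction => z w.
by rewrite (le_trans _ (normr_Re_le _))//; case: z; case: w.
Qed.

Lemma measurable_Im : measurable_fun setT (@complex.Im R : borelC R -> R).
Proof.
apply: measurable_fun_contraction => z w.
by rewrite (le_trans _ (normr_Im_le _))//; case: z; case: w.
Qed.

Lemma measurable_cmodB d (T : measurableType d) (g h : T -> borelC R) :
  measurable_fun setT g -> measurable_fun setT h ->
  measurable_fun setT (fun t => cmod ((g t : R[i]) - h t)).
Proof.
move=> mg mh.
have -> : (fun t => cmod ((g t : R[i]) - h t)) =
  (fun t => Num.sqrt ((complex.Re (g t) - complex.Re (h t)) ^+ 2 +
     (complex.Im (g t) - complex.Im (h t)) ^+ 2)).
  by apply/funext => t; case: (g t) => a b; case: (h t).
apply: (measurableT_comp (f := @Num.sqrt R)).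
  by apply: continuous_measurable_fun; exact: sqrt_continuous.
apply: measurable_funD; apply: measurable_funX; apply: measurable_funB.
- exact: (measurableT_comp measurable_Re).
- exact: (measurableT_comp measurable_Re).
- exact: (measurableT_comp measurable_Im).
- exact: (measurableT_comp measurable_Im).
Qed.

Lemma measurable_lne_EFin d (T : measurableType d) (h : T -> R) :
  measurable_fun setT h -> measurable_fun setT (fun t => lne (h t)%:E).
Proof.
move=> mh.
have -> : (fun t => lne (h t)%:E) =
   (fun t => if h t <= 0 then -oo%E else (ln (h t))%:E) by [].
apply: measurable_fun_if => //.
- exact: measurable_fun_ler.
- apply: measurable_funTS; apply/measurable_EFinP.
  exact: measurableT_comp.
Qed.

End BorelPlane.

(** * Truncated logarithmic potentials *)

Section ProbabilityIntegrals.
Local Open Scope ereal_scope.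
Context d (T : measurableType d) (R : realType) (s : probability T R).

Lemma prob1_negligible A : measurable A -> s A = 1 -> s (~` A) = 0.
Proof. by move=> mA sA; rewrite probability_setC// sA subee. Qed.

Lemma prob1_integral A (h : T -> \bar R) : measurable A -> s A = 1 ->
  measurable_fun setT h -> (forall t, 0 <= h t) ->
  \int[s]_(t in A) h t = \int[s]_t h t.
Proof.
move=> mA sA mh h0.
rewrite [RHS](@ge0_negligible_integral _ _ _ s setT (~` A))//.
- by rewrite setTD setCK.
- exact: measurableC.
- exact: prob1_negligible.
Qed.

(** Rewriting through the nonnegative function [c - h] makes Tonelli's theorem and
    monotone convergence available for logarithms, which are bounded above on
    bounded sets but may take the value [-oo]. *)
Lemma prob1_integral_bounded_above A (h : T -> \bar R) (c : R) :
  measurable A -> s A = 1 -> measurable_fun A h -> (0 <= c)%R ->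
  (forall t, A t -> h t <= c%:E) ->
  \int[s]_(t in A) h t = c%:E - \int[s]_(t in A) (c%:E - h t).
Proof.
move=> mA sA mh c0 hc; rewrite integralE.
have sA1 : (s : {measure set T -> \bar R}) A = 1 := sA.
have iA : \int[s]_(t in A) (cst c%:E t) = c%:E by rewrite integral_cst// sA1 mule1.
have fp : \int[s]_(t in A) h^\+ t \is a fin_num.
  rewrite ge0_fin_numE ?integral_ge0//.
  rewrite (@le_lt_trans _ _ (\int[s]_(t in A) (cst c%:E t)))//.
    apply: ge0_le_integral => //.
    - exact: measurable_funepos.
    - by move=> t At; rewrite funeposE ge_max hc//= lee_fin.
  by rewrite iA ltry.
have key : \int[s]_(t in A) (c%:E - h t) + \int[s]_(t in A) h^\+ t =
           c%:E + \int[s]_(t in A) h^\- t.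
  rewrite -ge0_integralD//; last 3 first.
  - by move=> t At; rewrite sube_ge0 ?orbT// hc.
  - by apply: emeasurable_funB => //; exact: measurable_cst.
  - exact: measurable_funepos.
  rewrite [X in _ = X + _](_ : _ = \int[s]_(t in A) (cst c%:E t)); last first.
    by rewrite iA.
  rewrite -ge0_integralD//.
  - apply: eq_integral => t /[!inE] At.
    rewrite /cst/=.
    have := hc t At; rewrite funeposE funenegE.
    case: (h t) => [r| |] //= _; first last.
      by rewrite (max_r (leNye _)) (max_l (leey _)) adde0 addey.
    rewrite -[0%E]/(0%R%:E) -!EFin_max -!EFinD; congr (_%:E).
    by rewrite /Num.max; case: ltP => ?; case: ltP => ?; lra.
  - exact: measurable_funeneg.
move: key fp.
have := @integral_ge0 _ _ _ s A (fun t => c%:E - h t).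
have := @integral_ge0 _ _ _ s A h^\- (fun t _ => funeneg_ge0 h t).
move: (\int[s]_(t in A) h^\+ t) (\int[s]_(t in A) h^\- t) => [p| |]// [n| |]//.
  move: (\int[s]_(t in A) (c%:E - h t)) => [x| |]// _ _ [] key _.
  by rewrite -!EFinD; congr (_%:E); lra.
by move: (\int[s]_(t in A) (c%:E - h t)) => [x| |].
Qed.

End ProbabilityIntegrals.

Section LogKernel.
Local Open Scope ereal_scope.
Variable R : realType.
Implicit Types (M : R) (z w : borelC R).
Local Notation cdist z w := (cmod ((z : R[i]) - (w : R[i]))%R).

(** Since [log (M / |z - w|)] may be infinite but is nonnegative for [|z - w| <= M],
    truncating it at [0] gives a kernel to which the theory of nonnegative
    integrands applies everywhere; on bounded sets a large [M] makes the truncation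
    harmless. *)
Definition log_kernel M z w : \bar R :=
  maxe 0 ((ln M)%:E - lne (cdist z w)%:E).

Lemma log_kernel_ge0 M z w : 0 <= log_kernel M z w.
Proof. by rewrite /log_kernel le_max lexx. Qed.

Lemma log_kernelC M z w : log_kernel M z w = log_kernel M w z.
Proof. by rewrite /log_kernel cmodBC. Qed.

Lemma log_kernelE M z w : (1 <= M)%R -> (cdist z w <= M)%R ->
  log_kernel M z w = (ln M)%:E - lne (cdist z w)%:E.
Proof.
move=> M1 zM; apply/max_idPr; rewrite sube_ge0 ?ltNyr//; last first.
  by rewrite /lne; case: ifP.
have [z0|z0] := leP (cdist z w) 0%R.
  by rewrite le0_lneNy// leNye.
by rewrite lne_EFin// lee_fin ler_ln ?posrE// (lt_le_trans _ M1).
Qed.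

Lemma measurable_log_kernel_comp M d (T : measurableType d) (g h : T -> borelC R) :
  measurable_fun setT g -> measurable_fun setT h ->
  measurable_fun setT (fun t => log_kernel M (g t) (h t)).
Proof.
move=> mg mh; apply: measurable_maxe => //.
apply: emeasurable_funB => //.
by apply: measurable_lne_EFin; exact: measurable_cmodB.
Qed.

Lemma measurable_log_kernel M z : measurable_fun setT (log_kernel M z).
Proof. exact: (@measurable_log_kernel_comp M _ _ (cst z) id). Qed.

Definition pot (m : {measure set (borelC R) -> \bar R}) M z : \bar R :=
  \int[m]_w log_kernel M z w.

Lemma pot_ge0 m M z : 0 <= pot m M z.
Proof. by apply: integral_ge0 => w _; exact: log_kernel_ge0. Qed.

Lemma measurable_pot (s : {finite_measure set (borelC R) -> \bar R}) M :
  measurable_fun setT (pot s M).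
Proof.
apply: (@measurable_fun_fubini_tonelli_F _ _ (borelC R) (borelC R) R s
  (fun zw => log_kernel M zw.1 zw.2)) => //.
- by apply: measurable_log_kernel_comp; [exact: measurable_fst|exact: measurable_snd].
- by move=> zw; exact: log_kernel_ge0.
Qed.

Lemma pot_swap (s1 s2 : {finite_measure set (borelC R) -> \bar R}) M :
  \int[s1]_z pot s2 M z = \int[s2]_z pot s1 M z.
Proof.
have mk : measurable_fun setT (fun zw : borelC R * borelC R => log_kernel M zw.1 zw.2).
  by apply: measurable_log_kernel_comp; [exact: measurable_fst|exact: measurable_snd].
have := @fubini_tonelli _ _ (borelC R) (borelC R) R s1 s2 _ mk
  (fun zw => log_kernel_ge0 M zw.1 zw.2).
move=> /= H; apply: (eq_trans H).
by apply: eq_integral => w _; apply: eq_integral => z _; exact: log_kernelC.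
Qed.

Lemma log_integral_pot (s : probability (borelC R) R) A M z :
  measurable A -> s A = 1 -> (1 <= M)%R ->
  (forall w, A w -> cdist z w <= M)%R ->
  \int[s]_(w in A) lne (cdist z w)%:E = (ln M)%:E - pot s M z.
Proof.
move=> mA sA M1 zM.
have lnM0 : (0 <= ln M)%R by rewrite ln_ge0.
rewrite (@prob1_integral_bounded_above _ _ _ s A _ (ln M))//.
- congr (_ - _); rewrite /pot -(prob1_integral mA sA).
  + by apply: eq_integral => w /[!inE] Aw; rewrite log_kernelE// zM.
  + exact: measurable_log_kernel.
  + by move=> t; exact: log_kernel_ge0.
- by apply: measurable_funTS; apply: measurable_lne_EFin; exact: measurable_cmodB.
- move=> w Aw; have := log_kernel_ge0 M z w; rewrite log_kernelE ?zM//.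
  rewrite sube_ge0 ?ltNyr//.
  by rewrite /lne; case: ifP.
Qed.

Lemma log_energy (s : probability (borelC R) R) A M :
  measurable A -> s A = 1 -> (1 <= M)%R ->
  (forall z w, A z -> A w -> cdist z w <= M)%R ->
  \int[s]_(z in A) \int[s]_(w in A) lne (cdist z w)%:E =
    (ln M)%:E - \int[s]_z pot s M z.
Proof.
move=> mA sA M1 zM.
have lnM0 : (0 <= ln M)%R by rewrite ln_ge0.
have E z : A z -> \int[s]_(w in A) lne (cdist z w)%:E =
    (ln M)%:E - pot s M z.
  by move=> Az; apply: log_integral_pot => // w; exact: zM.
under eq_integral => z /[!inE] Az do rewrite E//.
rewrite (@prob1_integral_bounded_above _ _ _ s A _ (ln M))//.
- congr (_ - _); rewrite -(prob1_integral mA sA); last 2 first.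
  + exact: measurable_pot.
  + by move=> t; exact: pot_ge0.
  apply: eq_integral => w _; have := pot_ge0 s M w.
  by case: (pot s M w) => [r| |]//= _; rewrite -!EFinD; congr (_%:E); lra.
- apply: measurable_funTS; apply: emeasurable_funB => //; exact: measurable_pot.
- move=> w Aw; have := pot_ge0 s M w; case: (pot s M w) => [r| |]//=.
  + by rewrite -EFinB !lee_fin; lra.
  + by rewrite leNye.
Qed.

End LogKernel.

(** * Fibres of the polynomial and pullback of measures *)

Lemma uniform_radius (R : realType) (T : eqType) (s : seq T) (Q : T -> R -> Prop) :
  (forall x e e', e' <= e -> Q x e -> Q x e') ->
  (forall x, x \in s -> exists2 e : R, 0 < e & Q x e) ->
  exists2 e : R, 0 < e & forall x, x \in s -> Q x e.
Proof.
move=> Qle; elim: s => [|x s IH] h; first by exists 1.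
have [e e0 eQ] := IH (fun y ys => h y (mem_behead (s := x :: s) ys)).
have [e' e'0 e'Q] := h x (mem_head _ _).
exists (Num.min e e'); first by rewrite lt_min e0.
move=> y; rewrite inE => /predU1P[->|ys].
  by apply: Qle e'Q; rewrite ge_min lexx orbT.
by apply: Qle (eQ y ys); rewrite ge_min lexx.
Qed.

Section Fibres.
Variables (R : realType) (f : {poly int}).
Hypotheses (fm : f \is monic) (fd : (2 <= (size f).-1)%N).
Implicit Types (z w a u : R[i]) (rs : seq R[i]).
Local Notation F := (@poly_fun R f).
Local Notation d := (size f).-1.

(** The roots of [f - u] listed with multiplicity. *)
Definition fiber u : seq R[i] := sval (cid (poly_fun_fiber fm fd u)).

Lemma size_fiber u : size (fiber u) = d.
Proof. by rewrite /fiber; case: cid => rs [] /=. Qed.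

Lemma fiber_prod u :
  map_poly intr f - u%:P = \prod_(r <- fiber u) ('X - r%:P).
Proof. by rewrite /fiber; case: cid => rs [] /=. Qed.

Lemma mem_fiber u z : (z \in fiber u) = (F z == u).
Proof. exact: (fiberP _ (fiber_prod u)). Qed.

Lemma deg_gt0 : (0 < d)%N.
Proof. exact: leq_trans fd. Qed.

(** A fibre with a repeated point lies over a critical value. *)
Lemma finite_critical_values : finite_set [set u | ~~ uniq (fiber u)].
Proof.
have [cs csE] := closed_field_poly_normal ((map_poly intr f)^`() : {poly R[i]}).
have f'0 : (map_poly intr f)^`() != 0 :> {poly R[i]}.
  apply/eqP => /(congr1 (fun p : {poly R[i]} => p`_d.-1)).
  rewrite coef0 coef_deriv coef_map /= prednK ?deg_gt0// -lead_coefE (monicP fm).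
  by apply/eqP; rewrite mulrn_eq0 oner_eq0 orbF -lt0n deg_gt0.
apply: (@sub_finite_set _ _ (F @` [set` cs])); last exact/finite_image/finite_seq.
move=> u /=; rewrite -separable_prod_XsubC -fiber_prod unlock /=.
rewrite derivB derivC subr0 => /Pdiv.ClosedField.coprimepP h.
apply: contrapT => hu; apply: h => x; rewrite rootE !hornerE subr_eq0 => /eqP xu.
apply/negP => x0; apply: hu; exists x => //=.
have : root (map_poly intr f)^`() x by [].
by rewrite csE rootZ ?lead_coef_eq0// root_prod_XsubC.
Qed.

(** Preimages counted without multiplicity: this is the semicontinuous count, and it
    agrees with the count with multiplicity outside the finite set of critical
    values. *)
Definition fiber_count (A : set R[i]) u : nat :=
  size (undup [seq r <- fiber u | r \in A]).

(** Each preimage of [u] is close to a preimage of any nearby point, and discs about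
    distinct preimages can be taken disjoint. *)
Lemma open_fiber_count (A : set (Cplx R)) k : open A ->
  open [set u : Cplx R | (k <= fiber_count A u)%N].
Proof.
move=> /open_CplxP oA; apply/open_CplxP => u /= ku.
pose rs := undup [seq r <- fiber u | r \in (A : set R[i])].
have [e e0 eP] : exists2 e : R, 0 < e & forall r, r \in rs ->
   (forall w, cmod (w - r) < e -> A w) /\
   (forall s, s \in rs -> r != s -> 2 * e <= cmod (r - s)).
  apply: uniform_radius => [r e e' ee' [h1 h2]|r rrs].
    split => [w we|s srs rs']; first by apply: h1; exact: lt_le_trans we ee'.
    by apply: le_trans (h2 s srs rs'); rewrite ler_pM2l.
  have Ar : A r by move: rrs; rewrite mem_undup mem_filter => /andP[/set_mem].
  have [e1 e10 h1] := oA r Ar.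
  have [e2 e20 h2] : exists2 e : R, 0 < e & forall s, s \in rs ->
      (r != s -> 2 * e <= cmod (r - s)).
    apply: uniform_radius => [s e e' ee' h rs'|s srs].
      by apply: le_trans (h rs'); rewrite ler_pM2l.
    have [->|rs'] := eqVneq r s; first by exists 1.
    exists (cmod (r - s) / 2); first by rewrite divr_gt0// cmod_gt0 subr_eq0.
    by move=> _; rewrite mulrCA divff// mulr1.
  exists (Num.min e1 e2); first by rewrite lt_min e10.
  split => [w|s srs rs']; first by rewrite lt_min => /andP[we _]; exact: h1.
  apply: le_trans (h2 s srs rs').
  by rewrite ler_pM2l// ge_min lexx orbT.
exists (e ^+ d); first by rewrite exprn_gt0.
move=> v vu; apply: (leq_trans ku).
have [g gP] : {g : R[i] -> R[i] & forall r,
    r \in rs -> g r \in fiber v /\ cmod (r - g r) < e}.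
  apply: (@choice _ _ (fun r s => r \in rs -> s \in fiber v /\ cmod (r - s) < e)) => r.
  have [rrs|] := boolP (r \in rs); last by exists 0.
  have Fr : F r = u.
    by apply/eqP; move: rrs; rewrite mem_undup mem_filter mem_fiber => /andP[].
  have [||s sv rs'] := @near_root R _ (fiber v) r e _ (ltW e0) (fiber_prod v).
  - by rewrite size_fiber deg_gt0.
  - by rewrite size_fiber !hornerE -/(poly_fun f r) Fr cmodBC.
  - by exists s.
have ginj : {in rs &, injective g}.
  move=> r s rrs srs gg; apply/eqP; apply: contrapT => /negP rs'.
  have [_ /(_ s srs rs')] := eP r rrs.
  apply/negP; rewrite -ltNge.
  have [_ h1] := gP r rrs; have [_ h2] := gP s srs.
  rewrite (le_lt_trans (cmod_triangleB (g r) _ _))//.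
  by rewrite mulr_natl mulr2n ltrD// gg cmodBC.
rewrite /fiber_count -/rs -(size_map g); apply: uniq_leq_size.
  by rewrite map_inj_in_uniq// undup_uniq.
move=> _ /mapP[r rrs ->]; rewrite mem_undup mem_filter.
have [gv gr] := gP r rrs; rewrite gv andbT; apply/mem_set.
by have [h _] := eP r rrs; apply: h; rewrite cmodBC.
Qed.

(** The uniform measure on the fibre over [u], counted with multiplicity; it is a
    probability because [f - u] has [d] roots. *)
Definition fiber_measure u : set (borelC R) -> \bar R :=
  mscale (d%:R^-1)%:nng
    (msum (fun i => \d_(nth 0 (fiber u) i : borelC R)) d).
HB.instance Definition _ u := Measure.on (fiber_measure u).

Lemma fiber_measureE u A : fiber_measure u A =
  (d%:R^-1 * (count (fun r => r \in A) (fiber u))%:R)%:E.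
Proof.
rewrite /fiber_measure /mscale /= /msum EFinM; congr (_ * _)%E.
have -> : (\sum_(k < d) \d_(nth 0%R (fiber u) k : borelC R) A =
   \sum_(r <- fiber u) ((r \in A)%:R)%:E :> \bar R)%E.
  by rewrite (big_nth 0) big_mkord size_fiber.
rewrite sumEFin; congr (_%:E).
by elim: (fiber u) => [|r rs IH]; rewrite ?big_nil// big_cons IH /= natrD.
Qed.

Lemma integral_fiber_measure u (h : borelC R -> \bar R) :
  measurable_fun setT h -> (forall z, 0 <= h z)%E ->
  (\int[fiber_measure u]_z h z = (d%:R^-1)%:E * \sum_(r <- fiber u) h r)%E.
Proof.
move=> mh h0; rewrite ge0_integral_mscale// ge0_integral_measure_sum//.
rewrite (big_nth 0) big_mkord size_fiber; congr (_ * _)%E.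
by apply: eq_bigr => i _; rewrite integral_dirac// diracT mul1e.
Qed.

Lemma finite_set_borelC (A : set (borelC R)) : finite_set A -> measurable A.
Proof.
move=> fA; have -> : A = \bigcup_(a in A) [set a].
  by apply/seteqP; split => [a Aa|a [b Ab ->]//]; exists a.
by apply: fin_bigcup_measurable => // a _; exact: measurable_set1C.
Qed.

Lemma measurable_fiber_count (A : set (Cplx R)) : open A ->
  measurable_fun setT (fun u : borelC R => (fiber_count A u)%:R : R).
Proof.
move=> oA; apply: (measurability _ (RGenOInfty.measurableE R)) => //.
move=> _ [_ [a ->] <-]; rewrite setTI; apply: open_borelC.
have -> : (fun u : borelC R => (fiber_count A u)%:R : R) @^-1` `]a, +oo[%classic =
  \bigcup_(k in [set k : nat | a < k%:R]) [set u : Cplx R | (k <= fiber_count A u)%N].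
  apply/seteqP; split => u /=; rewrite in_itv/= andbT.
    by move=> h; exists (fiber_count A u) => /=.
  by move=> [k /= ak ku]; rewrite (lt_le_trans ak)// ler_nat.
by apply: bigcup_open => k _; exact: open_fiber_count.
Qed.

Lemma measurable_fiber_measure_open (A : set (borelC R)) : open (A : set (Cplx R)) ->
  measurable_fun setT (fun u : borelC R => fiber_measure u A).
Proof.
move=> oA; pose N : set (borelC R) := [set u | ~~ uniq (fiber u)].
have fN : finite_set N := finite_critical_values.
have mN := finite_set_borelC fN.
rewrite -(setvU N); apply/measurable_funU => //; first exact: measurableC.
split; last first.
  move=> _ B mB; apply: finite_set_borelC; exact: finite_setIl.
apply: (eq_measurable_fun (fun u : borelC R => (d%:R^-1 * (fiber_count A u)%:R)%:E)).
  move=> u /[!inE] /= /negP/negPn uu; rewrite fiber_measureE.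
  by rewrite -size_filter /fiber_count undup_id// filter_uniq.
apply: measurable_funTS; apply/measurable_EFinP.
by apply: measurable_funM => //; exact: measurable_fiber_count.
Qed.

Lemma fiber_measureT u : fiber_measure u setT = 1%E.
Proof.
rewrite fiber_measureE (eq_count (a2 := predT)); last by move=> r; rewrite /= in_setT.
rewrite count_predT size_fiber mulVf//.
by rewrite pnatr_eq0 -lt0n deg_gt0.
Qed.

(** Open sets generate the Borel sets and are stable under intersection, so it is
    enough to treat them; there semicontinuity of the count applies, apart from
    finitely many critical values. *)
Lemma measurable_fiber_measure (A : set (borelC R)) : measurable A ->
  measurable_fun setT (fun u : borelC R => fiber_measure u A).
Proof.
apply: (@dynkin_induction _ (borelC R) (@open (Cplx R))
  (fun A => measurable_fun setT (fun u : borelC R => fiber_measure u A))) => //.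
- by move=> B D; exact: openI.
- by apply: measurable_fiber_measure_open; exact: openT.
- by move=> B oB; exact: measurable_fiber_measure_open.
- move=> B mB hB.
  have -> : (fun u : borelC R => fiber_measure u (~` B)) =
      (fun u => 1 - fiber_measure u B)%E.
    apply/funext => u; rewrite -(fiber_measureT u) -(setvU B) measureU//.
    - have fB : fiber_measure u B \is a fin_num by rewrite fiber_measureE.
      by rewrite addeK//.
    - exact: measurableC.
    - by rewrite setICl.
  by apply: emeasurable_funB.
- move=> G mG tG hG.
  have -> : (fun u : borelC R => fiber_measure u (\bigcup_k G k)) =
      (fun u => \sum_(k <oo) fiber_measure u (G k))%E.
    apply/funext => u; apply: measure_semi_bigcup => //.
    exact: bigcupT_measurable.
  by apply: (ge0_emeasurable_sum (P := xpredT)).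
Qed.

End Fibres.

Section Pullback.
Local Open Scope ereal_scope.
Variables (R : realType) (f : {poly int}).
Hypotheses (fm : f \is monic) (fd : (2 <= (size f).-1)%N).
Variable mu : probability (borelC R) R.
Local Notation d := (size f).-1.

Definition const_kernel (t : unit) : {measure set (borelC R) -> \bar R} := mu.

Let measurable_const_kernel A : measurable A ->
  measurable_fun setT (const_kernel ^~ A).
Proof. by move=> mA; exact: measurable_cst. Qed.

HB.instance Definition _ := isKernel.Build _ _ _ _ R const_kernel measurable_const_kernel.

Let const_kernel_prob t : const_kernel t setT = 1.
Proof. exact: probability_setT. Qed.

HB.instance Definition _ :=
  Kernel_isProbability.Build _ _ _ _ R const_kernel const_kernel_prob.

Definition fiber_kernel (tu : unit * borelC R) : {measure set (borelC R) -> \bar R} :=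
  fiber_measure fm fd tu.2.

Let measurable_fiber_kernel A : measurable A ->
  measurable_fun setT (fiber_kernel ^~ A).
Proof.
move=> mA; apply: (measurableT_comp (measurable_fiber_measure fm fd mA)).
exact: measurable_snd.
Qed.

HB.instance Definition _ := isKernel.Build _ _ _ _ R fiber_kernel measurable_fiber_kernel.

Let fiber_kernel_prob t : fiber_kernel t setT = 1.
Proof. exact: fiber_measureT. Qed.

HB.instance Definition _ :=
  Kernel_isProbability.Build _ _ _ _ R fiber_kernel fiber_kernel_prob.

(** The normalized pullback [f^* mu / d], as the composition of the constant kernel
    [mu] with the kernel of fibre measures. *)
Definition pullback : set (borelC R) -> \bar R :=
  mkcomp const_kernel fiber_kernel tt.

HB.instance Definition _ := Measure.on pullback.

Let pullbackT : pullback setT = 1.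
Proof.
rewrite /pullback /= /kcomp.
under eq_integral do rewrite fiber_kernel_prob.
by rewrite integral_cst// mul1e; exact: probability_setT.
Qed.

HB.instance Definition _ := Measure_isProbability.Build _ _ _ pullback pullbackT.

Lemma integral_pullback (h : borelC R -> \bar R) :
  measurable_fun setT h -> (forall z, 0 <= h z) ->
  \int[pullback]_z h z =
  \int[mu]_u ((d%:R^-1)%:E * \sum_(r <- fiber fm fd u) h r).
Proof.
move=> mh h0; rewrite /pullback integral_kcomp//.
by apply: eq_integral => u _; rewrite integral_fiber_measure.
Qed.

Lemma measurable_fiber_sum (h : borelC R -> \bar R) :
  measurable_fun setT h -> (forall z, 0 <= h z) ->
  measurable_fun setT
    (fun u : borelC R => (d%:R^-1)%:E * \sum_(r <- fiber fm fd u) h r).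
Proof.
move=> mh h0.
have mh2 : measurable_fun setT (fun p : (unit * borelC R) * borelC R => h p.2).
  by apply: (measurableT_comp mh); exact: measurable_snd.
have m2 := @measurable_fun_integral_finite_kernel _ _ _ _ R _ fiber_kernel
  (fun p => h0 p.2) mh2.
apply: (eq_measurable_fun (fun u : borelC R => \int[fiber_kernel (tt, u)]_z h z)).
  by move=> u _; rewrite integral_fiber_measure.
exact: (measurableT_comp m2 (measurable_pair1 tt)).
Qed.

End Pullback.

(** * Potential and energy of the pullback *)

Section LogProducts.
Local Open Scope ereal_scope.
Variable R : realType.

(** Working with [c - log] keeps every term away from [-oo], so that the sum is
    meaningful even when a factor vanishes. *)
Lemma sum_sub_lne (I : eqType) (rs : seq I) (c : R) (x : I -> R) :
  (forall r, r \in rs -> 0 <= x r)%R ->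
  \sum_(r <- rs) (c%:E - lne (x r)%:E) =
  ((size rs)%:R * c)%:E - lne (\prod_(r <- rs) x r)%:E.
Proof.
elim: rs => [|r rs IH] x0; first by rewrite !big_nil mul0r lne1 sube0.
rewrite !big_cons IH => [|s srs]; last by rewrite x0// inE srs orbT.
have xr : (0 <= x r)%R by rewrite x0 ?mem_head.
have px : (0 <= \prod_(s <- rs) x s)%R.
  by rewrite big_seq prodr_ge0// => s srs; rewrite x0// inE srs orbT.
have [x0'|] := ltP 0%R (x r); last first.
  move=> x0'; have -> : x r = 0%R by apply/eqP; rewrite eq_le x0' xr.
  rewrite mul0r !(le0_lneNy (lexx _))/= !addey// addye// /lne.
  by case: ifP.
have [p0|] := ltP 0%R (\prod_(s <- rs) x s)%R; last first.
  move=> p0; have -> : (\prod_(s <- rs) x s)%R = 0%R by apply/eqP; rewrite eq_le p0 px.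
  by rewrite mulr0 (le0_lneNy (lexx _)) lne_EFin.
rewrite !lne_EFin// ?mulr_gt0// (lnM x0' p0) -!EFinD; congr (_%:E).
by rewrite -[size (r :: rs)]/(size rs).+1 -natr1; lra.
Qed.

End LogProducts.

Section PullbackPotential.
Local Open Scope ereal_scope.
Variables (R : realType) (f : {poly int}).
Hypotheses (fm : f \is monic) (fd : (2 <= (size f).-1)%N).
Variable mu : probability (borelC R) R.
Local Notation F := (@poly_fun R f).
Local Notation d := (size f).-1.
Local Notation J := (julia f : set (borelC R)).
Hypothesis muJ : mu J = 1.
Local Notation nu := (pullback fm fd mu).
Local Notation cdist z w := (cmod ((z : R[i]) - (w : R[i]))%R).

Lemma measurable_julia : measurable J.
Proof. by apply: closed_borelC; exact: (julia_closed fm fd). Qed.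

Lemma fiber_julia u r : J u -> r \in fiber fm fd u -> J r.
Proof. by move=> Ju; rewrite mem_fiber => /eqP Fr; apply: (julia_preimage fm fd); rewrite Fr. Qed.

Lemma pullback_julia : nu J = 1.
Proof.
have mJ := measurable_julia.
rewrite /pullback /= /kcomp -(prob1_integral mJ muJ); last 2 first.
- by apply: (measurable_fiber_measure fm fd mJ).
- by [].
rewrite (eq_integral (cst 1)).
  by rewrite integral_cst// mul1e; exact: muJ.
move=> u /[!inE] Ju; rewrite /= fiber_measureE.
have : all (fun r => r \in J) (fiber fm fd u).
  by apply/allP => r rF; rewrite inE; exact: fiber_julia rF.
rewrite all_count => /eqP ->.
by rewrite size_fiber mulVf// pnatr_eq0 -lt0n (deg_gt0 fd).
Qed.

(** Since [f - u] is the product of the [z - r] over the fibre of [u], the sum of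
    [log |z - r|] is [log |f z - u|]. The constant becomes [M ^+ d] because the [d]
    terms each carry [log M]. *)
Lemma pot_pullback M z : (1 <= M)%R ->
  (forall w, J w -> cdist z w <= M)%R ->
  (forall w, J w -> cdist (F z) w <= M ^+ d)%R ->
  pot nu M z = (d%:R^-1)%:E * pot mu (M ^+ d) (F z).
Proof.
move=> M1 h1 h2; rewrite /pot integral_pullback; last 2 first.
- exact: measurable_log_kernel.
- by move=> w; exact: log_kernel_ge0.
have mJ := measurable_julia.
have mS : measurable_fun setT (fun u : borelC R =>
    (d%:R^-1)%:E * \sum_(r <- fiber fm fd u) log_kernel M z r).
  exact: (measurable_fiber_sum fm fd (measurable_log_kernel M z) (log_kernel_ge0 M z)).
rewrite -(prob1_integral mJ muJ)//; last first.
  move=> u; rewrite mule_ge0 ?lee_fin ?invr_ge0//.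
  by apply: sume_ge0 => r _; exact: log_kernel_ge0.
rewrite -ge0_integralZl//; try by [exact: measurable_log_kernel|
  move=> w _; exact: log_kernel_ge0|rewrite lee_fin invr_ge0].
rewrite -[RHS](prob1_integral mJ muJ); last 2 first.
- by apply: emeasurable_funM => //; exact: measurable_log_kernel.
- by move=> w; rewrite mule_ge0 ?lee_fin ?invr_ge0// log_kernel_ge0.
apply: eq_integral => u /[!inE] Ju; congr (_ * _).
rewrite (log_kernelE (exprn_ege1 _ M1) (h2 u Ju)).
transitivity (\sum_(r <- fiber fm fd u) ((ln M)%:E - lne (cdist z r)%:E)).
  apply: eq_big_seq => r rF.
  by rewrite (log_kernelE M1 (h1 r (fiber_julia Ju rF))).
rewrite sum_sub_lne => [|r _]; last exact: cmod_ge0.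
rewrite size_fiber -(fiber_cmod _ (fiber_prod fm fd u)).
by rewrite lnXn ?(lt_le_trans ltr01)// mulr_natl.
Qed.

(** By [pot_pullback] the potential of the pullback is constant along each fibre,
    so that integrating it against the pullback amounts to integrating the
    potential of [mu] against [mu]. *)
Lemma energy_pullback M : (1 <= M)%R ->
  (forall z w, J z -> J w -> cdist z w <= M)%R ->
  \int[nu]_z pot nu M z = (d%:R^-1)%:E * \int[mu]_z pot mu (M ^+ d) z.
Proof.
move=> M1 JM.
have JMd z w : J z -> J w -> (cdist z w <= M ^+ d)%R.
  move=> Jz Jw; apply: (le_trans (JM _ _ Jz Jw)).
  by rewrite -[leLHS]expr1 ler_weXn2l// deg_gt0.
have mp := @measurable_pot R nu M; have mJ := measurable_julia.
have p0 := @pot_ge0 R nu M.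
rewrite integral_pullback//.
rewrite -(prob1_integral mJ muJ); last 2 first.
- exact: (measurable_fiber_sum fm fd mp p0).
- move=> u; rewrite mule_ge0 ?lee_fin ?invr_ge0//.
  by apply: sume_ge0 => r _; exact: p0.
rewrite -ge0_integralZl//; try by [exact: measurable_pot|
  move=> w _; exact: pot_ge0|rewrite lee_fin invr_ge0].
rewrite -[RHS](prob1_integral mJ muJ); last 2 first.
- by apply: emeasurable_funM => //; exact: measurable_pot.
- by move=> w; rewrite mule_ge0 ?lee_fin ?invr_ge0// pot_ge0.
apply: eq_integral => u /[!inE] Ju.
rewrite (eq_big_seq (fun=> (d%:R^-1)%:E * pot mu (M ^+ d) u)); last first.
  move=> r rF; have Jr := fiber_julia Ju rF.
  have Fr : F r = u by apply/eqP; rewrite -(mem_fiber fm fd).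
  rewrite (pot_pullback M1) ?Fr//.
  - by move=> w; exact: JM.
  - by move=> w; exact: JMd.
rewrite big_const_seq count_predT size_fiber.
have d0 : (d%:R != 0 :> R)%R by rewrite pnatr_eq0 -lt0n (deg_gt0 fd).
move: (pot mu (M ^+ d) u) => y.
have -> a : iter d (adde a) 0 = d%:R%:E * a :> \bar R.
  by rewrite mule_natl; elim: (size f).-1 => [|n IH]; rewrite ?mule0n// iterS IH muleS.
by rewrite !muleA -!EFinM mulVf// mul1r.
Qed.

End PullbackPotential.

(** * Energy of a mixture with a restriction *)

Section Mixture.
Local Open Scope ereal_scope.
Context dT (T : measurableType dT) (R : realType).
Variable mu : probability T R.

Section RestrictedMeasure.
Variables (D : set T) (mD : measurable D).

Lemma prob_fin_set (s : probability T R) A : measurable A -> s A < +oo.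
Proof. by move=> mA; rewrite (le_lt_trans (probability_le1 s mA))// ltry. Qed.

Definition restrict_measure := mfrestr mD (prob_fin_set mu mD).
HB.instance Definition _ := FiniteMeasure.on restrict_measure.

Lemma integral_restrict_measure (h : T -> \bar R) :
  measurable_fun setT h -> (forall t, 0 <= h t) ->
  \int[restrict_measure]_t h t = \int[mu]_(t in D) h t.
Proof.
move=> mh h0.
have mCD : measurable (~` D) by exact: measurableC.
rewrite -(setvU D) ge0_integral_setU//; last 2 first.
- by apply: measurable_funTS.
- by rewrite /disj_set setICl.
rewrite (eq_measure_integral mzero); last first.
  move=> A mA AD; rewrite -[LHS]/(mu (A `&` D)).
  by rewrite (_ : A `&` D = set0) ?measure0//; apply/disjoints_subset.
rewrite integral_measure_zero add0e.
apply: eq_measure_integral => A mA AD.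
by rewrite -[LHS]/(mu (A `&` D)) setIidl.
Qed.

End RestrictedMeasure.

Variables (a b : {nonneg R}) (D : set T) (mD : measurable D).

(** The probability [a mu + b mu|_D]; the normalization is an argument so that the
    result is canonically a probability. *)
Definition mixture (_ : (a%:num)%:E + (b%:num)%:E * mu D = 1) : set T -> \bar R :=
  measure_add (mscale a mu) (mscale b (restrict_measure mD)).

Hypothesis abD : (a%:num)%:E + (b%:num)%:E * mu D = 1.
HB.instance Definition _ := Measure.on (mixture abD).

Let mixtureT : mixture abD setT = 1.
Proof.
rewrite /mixture measure_addE.
rewrite -[LHS]/((a%:num)%:E * mu setT + (b%:num)%:E * mu (setT `&` D)) setTI.
by rewrite probability_setT mule1.
Qed.
HB.instance Definition _ := Measure_isProbability.Build _ _ _ (mixture abD) mixtureT.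

Lemma mixtureE A : mixture abD A = (a%:num)%:E * mu A + (b%:num)%:E * mu (A `&` D).
Proof. by rewrite /mixture measure_addE. Qed.

Lemma integral_mixture (h : T -> \bar R) :
  measurable_fun setT h -> (forall t, 0 <= h t) ->
  \int[mixture abD]_t h t =
  (a%:num)%:E * \int[mu]_t h t + (b%:num)%:E * \int[mu]_(t in D) h t.
Proof.
move=> mh h0; rewrite /mixture ge0_integral_measure_add//.
by rewrite !ge0_integral_mscale// integral_restrict_measure.
Qed.

End Mixture.

Section EnergyVariation.
Local Open Scope ereal_scope.
Variables (R : realType) (mu : probability (borelC R) R) (M : R).
Implicit Types (s : probability (borelC R) R) (D : set (borelC R)).

Lemma swap_pot_restrict D (mD : measurable D) :
  \int[mu]_z \int[mu]_(w in D) log_kernel M z w = \int[mu]_(z in D) pot mu M z.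
Proof.
rewrite -(integral_restrict_measure mu mD (measurable_pot mu M) (pot_ge0 mu M)).
rewrite -pot_swap; apply: eq_integral => z _.
rewrite /pot (integral_restrict_measure mu mD)//.
  exact: measurable_log_kernel.
by move=> w; exact: log_kernel_ge0.
Qed.

Lemma measurable_pot_restrict D : measurable D ->
  measurable_fun setT (fun z => \int[mu]_(w in D) log_kernel M z w).
Proof.
move=> mD; apply: (eq_measurable_fun (pot (restrict_measure mu mD) M)).
  move=> z _; rewrite /pot (integral_restrict_measure mu mD)//.
    exact: measurable_log_kernel.
  by move=> w; exact: log_kernel_ge0.
exact: measurable_pot.
Qed.

(** Expanding the square, the term in [b ^+ 2] is the energy of the restriction,
    which is at most the integral of the potential of [mu] over [D]. *)
Lemma mixture_energy (a b : {nonneg R}) D (mD : measurable D)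
    (abD : (a%:num)%:E + (b%:num)%:E * mu D = 1) :
  \int[mu]_z pot mu M z \is a fin_num ->
  \int[mixture mD abD]_z pot (mixture mD abD) M z <=
  ((a%:num ^+ 2)%R)%:E * \int[mu]_z pot mu M z +
  ((2 * a%:num * b%:num + b%:num ^+ 2)%R)%:E * \int[mu]_(z in D) pot mu M z.
Proof.
move=> Efin; set U := pot mu M; pose Q z := \int[mu]_(w in D) log_kernel M z w.
have U0 z : 0 <= U z by exact: pot_ge0.
have Q0 z : 0 <= Q z by apply: integral_ge0 => w _; exact: log_kernel_ge0.
have mU : measurable_fun setT U by exact: measurable_pot.
have mQ : measurable_fun setT Q by exact: measurable_pot_restrict.
have QU z : Q z <= U z.
  apply: ge0_subset_integral => //; first exact: measurable_log_kernel.
  by move=> w _; exact: log_kernel_ge0.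
have potE z : pot (mixture mD abD) M z = (a%:num)%:E * U z + (b%:num)%:E * Q z.
  rewrite /pot integral_mixture//; first exact: measurable_log_kernel.
  by move=> w; exact: log_kernel_ge0.
have EQ (x y : R) A : (0 <= x)%R -> (0 <= y)%R -> measurable A ->
    \int[mu]_(z in A) (x%:E * U z + y%:E * Q z) =
    x%:E * \int[mu]_(z in A) U z + y%:E * \int[mu]_(z in A) Q z.
  move=> x0 y0 mA; have mUA := measurable_funS measurableT (@subsetT _ A) mU.
  have mQA := measurable_funS measurableT (@subsetT _ A) mQ.
  have xU z : A z -> 0 <= x%:E * U z by rewrite mule_ge0 ?lee_fin.
  have yQ z : A z -> 0 <= y%:E * Q z by rewrite mule_ge0 ?lee_fin.
  have mxU : measurable_fun A (fun z => x%:E * U z) by apply: emeasurable_funM.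
  have myQ : measurable_fun A (fun z => y%:E * Q z) by apply: emeasurable_funM.
  rewrite (ge0_integralD mu mA xU mxU yQ myQ).
  rewrite (ge0_integralZl mu mA mUA (fun z _ => U0 z)) ?lee_fin//.
  by rewrite (ge0_integralZl mu mA mQA (fun z _ => Q0 z)) ?lee_fin.
have a0 : (0 <= a%:num)%R by [].
have b0 : (0 <= b%:num)%R by [].
under eq_integral => z _ do rewrite potE.
rewrite integral_mixture; last 2 first.
- by apply: emeasurable_funD; exact: emeasurable_funM.
- by move=> z; rewrite adde_ge0// mule_ge0 ?lee_fin.
rewrite (EQ _ _ _ a0 b0 measurableT) (EQ _ _ _ a0 b0 mD).
have -> : \int[mu]_z Q z = \int[mu]_(z in D) U z by exact: swap_pot_restrict.
rewrite -/U in Efin *.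
have X0 : 0 <= \int[mu]_(z in D) U z by exact: integral_ge0.
have Y0 : 0 <= \int[mu]_(z in D) Q z by exact: integral_ge0.
have YX : \int[mu]_(z in D) Q z <= \int[mu]_(z in D) U z.
  by apply: ge0_le_integral => //; apply: measurable_funTS.
have XE : \int[mu]_(z in D) U z <= \int[mu]_z U z by apply: ge0_subset_integral.
have Xfin : \int[mu]_(z in D) U z \is a fin_num.
  rewrite (ge0_fin_numE X0) (le_lt_trans XE)//.
  by move: Efin; rewrite fin_numE ltey => /andP[].
have Yfin : \int[mu]_(z in D) Q z \is a fin_num.
  rewrite (ge0_fin_numE Y0) (le_lt_trans YX)//.
  by move: Xfin; rewrite fin_numE ltey => /andP[].
move: Efin Xfin Yfin YX a0 b0 {X0 Y0 XE EQ potE}.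
move: (\int[mu]_z U z) (\int[mu]_(z in D) U z) (\int[mu]_(z in D) Q z).
move: (a%:num) (b%:num) => x y [e| |]// [v| |]// [t| |]// _ _ _.
rewrite lee_fin => tv x0 y0; rewrite -!(EFinM, EFinD) lee_fin.
rewrite -subr_ge0 (_ : (_ - _)%R = y ^+ 2 * (v - t))%R; last by ring.
by rewrite mulr_ge0 ?sqr_ge0// subr_ge0.
Qed.

End EnergyVariation.

(** * The Robin constant *)

(** The first order term at [t = 0] of the right-hand side is [2 t (X / m - E)]. It
    cannot be negative. *)
Lemma quadratic_variation (R : realType) (m E X : R) :
  0 < m -> 0 <= E -> 0 <= X ->
  (forall t : R, 0 < t -> t < 1 ->
     E <= (1 - t) ^+ 2 * E + (2 * (1 - t) * (t / m) + (t / m) ^+ 2) * X) ->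
  E * m <= X.
Proof.
move=> m0 E0 X0 h; rewrite leNgt; apply/negP => XE.
(* A step of size about [eta] is short enough for the quadratic terms, which are
   bounded by [Z], not to outweigh the linear one. *)
pose eta := E * m - X; have eta0 : 0 < eta by rewrite subr_gt0.
pose Z := m ^+ 2 * E + X + 1.
have Z0 : 0 < Z by rewrite ltr_wpDl// addr_ge0// mulr_ge0// sqr_ge0.
pose t := Num.min (1 / 2) (m * eta / Z).
have t0 : 0 < t by rewrite lt_min !divr_gt0// mulr_gt0.
have t1 : t < 1 by rewrite gt_min; apply/orP; left; lra.
have tZ : t * Z <= m * eta by rewrite -ler_pdivlMr// ge_min lexx orbT.
have := h t t0 t1; rewrite -(ler_pM2r (exprn_gt0 2 m0)) -subr_ge0.
have -> : ((1 - t) ^+ 2 * E + (2 * (1 - t) * (t / m) + (t / m) ^+ 2) * X) * m ^+ 2 -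
    E * m ^+ 2 = t * (t * (m ^+ 2 * E - 2 * m * X + X) - 2 * m * eta).
  by rewrite /eta; field; rewrite gt_eqF.
rewrite pmulr_rge0// subr_ge0 => h1.
have h2 : t * (m ^+ 2 * E - 2 * m * X + X) <= t * Z.
  rewrite ler_pM2l// /Z; have : 0 <= m * X by rewrite mulr_ge0// ltW.
  lra.
have me : 0 < m * eta by rewrite mulr_gt0.
lra.
Qed.

Section RobinConstant.
Local Open Scope ereal_scope.
Variables (R : realType) (f : {poly int}).
Hypotheses (fm : f \is monic) (fd : (2 <= (size f).-1)%N).
Hypothesis preper_julia : [set z : R[i] | preperiodic f z] `<=` julia f.
Variable mu : probability (borelC R) R.
Hypothesis mu_eq : is_equilibrium_measure f mu.
Implicit Types (s : probability (borelC R) R).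
Local Notation F := (@poly_fun R f).
Local Notation d := (size f).-1.
Local Notation J := (julia f : set (borelC R)).
Local Notation B := (escape_bound R fm fd).
Local Notation cdist z w := (cmod ((z : R[i]) - (w : R[i]))%R).

Lemma muJ : mu J = 1. Proof. by case: mu_eq => -[]. Qed.

Let mJ : measurable J := measurable_julia fm fd.

Lemma julia_bounded z : J z -> (cmod z <= B)%R.
Proof. by move=> /(julia_filled fm fd)/(filled_julia_bounded fm fd). Qed.

Lemma julia_dist M z w : (2 * B <= M)%R -> J z -> J w -> (cdist z w <= M)%R.
Proof.
move=> BM /julia_bounded zB /julia_bounded wB.
rewrite (le_trans _ BM)// (le_trans (cmod_triangle _ _))// cmodN; lra.
Qed.

Lemma large_ge1 M : (2 * B <= M -> 1 <= M)%R.
Proof. by have := escape_bound_ge1 R fm fd; lra. Qed.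

Lemma energyE s M : s J = 1 -> (2 * B <= M)%R ->
  energy f s = (ln M)%:E - \int[s]_z pot s M z.
Proof.
move=> sJ BM; apply: (log_energy mJ sJ (large_ge1 BM)) => z w.
exact: julia_dist.
Qed.

Lemma energy_le_mu s : s J = 1 -> energy f s <= energy f mu.
Proof. by case: mu_eq => -[_ h] _; exact: h. Qed.

(** If the maximal energy were [-oo], the Dirac masses at two distinct preperiodic
    points would both be equilibrium measures. *)
Lemma energy_ltNy : -oo < energy f mu.
Proof.
rewrite ltNye; apply/eqP => eNy.
have [a [b [Ja Jb ab]]] : exists a b : R[i], [/\ J a, J b & a != b].
  have inf := infinite_preperiodic (R := R) fm fd.
  have [a pa] := infinite_setN0 inf.
  have := infinite_setD inf (finite_set1 a).
  move=> /infinite_setN0[b [pb /= ab]].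
  exists a, b; split; [exact: preper_julia|exact: preper_julia|].
  by apply/eqP => h; apply: ab.
(* No probability on the Julia set could then be beaten. *)
have max c : J c -> maximizes_energy f (dirac (c : borelC R)).
  move=> Jc; split.
    by rewrite -[LHS]/(\d_(c : borelC R) J) diracE mem_set.
  by move=> nu nuJ; rewrite (le_trans (energy_le_mu nuJ))// eNy leNye.
have [_ uniq] := mu_eq.
have ma := uniq _ (max a Ja) [set a] (@measurable_set1C R a).
have mb := uniq _ (max b Jb) [set a] (@measurable_set1C R a).
have : \d_(b : borelC R) [set a] = \d_(a : borelC R) [set a] :> \bar R.
  exact: (etrans mb (esym ma)).
have ain : (a : borelC R) \in ([set a] : set (borelC R)) by exact: mem_set.
have bin : (b : borelC R) \notin ([set a] : set (borelC R)).
  by rewrite notin_setE /= => h; rewrite h eqxx in ab.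
rewrite !diracE ain (negbTE bin).
by move=> /eqP; rewrite eqe eq_sym oner_eq0.
Qed.

Lemma energy_fin : energy f mu \is a fin_num.
Proof.
rewrite fin_numE; move: energy_ltNy; rewrite ltNye => -> /=.
rewrite (energyE muJ (lexx _)).
have : 0 <= \int[mu]_z pot mu (2 * B) z by apply: integral_ge0 => z _; exact: pot_ge0.
by case: (\int[mu]_z pot mu (2 * B) z).
Qed.

Definition robin : R := fine (energy f mu).

Lemma energy_potE M : (2 * B <= M)%R -> \int[mu]_z pot mu M z = (ln M - robin)%:E.
Proof.
move=> BM; have := energyE muJ BM; rewrite -(fineK energy_fin) -/robin.
case: (\int[mu]_z pot mu M z) => [r| |]//=.
by rewrite -EFinB => -[->]; congr (_%:E); lra.
Qed.

Lemma robin_le_ln M : (2 * B <= M)%R -> (0 <= ln M - robin)%R.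
Proof.
move=> BM; rewrite -lee_fin -energy_potE//.
by apply: integral_ge0 => z _; exact: pot_ge0.
Qed.

Lemma pow_ge M : (2 * B <= M -> 2 * B <= M ^+ d)%R.
Proof.
move=> BM; rewrite (le_trans BM)// -[leLHS]expr1 ler_weXn2l ?(deg_gt0 fd)//.
exact: large_ge1.
Qed.

Lemma energy_pullbackE : energy f (pullback fm fd mu) = (robin / d%:R)%:E.
Proof.
have BM := lexx (2 * B)%R; have M1 := large_ge1 BM.
rewrite (energyE (pullback_julia fm fd muJ) BM).
rewrite (energy_pullback fm fd muJ M1); last by move=> z w; exact: julia_dist.
rewrite energy_potE ?pow_ge// -EFinM -EFinB; congr (_%:E).
rewrite lnXn ?(lt_le_trans ltr01)// -mulr_natl.
have d0 : (d%:R != 0 :> R)%R by rewrite pnatr_eq0 -lt0n (deg_gt0 fd).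
by field.
Qed.

(** The pullback is a competitor with energy [robin / d], and [d > 1]. *)
Lemma robin_ge0 : (0 <= robin)%R.
Proof.
have := energy_le_mu (pullback_julia fm fd muJ).
rewrite energy_pullbackE -(fineK energy_fin) lee_fin -/robin.
have d1 : (2 <= d%:R :> R)%R by rewrite (ler_nat R 2).
rewrite ler_pdivrMr ?(lt_le_trans _ d1)// => h; nra.
Qed.

(** When the Robin constant vanishes the pullback has maximal energy too, so
    uniqueness identifies it with [mu]. *)
Lemma pot_invariant M z : robin = 0%R -> (1 <= M)%R ->
  (cmod z + B <= M)%R -> (cmod (F z) + B <= M ^+ d)%R ->
  pot mu M z = (d%:R^-1)%:E * pot mu (M ^+ d) (F z).
Proof.
move=> r0 M1 zM FzM; have cB (w v : R[i]) : J v -> (cdist w v <= cmod w + B)%R.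
  by move=> /julia_bounded vB; rewrite (le_trans (cmod_triangle _ _))// cmodN lerD2l.
rewrite -(pot_pullback fm fd muJ M1); last 2 first.
- by move=> w Jw; exact: (le_trans (cB z w Jw) zM).
- by move=> w Jw; exact: (le_trans (cB (F z) w Jw) FzM).
apply: eq_measure_integral => A mA _; apply/esym.
have [_ uniq] := mu_eq; apply: uniq => //; split; first exact: (pullback_julia fm fd muJ).
move=> s /energy_le_mu; rewrite -(fineK energy_fin) -/robin energy_pullbackE.
by rewrite r0 mul0r.
Qed.

(** Moving a small mass from [mu] to its normalized restriction to [D] cannot raise
    the energy; the first variation of the energy gives the inequality. *)
Lemma integral_pot_ge M (D : set (borelC R)) : (2 * B <= M)%R -> measurable D ->
  (ln M - robin)%:E * mu D <= \int[mu]_(z in D) pot mu M z.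
Proof.
move=> BM mD; have E0 := robin_le_ln BM; set E := (ln M - robin)%R in E0 *.
have mDfin : mu D \is a fin_num by exact: fin_num_measure.
have pot0 z : 0 <= pot mu M z by exact: pot_ge0.
have X0 : 0 <= \int[mu]_(z in D) pot mu M z by exact: integral_ge0.
have XE : \int[mu]_(z in D) pot mu M z <= E%:E.
  rewrite -energy_potE//; apply: ge0_subset_integral => //.
  exact: measurable_pot.
have Xfin : \int[mu]_(z in D) pot mu M z \is a fin_num.
  by rewrite ge0_fin_numE// (le_lt_trans XE) ?ltry.
have m0 : (0 <= fine (mu D))%R by rewrite fine_ge0.
have [->|mD0] := eqVneq (mu D) 0; first by rewrite mule0.
have {}m0 : (0 < fine (mu D))%R by rewrite lt_neqAle m0 andbT eq_sym fine_eq0.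
have muJD : mu (J `&` D) = mu D.
  have h : mu D = mu (D `\` J) + mu (D `&` J) := measureDI mu mD mJ.
  rewrite setIC h (_ : mu (D `\` J) = 0) ?add0e//.
  apply: (subset_measure0 _ _ _ (prob1_negligible mJ muJ)) => //.
  - exact: measurableD.
  - exact: measurableC.
rewrite -(fineK mDfin) -(fineK Xfin) -EFinM lee_fin.
apply: quadratic_variation => //; first exact: fine_ge0.
move=> t t0 t1.
have a0 : (0 <= 1 - t)%R by lra.
have b0 : (0 <= t / fine (mu D))%R by rewrite divr_ge0// ltW.
(* The mass [t] is taken from [mu] and redistributed proportionally over [D]. *)
pose a := NngNum a0; pose b := NngNum b0.
have abD : (a%:num)%:E + (b%:num)%:E * mu D = 1.
  rewrite -(fineK mDfin) -EFinM -EFinD /a /b /= divfK ?gt_eqF//.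
  by congr (_%:E); lra.
have sJ : mixture mD abD J = 1.
  by rewrite mixtureE muJ muJD mule1.
have := energy_le_mu sJ; rewrite (energyE sJ BM) (energyE muJ BM).
have Ufin : \int[mu]_z pot mu M z \is a fin_num by rewrite energy_potE.
have := mixture_energy mD abD Ufin; rewrite energy_potE// -/E.
move: Xfin; move: (\int[mu]_(z in D) pot mu M z) => [x| |]// _.
move: (\int[mixture mD abD]_z pot (mixture mD abD) M z) => [y| |]//.
rewrite -!(EFinM, EFinD) !lee_fin /= => h1 h2.
by rewrite mulrA; lra.
Qed.

(** The mean of the potential over [mu] is [ln M - robin], and by [integral_pot_ge]
    its mean over any set is no smaller, so it cannot exceed this value on a set of
    positive measure. *)
Lemma pot_le_ae M : (2 * B <= M)%R ->
  mu [set z | (ln M - robin)%:E < pot mu M z] = 0.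
Proof.
move=> BM; set E := (ln M - robin)%R.
have mp := @measurable_pot R mu M.
have mA (c : R) : measurable [set z | c%:E < pot mu M z].
  have -> : [set z | c%:E < pot mu M z] = setT `&` pot mu M @^-1` `]c%:E, +oo]%classic.
    by apply/seteqP; split => z /=; rewrite in_itv/= leey andbT => // -[].
  by apply: mp => //; exact: emeasurable_itv.
have step n : mu [set z | (E + n.+1%:R^-1)%:E < pot mu M z] = 0.
  set D := [set z | _]; set e := (n.+1%:R^-1)%R in D *.
  have e0 : (0 < e)%R by rewrite invr_gt0.
  have mD : measurable D by exact: mA.
  have mCD := measurableC mD.
  have pot0 z : 0 <= pot mu M z by exact: pot_ge0.
  have h1 := integral_pot_ge BM mCD.
  have h2 : (E + e)%:E * mu D <= \int[mu]_(z in D) pot mu M z.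
    rewrite -(integral_cst mu mD); apply: ge0_le_integral => //.
    - by move=> z _; rewrite lee_fin addr_ge0 ?robin_le_ln// ltW.
    - by apply: measurable_funTS.
    - by move=> z Dz; exact: ltW.
  have := energy_potE BM; rewrite -/E -(setvU D) ge0_integral_setU//; last 2 first.
  - by apply: measurable_funTS.
  - by rewrite /disj_set setICl.
  have := probability_setC mu mD.
  have : mu D \is a fin_num by exact: fin_num_measure.
  have : 0 <= mu D by exact: measure_ge0.
  move: h1 h2 => /[swap]; rewrite -/E.
  move: (\int[mu]_(z in D) pot mu M z) (\int[mu]_(z in ~` D) pot mu M z).
  move=> x y h2 h1 m0 mf mC xy; move: h1; rewrite mC.
  move: (mu D) x y m0 mf h2 xy => [m| |]// [x| |]// [y| |]//.
  rewrite !lee_fin => m0 _ h2 [xy] h1; congr (_%:E).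
  have : (e * m <= 0)%R by lra.
  by rewrite pmulr_rle0// => m1; apply/eqP; rewrite eq_le m1 m0.
have -> : [set z | E%:E < pot mu M z] =
    \bigcup_n [set z | (E + n.+1%:R^-1)%:E < pot mu M z].
  apply/seteqP; split => z /=; last first.
    move=> [n _ /=]; apply: lt_trans; rewrite lte_fin ltrDl invr_gt0//.
  have := @pot_ge0 R mu M z; case pE: (pot mu M z) => [r| |]//= r0.
    rewrite lte_fin => Er; have [n] := ltr_add_invr Er => h.
    by exists n => //=; rewrite pE lte_fin.
  by move=> _; exists 0%N => //=; rewrite pE ltry.
apply: measure_negligible.
  by apply: bigcupT_measurable => n; exact: mA.
by apply: negligible_bigcup => n; apply/negligibleP; [exact: mA|exact: step].
Qed.

End RobinConstant.

(** * Semicontinuity of potentials *)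

Section LogKernelBounds.
Local Open Scope ereal_scope.
Variable R : realType.
Implicit Types (M c : R) (z w : borelC R).
Local Notation cdist z w := (cmod ((z : R[i]) - (w : R[i]))%R).

Lemma sub_lne_gt M c (r : R) : (0 < M)%R ->
  (c%:E < (ln M)%:E - lne r%:E) = (r < M * expR (- c))%R.
Proof.
move=> M0; have [r0|r0] := leP r 0%R.
  rewrite le0_lneNy// addey// ltry; apply/esym.
  by rewrite (le_lt_trans r0)// mulr_gt0// expR_gt0.
rewrite lne_EFin// -EFinB lte_fin ltrBrDr -ltrBrDl.
rewrite -[RHS]ltr_ln ?posrE ?mulr_gt0 ?expR_gt0//.
by rewrite lnM ?posrE ?expR_gt0// expRK.
Qed.

(** On the disc of radius [r] the kernel is at least [ln (M / r)]. *)
Lemma pot_ball_measure (mu : probability (borelC R) R) M (r e : R) z :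
  (0 < r)%R -> (r <= M)%R -> (1 <= M)%R ->
  pot mu M z <= e%:E ->
  (ln (M / r))%:E * mu [set w | (cdist z w < r)%R] <= e%:E.
Proof.
move=> r0 rM M1; apply: le_trans.
have mBall : measurable ([set w | (cdist z w < r)%R] : set (borelC R)).
  rewrite (_ : mkset _ = [set w | (cdist w z < r)%R]).
    by apply: open_borelC; exact: open_ballC.
  by apply/seteqP; split => w /=; rewrite cmodBC.
rewrite -(integral_cst mu mBall).
apply: (@le_trans _ _ (\int[mu]_(w in [set w | (cdist z w < r)%R]) log_kernel M z w)).
  apply: ge0_le_integral => //.
  - by move=> w _; rewrite lee_fin ln_ge0// ler_pdivlMr// mul1r.
  - by apply: measurable_funTS; exact: measurable_log_kernel.
  - move=> w /= wr; rewrite log_kernelE//; last exact: le_trans (ltW wr) rM.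
    rewrite ltW// sub_lne_gt ?(lt_le_trans ltr01)//.
    have M0 : (0 < M)%R by rewrite (lt_le_trans ltr01).
    by rewrite expRN lnK ?posrE ?divr_gt0// invf_div mulrCA divff ?mulr1// gt_eqF.
apply: ge0_subset_integral => //; first exact: measurable_log_kernel.
by move=> w _; exact: log_kernel_ge0.
Qed.

(** The kernel at a point [z'] within [e] of [z] is at least the kernel of [z] with
    distances increased by [e]; as [e] tends to [0] these kernels increase to the
    kernel of [z]. *)
Lemma pot_lower_semicontinuous (mu : probability (borelC R) R) (A : set (borelC R))
    M (E : R) z : measurable A -> mu A = 1 -> (1 <= M)%R ->
  (forall w, A w -> cdist z w + 1 <= M)%R ->
  (forall e : R, (0 < e)%R -> exists2 z' : borelC R,
     (cdist z' z < e)%R & pot mu M z' <= E%:E) ->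
  pot mu M z <= E%:E.
Proof.
move=> mA muA M1 AM hz.
have M0 : (0 < M)%R by rewrite (lt_le_trans ltr01).
pose k n w : \bar R := maxe 0 ((ln M)%:E - lne (cdist z w + n.+1%:R^-1)%:E).
have k0 n w : A w -> 0 <= k n w by move=> _; rewrite /k le_max lexx.
have kE n w : A w -> k n w = (ln M)%:E - lne (cdist z w + n.+1%:R^-1)%:E.
  move=> Aw; apply/max_idPr; rewrite sube_ge0 ?orbT//.
  rewrite lne_EFin ?ltr_wpDl ?cmod_ge0 ?invr_gt0// lee_fin ler_ln ?posrE//.
    rewrite (le_trans _ (AM w Aw))// lerD2l invf_le1 ?ler1n//.
  by rewrite ltr_wpDl ?cmod_ge0 ?invr_gt0.
have mk n : measurable_fun A (k n).
  apply: measurable_funTS; apply: measurable_maxe => //.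
  apply: emeasurable_funB => //; apply: measurable_lne_EFin.
  apply: measurable_funD => //; exact: measurable_cmodB.
have knd w : A w -> nondecreasing_seq (k ^~ w).
  move=> Aw m n mn; rewrite !kE//; apply: leeB => //.
  rewrite !lne_EFin ?ltr_wpDl ?cmod_ge0 ?invr_gt0// lee_fin.
  rewrite ler_ln ?posrE ?ltr_wpDl ?cmod_ge0 ?invr_gt0//.
  by rewrite lerD2l lef_pV2 ?posrE// ler_nat.
have kle n : \int[mu]_(w in A) k n w <= E%:E.
  have n0 : (0 < n.+1%:R^-1 :> R)%R by rewrite invr_gt0.
  have [z' z'z] := hz _ n0; apply: le_trans; rewrite /pot -(prob1_integral mA muA).
  - apply: ge0_le_integral => //; first by move=> w; exact: k0.
      by apply: measurable_funTS; exact: measurable_log_kernel.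
    move=> w Aw; rewrite /k /log_kernel; apply: le_max2 => //; apply: leeB => //.
    have [zw|zw] := leP (cdist z' w) 0%R; first by rewrite le0_lneNy// leNye.
    rewrite !lne_EFin// ?ltr_wpDl ?cmod_ge0// lee_fin ler_ln ?posrE ?ltr_wpDl ?cmod_ge0//.
    by rewrite (le_trans (cmod_triangleB (z : R[i]) _ _))// addrC lerD2l ltW.
  - exact: measurable_log_kernel.
  - by move=> w; exact: log_kernel_ge0.
rewrite /pot -(prob1_integral mA muA); last 2 first.
- exact: measurable_log_kernel.
- by move=> w; exact: log_kernel_ge0.
apply: (@le_trans _ _ (\int[mu]_(w in A) limn (k ^~ w))).
  apply: ge0_le_integral => //.
  - by move=> w _; exact: log_kernel_ge0.
  - by apply: measurable_funTS; exact: measurable_log_kernel.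
  - by apply: (emeasurable_fun_cvg k) => // w Aw; apply: ereal_nondecreasing_is_cvgn; exact: knd.
  - move=> w Aw; rewrite leNgt; apply/negP.
    have lk n : k n w <= limn (k ^~ w).
      apply: lime_ge; first by apply: ereal_nondecreasing_is_cvgn; exact: knd.
      by exists n => // m /= nm; exact: knd.
    move=> lt; have l0 := le_trans (k0 0%N w Aw) (lk 0%N).
    case lE : (limn (k ^~ w)) lt l0 => [l| |]// lt l0; last first.
      by move: lt; rewrite ltNge leey.
    have zw1 : (cdist z w <= M)%R by have := AM w Aw; lra.
    move: lt; rewrite log_kernelE// sub_lne_gt// => /ltr_add_invr[n].
    rewrite -sub_lne_gt// -kE// -lE => h.
    by have := lt_le_trans h (lk n); rewrite ltxx.
have -> : \int[mu]_(w in A) limn (k ^~ w) = limn (fun n => \int[mu]_(w in A) k n w).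
  exact: (@monotone_convergence _ _ _ mu A mA k mk k0 knd).
apply: lime_le.
  apply: ereal_nondecreasing_is_cvgn => m n mn; apply: ge0_le_integral => //.
    by move=> w; exact: k0.
  by move=> w Aw; exact: knd.
by apply: nearW.
Qed.

End LogKernelBounds.

(** * A discrete mean value inequality *)

Section DiscreteMeanValue.
Local Open Scope ereal_scope.
Variable R : realType.
Implicit Types (M c : R) (z w : borelC R) (v : R[i]).
Local Notation cdist z w := (cmod ((z : R[i]) - (w : R[i]))%R).

Lemma roots_XnsubC n v : (0 < n)%N -> exists ss : seq R[i],
  [/\ size ss = n, v \in ss, (forall s, s \in ss -> cmod s = cmod v) &
      forall x : R[i], (\prod_(s <- ss) (x - s) = x ^+ n - v ^+ n)%R].
Proof.
move=> n0; have [ss ssE] := closed_field_poly_normal ('X^n - (v ^+ n)%:P : {poly R[i]})%R.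
rewrite lead_coefDl ?lead_coefXn ?scale1r in ssE; last first.
  by rewrite size_polyN size_polyXn ltnS (leq_trans (size_polyC_leq1 _)).
have mem s : (s \in ss) = (s ^+ n == v ^+ n)%R.
  by rewrite -root_prod_XsubC -ssE rootE !hornerE subr_eq0.
exists ss; split.
- by have /eqP := size_prod_XsubC ss id; rewrite -ssE size_XnsubC// eqSS => /eqP.
- by rewrite mem.
- move=> s; rewrite mem => /eqP sv; apply/eqP.
  by rewrite -(eqrXn2 n0) ?cmod_ge0// -!cmodX sv.
- move=> x; rewrite (_ : x ^+ n - v ^+ n = ('X^n - (v ^+ n)%:P).[x])%R; last by rewrite !hornerE.
  by rewrite ssE horner_prod; apply: eq_bigr => s _; rewrite !hornerE.
Qed.

(** Averaging [log |z + s - w|] over the [n] rotations [s] of [v] gives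
    [log |(w - z)^n - v^n| / n], which exceeds [log |z - w|] by at most
    [th ^+ n / n]. *)
Lemma discrete_mean_value (mu : probability (borelC R) R) (A : set (borelC R))
    M (dl th : R) z v n : measurable A -> mu A = 1 -> (1 <= M)%R ->
  (0 < dl)%R -> (0 <= th)%R -> (cmod v <= th * dl)%R ->
  (forall w, A w -> dl <= cdist z w)%R ->
  (forall w, A w -> cdist z w + cmod v <= M)%R -> (0 < n)%N ->
  exists ss : seq R[i], [/\ size ss = n, v \in ss,
    (forall s, s \in ss -> cmod s = cmod v) &
    (n%:R)%:E * pot mu M z <=
    \sum_(s <- ss) pot mu M ((z : R[i]) + s)%R + (th ^+ n)%:E].
Proof.
move=> mA muA M1 dl0 th0 vth Adl AM n0.
have [ss [sss vss cs ssE]] := roots_XnsubC v n0.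
exists ss; split => //.
have muA1 : (mu : {measure set (borelC R) -> \bar R}) A = 1 := muA.
have M0 : (0 < M)%R by rewrite (lt_le_trans ltr01).
have pA (x : borelC R) : pot mu M x = \int[mu]_(w in A) log_kernel M x w.
  rewrite /pot -(prob1_integral mA muA)//.
  - exact: measurable_log_kernel.
  - by move=> w; exact: log_kernel_ge0.
have mk (x : borelC R) : measurable_fun A (log_kernel M x).
  by apply: measurable_funTS; exact: measurable_log_kernel.
have k0 (x : borelC R) w : A w -> 0 <= log_kernel M x w.
  by move=> _; exact: log_kernel_ge0.
have thn0 : 0 <= (th ^+ n)%:E by rewrite lee_fin exprn_ge0.
rewrite pA -(ge0_integralZl mu mA (mk z) (k0 z)) ?lee_fin//.
rewrite (eq_bigr (fun s => \int[mu]_(w in A) log_kernel M ((z : R[i]) + s)%R w))//.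
rewrite -ge0_integral_sum//; last by move=> s; exact: k0.
have -> : (th ^+ n)%:E = \int[mu]_(w in A) (cst (th ^+ n)%:E w).
  by rewrite (integral_cst mu mA) muA1 mule1.
rewrite -ge0_integralD//; last 2 first.
- by move=> w Aw; apply: sume_ge0 => s _; exact: log_kernel_ge0.
- by apply: emeasurable_sum => s; exact: mk.
apply: ge0_le_integral => //.
- by move=> w Aw; rewrite mule_ge0 ?lee_fin ?log_kernel_ge0.
- by apply: emeasurable_funM.
- by apply: emeasurable_funD => //; apply: emeasurable_sum => s; exact: mk.
move=> w Aw; have zw := Adl w Aw.
have zw0 : (0 < cdist z w)%R by rewrite (lt_le_trans dl0).
have cv := cmod_ge0 v.
have zwM : (cdist z w <= M)%R by have := AM w Aw; lra.
rewrite (log_kernelE M1 zwM) lne_EFin//.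
have -> : \sum_(s <- ss) log_kernel M ((z : R[i]) + s)%R w =
    \sum_(s <- ss) ((ln M)%:E - lne (cmod ((w : R[i]) - z - s)%R)%:E).
  apply: eq_big_seq => s /cs sv.
  have e : cdist ((z : R[i]) + s)%R w = cmod ((w : R[i]) - z - s)%R.
    by rewrite cmodBC; congr cmod; rewrite opprD addrA.
  rewrite log_kernelE// e// (le_trans _ (AM w Aw))//.
  by rewrite (le_trans (cmod_triangle _ _))// cmodN cmodBC sv.
rewrite sum_sub_lne => [|s _]; last exact: cmod_ge0.
rewrite -cmod_prod ssE sss.
have P : (cmod (((w : R[i]) - z) ^+ n - v ^+ n) <= cdist z w ^+ n * (1 + th ^+ n))%R.
  rewrite (le_trans (cmod_triangle _ _))// cmodN !cmodX (cmodBC (w : R[i])) mulrDr mulr1.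
  have vz : (cmod v <= cdist z w * th)%R.
    by apply: (le_trans vth); rewrite mulrC ler_wpM2r.
  by rewrite lerD2l -exprMn; apply: lerXn2r => //; rewrite nnegrE ?cmod_ge0// mulr_ge0// cmod_ge0.
have [Q0|Q0] := leP (cmod (((w : R[i]) - z) ^+ n - v ^+ n)%R) 0%R.
  by rewrite [in leRHS]le0_lneNy// addey// addye// leey.
rewrite lne_EFin// /cst -!(EFinM, EFinD) lee_fin mulrBr -addrA lerD2l.
have : (ln (cmod (((w : R[i]) - z) ^+ n - v ^+ n)) <=
        n%:R * ln (cdist z w) + th ^+ n)%R.
  rewrite (le_trans (_ : _ <= ln (cdist z w ^+ n * (1 + th ^+ n))))%R//.
    by rewrite ler_ln ?posrE// mulr_gt0 ?exprn_gt0// ltr_wpDr// exprn_ge0.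
  rewrite lnM ?posrE ?exprn_gt0 ?ltr_wpDr ?exprn_ge0// lnXn// mulr_natl lerD2l.
  by apply: le_ln1Dx; rewrite (lt_le_trans _ (exprn_ge0 _ th0))// ltrN10.
lra.
Qed.

End DiscreteMeanValue.

(** * Potentials near a set of full measure *)

Lemma closed_distance (R : realType) (S : set (Cplx R)) (z : R[i]) :
  closed S -> S !=set0 -> ~ S z ->
  exists2 dl : R, 0 < dl & (forall w : R[i], S w -> dl <= cmod (z - w)) /\
    (forall e : R, 0 < e -> exists2 w : R[i], S w & cmod (z - w) < dl + e).
Proof.
move=> /closed_CplxP cS [a Sa] nSz.
pose X : set R := [set cmod (z - w) | w in (S : set R[i])].
have lX : has_lbound X by exists 0 => _ [w _ <-]; exact: cmod_ge0.
have iX : has_inf X by split => //; exists (cmod (z - a)), a.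
have lb w : S w -> inf X <= cmod (z - w).
  by move=> Sw; apply: ge_inf => //; exists w.
have ub e : 0 < e -> exists2 w : R[i], S w & cmod (z - w) < inf X + e.
  move=> e0; have [_ [w Sw <-] h] := inf_adherent e0 iX.
  by exists w.
exists (inf X) => //.
rewrite ltNge; apply/negP => X0; apply: nSz; apply: cS => e e0.
have [w Sw wz] := ub e e0; exists w => //.
by rewrite cmodBC; lra.
Qed.


Section NearSupport.
Local Open Scope ereal_scope.
Variable R : realType.
Local Notation cdist z w := (cmod ((z : R[i]) - (w : R[i]))%R).

(** This will compare the distances [a] from [z] and [b] from [y] to a point of the
    support, where [y] is almost the point of the support nearest to [z] and [dl]
    is the distance from [z] to the support: the ratio [b / a] is at most [3], and
    it is close to [1] as soon as [b] is large compared with [dl]. *)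
Lemma ln_ratio_bound (a b dl r : R) : (0 < dl -> 0 < b -> dl <= a ->
  b <= a + 2 * dl -> 4 * dl <= r ->
  ln b - ln a <= ln 3 * (b < r)%R%:R + 4 * dl / r)%R.
Proof.
move=> dl0 b0 da ba dr; have a0 : (0 < a)%R by exact: lt_le_trans da.
have r0 : (0 < r)%R by lra.
have q0 : (0 < dl / a)%R by exact: divr_gt0.
have q1 : (0 < dl / r)%R by exact: divr_gt0.
have [br|rb] := ltP b r.
  have b3 : (b <= 3 * a)%R by lra.
  have a3 : (0 < 3 * a)%R by lra.
  have : (ln b <= ln (3 * a))%R by rewrite ler_ln.
  rewrite lnM ?posrE// => h.
  rewrite /= mulr1 [(4 * dl / r)%R](_ : _ = 4 * (dl / r))%R ?mulrA//; lra.
have q2 : (0 < 1 + 2 * (dl / a))%R by lra.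
have : (ln b <= ln (a * (1 + 2 * (dl / a))))%R.
  rewrite ler_ln ?posrE ?mulr_gt0//.
  by rewrite mulrDr mulr1 mulrCA [(a * (dl / a))%R]mulrC divfK ?gt_eqF.
rewrite lnM ?posrE//.
have : (ln (1 + 2 * (dl / a)) <= 2 * (dl / a))%R by apply: le_ln1Dx; lra.
have : (dl / a <= 2 * (dl / r))%R.
  have ar : (r <= 2 * a)%R by lra.
  have h : (1 <= 2 * a / r)%R by rewrite ler_pdivlMr// mul1r.
  rewrite ler_pdivrMr//.
  have -> : (2 * (dl / r) * a = dl * (2 * a / r))%R by field; rewrite gt_eqF.
  by rewrite ler_peMr// ltW.
rewrite /= mulr0 add0r [(4 * dl / r)%R](_ : _ = 4 * (dl / r))%R ?mulrA//; lra.
Qed.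

Variables (mu : probability (borelC R) R) (A : set (borelC R)) (M : R).
Hypotheses (mA : measurable A) (muA : mu A = 1) (M1 : (1 <= M)%R).

Lemma pot_full_set x : pot mu M x = \int[mu]_(w in A) log_kernel M x w.
Proof.
rewrite /pot -(prob1_integral mA muA)//; first exact: measurable_log_kernel.
by move=> w; exact: log_kernel_ge0.
Qed.

Lemma measurable_ballC (y : R[i]) (r : R) :
  measurable ([set w | (cdist y w < r)%R] : set (borelC R)).
Proof.
rewrite (_ : mkset _ = [set w | (cdist w y < r)%R]).
  by apply: open_borelC; exact: open_ballC.
by apply/seteqP; split => w /=; rewrite cmodBC.
Qed.

Lemma pot_le_nearby (z y : R[i]) (c r : R) : (0 <= c)%R ->
  (forall w, A w -> log_kernel M z w <=
     log_kernel M y w + (ln 3 * (cdist y w < r)%R%:R + c)%:E) ->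
  pot mu M z <= pot mu M y +
    ((ln 3)%:E * mu [set w | (cdist y w < r)%R] + c%:E).
Proof.
move=> c0 ptw; pose Ball : set (borelC R) := [set w | (cdist y w < r)%R].
have mBall : measurable Ball by exact: measurable_ballC.
have ln3 : (0 <= ln 3 :> R)%R by rewrite ln_ge0//; lra.
have BallE w : \1_Ball w = (cdist y w < r)%R%:R :> R.
  rewrite indicE; congr (nat_of_bool _)%:R.
  by apply/idP/idP => [/set_mem//|?]; apply/mem_set.
have {}ptw w : A w -> log_kernel M z w <=
    log_kernel M y w + ((ln 3)%:E * (\1_Ball w)%:E + cst c%:E w).
  by move=> Aw; rewrite BallE -EFinM -EFinD; exact: ptw.
rewrite -/Ball; move: (Ball) mBall ptw {BallE} => D mD ptw.
have mk x : measurable_fun A (log_kernel M x).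
  by apply: measurable_funTS; exact: measurable_log_kernel.
have k0 x w : A w -> 0 <= log_kernel M x w by move=> _; exact: log_kernel_ge0.
have m1 : measurable_fun A (fun w => (\1_D w)%:E : \bar R).
  by apply: measurable_funTS; apply/measurable_EFinP; exact: measurable_indic.
have i0 w : A w -> 0 <= (\1_D w)%:E :> \bar R by rewrite lee_fin.
have l0 : 0 <= (ln 3 : R)%:E by rewrite lee_fin.
have m2 : measurable_fun A (fun w => (ln 3)%:E * (\1_D w)%:E : \bar R).
  exact: emeasurable_funM.
have i2 w : A w -> 0 <= (ln 3)%:E * (\1_D w)%:E :> \bar R.
  by move=> Aw; rewrite mule_ge0// i0.
have m3 : measurable_fun A (cst c%:E : _ -> \bar R) by exact: measurable_cst.
have i3 w : A w -> 0 <= (cst c%:E w : \bar R) by rewrite lee_fin.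
have m4 : measurable_fun A (fun w => (ln 3)%:E * (\1_D w)%:E + cst c%:E w : \bar R).
  exact: emeasurable_funD.
have i4 w : A w -> 0 <= (ln 3)%:E * (\1_D w)%:E + cst c%:E w :> \bar R.
  by move=> Aw; apply: adde_ge0; [exact: i2|exact: i3].
have m5 : measurable_fun A (fun w => log_kernel M y w +
    ((ln 3)%:E * (\1_D w)%:E + cst c%:E w)) by exact: emeasurable_funD.
have := @ge0_le_integral _ _ _ mu _ mA _ _ (k0 z) (mk z) m5 ptw.
rewrite !pot_full_set => /le_trans; apply.
rewrite (ge0_integralD mu mA (k0 y) (mk y) i4 m4) (ge0_integralD mu mA i2 m2 i3 m3).
rewrite (ge0_integralZl mu mA m1 i0 l0) (integral_indic mu mA mD) (integral_cst mu mA).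
have muA1 : (mu : {measure set (borelC R) -> \bar R}) A = 1 := muA.
rewrite muA1 mule1; apply: leeD => //; apply: leeD => //.
apply: lee_wpmul2l => //; apply: le_measure; rewrite ?inE//.
exact: measurableI.
Qed.

(** The kernels at [z] and [y] differ by at most [ln 3] on the disc of radius [r]
    about [y], which has small mass because the potential at [y] is finite, and by
    little outside it. *)
Lemma pot_near_support (E L dl r : R) (z y : R[i]) :
  (0 < r)%R -> (r <= M)%R -> (0 < dl)%R -> (4 * dl <= r)%R -> (0 < L)%R ->
  ln (M / r) = L ->
  (forall w, A w -> dl <= cdist z w)%R -> (cmod (z - y) <= 2 * dl)%R ->
  (forall w, A w -> cdist z w <= M)%R -> (forall w, A w -> cdist y w <= M)%R ->
  pot mu M y <= E%:E ->
  pot mu M z <= (E + (ln 3 * (E / L) + 4 * dl / r))%:E.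
Proof.
move=> r0 rM dl0 dr L0 LE zA zy zM yM Uy.
have c0 : (0 <= 4 * dl / r)%R by apply: divr_ge0; lra.
have ptw w : A w -> log_kernel M z w <=
     log_kernel M y w + (ln 3 * (cdist y w < r)%R%:R + 4 * dl / r)%:E.
  move=> Aw; have aw := zA w Aw.
  rewrite (log_kernelE M1 (zM w Aw)) (log_kernelE M1 (yM w Aw)).
  have ba : (cdist y w <= cdist z w + 2 * dl)%R.
    have := cmod_triangleB z y w; rewrite (cmodBC y z); lra.
  move: (cdist z w) (cdist y w) aw ba => a b da ba.
  have a0 : (0 < a)%R by exact: lt_le_trans da.
  have [b0|b0] := leP b 0%R.
    by rewrite (le0_lneNy (x := b%:E)) ?lee_fin// addey// addye// leey.
  rewrite !lne_EFin// -!EFinD lee_fin.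
  have := ln_ratio_bound dl0 b0 da ba dr; lra.
have mass := pot_ball_measure r0 rM M1 Uy; rewrite LE in mass.
have := pot_le_nearby c0 ptw.
have : mu [set w | (cdist y w < r)%R] \is a fin_num.
  by apply: fin_num_measure; exact: measurable_ballC.
move: (mu _) mass => [b| |]//; rewrite -EFinM lee_fin => mass _.
move=> /le_trans; apply; rewrite EFinD; apply: leeD => //.
rewrite -EFinM -EFinD lee_fin lerD2r ler_wpM2l ?ln_ge0//; first lra.
by rewrite ler_pdivlMr// mulrC.
Qed.

End NearSupport.

(** * A closed set of full measure with small potential *)

Section NearEquilibrium.
Local Open Scope ereal_scope.
Variables (R : realType) (f : {poly int}).
Hypotheses (fm : f \is monic) (fd : (2 <= (size f).-1)%N).
Hypothesis preper_julia : [set z : R[i] | preperiodic f z] `<=` julia f.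
Variable mu : probability (borelC R) R.
Hypothesis mu_eq : is_equilibrium_measure f mu.
Local Notation J := (julia f : set (borelC R)).
Local Notation B := (escape_bound R fm fd).
Local Notation cdist z w := (cmod ((z : R[i]) - (w : R[i]))%R).
Local Notation V := (robin f mu).

Section FrostmanSet.
Variable M1 : R.
Hypothesis M1_large : (2 * B + 2 <= M1)%R.
Local Notation E1 := (ln M1 - V)%R.

Let B1 : (1 <= B)%R. Proof. exact: escape_bound_ge1. Qed.
Let BM1 : (2 * B <= M1)%R. Proof. by move: M1_large; lra. Qed.
Let M1_1 : (1 <= M1)%R. Proof. by move: M1_large B1; lra. Qed.
Let E10 : (0 <= E1)%R. Proof. exact: (robin_le_ln preper_julia mu_eq BM1). Qed.
Let mJ : measurable J := measurable_julia fm fd.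
Let muJ1 : mu J = 1 := muJ mu_eq.

(** The potential is at most its mean [ln M1 - robin] on this set, which has full
    measure and is closed, so that it serves as a support of [mu]. *)
Definition frostman_set : set (borelC R) :=
  J `&` [set z | pot mu M1 z <= E1%:E].
Local Notation S := frostman_set.

Lemma measurable_frostman_set : measurable S.
Proof.
apply: measurableI => //.
have -> : [set z | pot mu M1 z <= E1%:E] = ~` [set z | E1%:E < pot mu M1 z].
  by apply/seteqP; split => z /=; rewrite leNgt => /negP.
apply: measurableC; rewrite -[X in measurable X]setTI.
by apply: emeasurable_fun_o_infty => //; exact: measurable_pot.
Qed.

Lemma frostman_set_full : mu S = 1.
Proof.
have -> : S = ~` (~` J `|` [set z | E1%:E < pot mu M1 z]).
  rewrite setCU setCK /S; congr (_ `&` _).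
  by apply/seteqP; split => z /=; rewrite leNgt => /negP.
have mU : measurable [set z | E1%:E < pot mu M1 z].
  rewrite -[X in measurable X]setTI.
  by apply: emeasurable_fun_o_infty => //; exact: measurable_pot.
have mCJ := measurableC mJ.
have U0 : mu [set z | E1%:E < pot mu M1 z] = 0.
  exact: (pot_le_ae preper_julia mu_eq BM1).
have h : mu (~` J `|` [set z | E1%:E < pot mu M1 z]) = 0.
  apply: (etrans (measureU0 mCJ mU U0)); exact: prob1_negligible.
by rewrite probability_setC ?h ?sube0//; exact: measurableU.
Qed.

Lemma frostman_set_nonempty : S !=set0.
Proof.
apply/set0P; apply/eqP => S0; have := frostman_set_full.
by rewrite S0 measure0 => /eqP; rewrite eqe eq_sym oner_eq0.
Qed.

Lemma frostman_set_julia z : S z -> J z. Proof. by case. Qed.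

Let dist_S_le z w : S w -> (cdist z w <= cmod z + B)%R.
Proof.
move=> /frostman_set_julia/(julia_bounded fm fd) wB.
by rewrite (le_trans (cmod_triangle _ _))// cmodN lerD2l.
Qed.

Lemma frostman_set_closed : closed (S : set (Cplx R)).
Proof.
apply/closed_CplxP => z zS; have Jz : J z.
  have /closed_CplxP cJ := @julia_closed R f fm fd; apply: cJ => e /zS[w /frostman_set_julia Jw wz].
  by exists w.
split => //; apply: (pot_lower_semicontinuous mJ muJ1 M1_1) => [w Jw|e e0].
  have := julia_dist (lexx (2 * B)%R) Jz Jw; move: M1_large; lra.
by have [w [_ Uw] wz] := zS e e0; exists w.
Qed.

(** Outside the set, compare with an almost nearest point [y] of it; the choice of
    [r] makes the mass of the disc of radius [r] about [y] small, and [t] is then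
    chosen small compared with [r]. *)
Lemma pot_near_frostman_set (e : R) : (0 < e)%R ->
  exists2 t : R, (0 < t <= 1)%R & forall z w : R[i], S w -> (cdist z w <= t)%R ->
    pot mu M1 z <= (E1 + e)%:E.
Proof.
have SU y : S y -> pot mu M1 y <= E1%:E by case.
move=> e0; move: M1_1 E10 SU => M11; move: E1 => E E0 SU.
have ln3 : (0 < ln 3 :> R)%R by rewrite ln_gt0//; lra.
have [L LE L0] : exists2 L : R, (ln 3 * (E / L) <= e / 2)%R & (0 < L)%R.
  pose L : R := (2 * E * ln 3 / e + 1)%R.
  have L0 : (0 < L)%R by rewrite ltr_wpDl// divr_ge0 ?mulr_ge0// ltW.
  exists L => //; rewrite mulrA ler_pdivrMr// /L mulrDr mulr1.
  have -> : (e / 2 * (2 * E * ln 3 / e) = ln 3 * E)%R by field; rewrite gt_eqF.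
  by rewrite lerDl divr_ge0// ltW.
have M10 : (0 < M1)%R by exact: lt_le_trans M11.
have [r [r0 rM lnMr]] : exists r : R, [/\ 0 < r, r <= M1 & ln (M1 / r) = L]%R.
  exists (M1 * expR (- L))%R; split.
  - by rewrite mulr_gt0// expR_gt0.
  - by rewrite ler_piMr ?(ltW M10)// -expR0 ler_expR oppr_le0 ltW.
  - by rewrite invfM mulrA divff ?gt_eqF// mul1r -expRN opprK expRK.
exists (Num.min 1 (Num.min (r / 4) (e * r / 8)))%R.
  apply/andP; split; last by rewrite ge_min lexx.
  by rewrite !lt_min ltr01 !divr_gt0// mulr_gt0.
move=> z z' Sz'; rewrite !le_min => /and3P[z1 zr zer].
have [Sz|nSz] := pselect (S z).
  by apply: (le_trans (SU z Sz)); rewrite lee_fin lerDl ltW.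
have [dl dl0 [dlS near]] := closed_distance frostman_set_closed frostman_set_nonempty nSz.
have [y Sy zy] := near dl dl0.
have dlz : (dl <= cmod (z - z'))%R by exact: dlS.
have dr : (4 * dl <= r)%R by lra.
have zy2 : (cmod (z - y) <= 2 * dl)%R by lra.
have yM w : S w -> (cdist y w <= M1)%R.
  by move=> Sw; apply: (julia_dist BM1); exact: frostman_set_julia.
have zM w : S w -> (cdist z w <= M1)%R.
  move=> Sw; have := dist_S_le z Sw; have := dist_S_le z' Sz'.
  have := cmod_triangle (z - z')%R z'; rewrite subrK.
  have := julia_bounded fm fd (frostman_set_julia Sz'); move: M1_large; lra.
apply: le_trans (pot_near_support measurable_frostman_set frostman_set_full M11
  r0 rM dl0 dr L0 lnMr dlS zy2 zM yM (SU y Sy)) _.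
rewrite lee_fin lerD2l.
have : (4 * dl / r <= e / 2)%R by rewrite ler_pdivrMr//; lra.
lra.
Qed.

Lemma pot_shift (M M' : R) z : (1 <= M)%R -> (1 <= M')%R ->
  (cmod z + B <= M)%R -> (cmod z + B <= M')%R ->
  (ln M)%:E - pot mu M z = (ln M')%:E - pot mu M' z.
Proof.
move=> M_1 M'_1 zM zM'.
rewrite -(log_integral_pot measurable_frostman_set frostman_set_full M_1); last first.
  by move=> w Sw; exact: le_trans (dist_S_le z Sw) zM.
rewrite -(log_integral_pot measurable_frostman_set frostman_set_full M'_1)//.
by move=> w Sw; exact: le_trans (dist_S_le z Sw) zM'.
Qed.

Lemma pot_le_dist (M dl : R) z : (1 <= M)%R -> (cmod z + B <= M)%R -> (0 < dl)%R ->
  (forall w : R[i], S w -> (dl <= cmod (z - w))%R) ->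
  pot mu M z <= (ln M - ln dl)%:E.
Proof.
move=> M_1 zM dl0 dlS; rewrite (pot_full_set M measurable_frostman_set frostman_set_full).
have M0 : (0 < M)%R by exact: lt_le_trans M_1.
have ptw w : S w -> log_kernel M z w <= (ln M - ln dl)%:E.
  move=> Sw; have dw := dlS w Sw.
  have w0 : (0 < cdist z w)%R by exact: lt_le_trans dw.
  rewrite (log_kernelE M_1 (le_trans (dist_S_le z Sw) zM)) lne_EFin// -EFinB lee_fin.
  by rewrite lerD2l lerN2 ler_ln.
have := @ge0_le_integral _ _ _ mu _ measurable_frostman_set _ (cst (ln M - ln dl)%:E)
  (fun w _ => log_kernel_ge0 M z w)
  (measurable_funTS (measurable_log_kernel M z)) (measurable_cst _) ptw.
have muS1 : (mu : {measure set (borelC R) -> \bar R}) S = 1 := frostman_set_full.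
by rewrite (integral_cst mu measurable_frostman_set) muS1 mule1.
Qed.

Lemma pot_fin (M : R) z : (1 <= M)%R -> (cmod z + B <= M)%R -> pot mu M z < +oo.
Proof.
move=> M_1 zM; have [Sz|nSz] := pselect (S z).
  have zM1 : (cmod z + B <= M1)%R.
    have := julia_bounded fm fd (frostman_set_julia Sz); move: M1_large; lra.
  have [_ Uz] := Sz.
  have : (ln M1)%:E - pot mu M1 z = (ln M)%:E - pot mu M z by apply: pot_shift.
  have fM1 : pot mu M1 z \is a fin_num.
    by rewrite ge0_fin_numE ?pot_ge0// (le_lt_trans Uz) ?ltry.
  move: fM1; case: (pot mu M1 z) => [r| |]// _.
  by case: (pot mu M z) => [x| |]// _; rewrite ltry.
have [dl dl0 [dlS _]] := closed_distance frostman_set_closed frostman_set_nonempty nSz.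
by apply: (le_lt_trans (pot_le_dist M_1 zM dl0 dlS)); rewrite ltry.
Qed.

End FrostmanSet.
End NearEquilibrium.

(** * The logarithmic potential of the equilibrium measure *)

Section LogPotential.
Local Open Scope ereal_scope.
Variables (R : realType) (f : {poly int}).
Hypotheses (fm : f \is monic) (fd : (2 <= (size f).-1)%N).
Hypothesis preper_julia : [set z : R[i] | preperiodic f z] `<=` julia f.
Variable mu : probability (borelC R) R.
Hypothesis mu_eq : is_equilibrium_measure f mu.
Implicit Types (z w v : R[i]).
Local Notation J := (julia f : set (borelC R)).
Local Notation B := (escape_bound R fm fd).
Local Notation cdist z w := (cmod ((z : R[i]) - (w : R[i]))%R).
Local Notation S := (frostman_set f mu (2 * B + 2)).

Let mJ : measurable J := measurable_julia fm fd.
Let muJ1 : mu J = 1 := muJ mu_eq.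

(** Real-valued because the potential turns out to be finite everywhere
    ([log_integral]); this is what allows arithmetic with its values. *)
Definition log_pot z : R := fine (\int[mu]_(w in J) lne (cdist z w)%:E).

Let B1 : (1 <= B)%R. Proof. exact: escape_bound_ge1. Qed.

Lemma far_bound_dist M z w : (cmod z + B <= M)%R -> J w -> (cdist z w <= M)%R.
Proof.
move=> zM /(julia_bounded fm fd) wB; apply: le_trans zM.
by rewrite (le_trans (cmod_triangle _ _))// cmodN lerD2l.
Qed.

Lemma far_bound_ge1 M z : (cmod z + B <= M -> 1 <= M)%R.
Proof. by move: B1 (cmod_ge0 z); lra. Qed.

Lemma log_potP M z : (cmod z + B <= M)%R ->
  pot mu M z = (ln M - log_pot z)%:E /\
  \int[mu]_(w in J) lne (cdist z w)%:E = (log_pot z)%:E.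
Proof.
move=> zM; have M1 := far_bound_ge1 zM.
have := pot_fin preper_julia mu_eq (lexx _) M1 zM.
rewrite /log_pot (log_integral_pot mJ muJ1 M1); last by move=> w; exact: far_bound_dist.
have := pot_ge0 mu M z; case: (pot mu M z) => [r| |]// _ _.
by split; congr (_%:E) => /=; lra.
Qed.

Lemma log_integral z : \int[mu]_(w in J) lne (cdist z w)%:E = (log_pot z)%:E.
Proof. by case: (log_potP (lexx (cmod z + B)%R)). Qed.

Lemma pot_log_pot M z : (cmod z + B <= M)%R -> pot mu M z = (ln M - log_pot z)%:E.
Proof. by case/log_potP. Qed.

Lemma log_pot_le z M : (cmod z + B <= M)%R -> (log_pot z <= ln M)%R.
Proof. by move=> /pot_log_pot zM; have := pot_ge0 mu M z; rewrite zM lee_fin; lra. Qed.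

Lemma log_pot_ge_ln z (dl : R) : (0 < dl)%R ->
  (forall w, S w -> dl <= cdist z w)%R -> (ln dl <= log_pot z)%R.
Proof.
move=> dl0 dlS; have zM := lexx (cmod z + B)%R.
have := pot_le_dist preper_julia mu_eq (lexx _) (far_bound_ge1 zM) zM dl0 dlS.
by rewrite pot_log_pot// lee_fin; lra.
Qed.

Lemma log_pot_mean_value (A : set (borelC R)) (dl th : R) z v n :
  measurable A -> mu A = 1 -> A `<=` J ->
  (0 < dl)%R -> (0 <= th)%R -> (cmod v <= th * dl)%R ->
  (forall w, A w -> dl <= cdist z w)%R -> (0 < n)%N ->
  exists ss : seq R[i], [/\ size ss = n, v \in ss &
    (\sum_(s <- ss) log_pot (z + s) <= n%:R * log_pot z + th ^+ n)%R].
Proof.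
move=> mA muA AJ dl0 th0 vth Adl n0.
pose M := (cmod z + cmod v + B)%R; have v0 := cmod_ge0 v.
have zM : (cmod z + B <= M)%R by rewrite /M; lra.
have AM w : A w -> (cdist z w + cmod v <= M)%R.
  by move=> /AJ/(far_bound_dist (lexx (cmod z + B)%R)); rewrite /M; lra.
have [ss [sss vss cs h]] :=
  discrete_mean_value mA muA (far_bound_ge1 zM) dl0 th0 vth Adl AM n0.
exists ss; split => //; move: h.
have zsM s : s \in ss -> (cmod (z + s)%R + B <= M)%R.
  by move=> /cs sv; have := cmod_triangle z s; rewrite sv /M; lra.
rewrite pot_log_pot// -EFinM.
rewrite (eq_big_seq (fun s => (ln M - log_pot (z + s))%:E)); last first.
  by move=> s /zsM sM; rewrite pot_log_pot.
rewrite sumEFin -EFinD lee_fin sumrB big_const_seq count_predT sss.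
by rewrite iter_addr_0 -mulr_natl; lra.
Qed.

End LogPotential.

(** * Frostman's lower bound *)

Section FrostmanBound.
Variables (R : realType) (f : {poly int}).
Hypotheses (fm : f \is monic) (fd : (2 <= (size f).-1)%N).
Hypothesis preper_julia : [set z : R[i] | preperiodic f z] `<=` julia f.
Variable mu : probability (borelC R) R.
Hypothesis mu_eq : is_equilibrium_measure f mu.
Implicit Types (z w v : R[i]).
Local Notation B := (escape_bound R fm fd).
Local Notation V := (robin f mu).
Local Notation log_pot := (log_pot f mu).
Local Notation S := (frostman_set f mu (2 * B + 2)).


Lemma log_pot_near (e : R) : 0 < e -> exists2 t : R, 0 < t <= 1 &
  forall z w, S w -> cmod (z - w) <= t -> V - e <= log_pot z.
Proof.
move=> e0.
have [t t1 ht] := pot_near_frostman_set preper_julia mu_eq (lexx (2 * B + 2)) e0.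
exists t => // z w Sw zw; have := ht z w Sw zw.
have wB := julia_bounded fm fd (frostman_set_julia Sw).
have zM : cmod z + B <= 2 * B + 2.
  have := cmod_triangle (z - w) w; rewrite subrK; case/andP: t1; lra.
by rewrite (pot_log_pot preper_julia mu_eq zM) lee_fin; lra.
Qed.

Lemma log_pot_bounded_below : exists b : R, forall z, b <= log_pot z.
Proof.
have [t /andP[t0 _] ht] := log_pot_near ltr01.
exists (Num.min (V - 1) (ln t)) => z; rewrite ge_min.
have [[w Sw zw]|h] := pselect (exists2 w, S w & cmod (z - w) <= t).
  by rewrite (ht z w Sw zw).
apply/orP; right; apply: (log_pot_ge_ln preper_julia mu_eq t0) => w Sw.
by rewrite leNgt; apply/negP => zw; apply: h; exists w => //; exact: ltW.
Qed.

Lemma exists_small_power (th e : R) : 0 <= th -> th < 1 -> 0 < e ->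
  exists2 n, (0 < n)%N & th ^+ n < e.
Proof.
move=> th0 th1 e0.
have : (fun n => th ^+ n) @ \oo --> 0 by apply: cvg_expr; rewrite ger0_norm.
move=> /cvgr0Pnorm_lt/(_ e e0)[n _ h]; exists n.+1 => //.
by have := h n.+1 (leqnSn n); rewrite /= ger0_norm ?exprn_ge0.
Qed.

Lemma cmod_scale z (c : R) : cmod (z * c%:C%C) = cmod z * `|c|.
Proof. by rewrite cmodM /= expr0n addr0 sqrtr_sqr. Qed.

(** Suppose that the infimum [m] is below [V]. A point [x] where [p] is nearly [m]
    stays at distance more than [t] from the support. Rotating about [x] a vector
    [v] that leads to the vicinity of the support, the mean value inequality says
    that [p x] is almost at least the mean of values that are all at least [m],
    one of them being at least [V - e]; with [x] chosen well enough for the given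
    [n], this is a contradiction. *)
Lemma log_pot_ge_robin z : V <= log_pot z.
Proof.
rewrite leNgt; apply/negP => zV.
pose X : set R := range log_pot; have [b bX] := log_pot_bounded_below.
have lX : has_lbound X by exists b => _ [w _ <-].
have iX : has_inf X by split => //; exists (log_pot z), z.
pose m := inf X; have mle w : m <= log_pot w by apply: ge_inf => //; exists w.
have mV : m < V by exact: le_lt_trans zV.
pose e := (V - m) / 2; have e0 : 0 < e by rewrite divr_gt0// subr_gt0.
have Vme : V - e = m + e by rewrite /e; lra.
have [t /andP[t0 t1] near] := log_pot_near e0.
(* The potential at [x] is less than [V], so the support comes within [D] of [x]:
   this makes [th] independent of [x] and lets [n] be chosen before [x]. *)
pose D := expR V; have D0 : 0 < D := expR_gt0 _.
pose th := Num.max 0 (1 - t / (4 * D)).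
have th0 : 0 <= th by rewrite le_max lexx.
have th1 : th < 1.
  have : 0 < t / (4 * D) by rewrite divr_gt0// mulr_gt0.
  by rewrite gt_max ltr01 /=; lra.
have thD : 1 - t / (4 * D) <= th by rewrite le_max lexx orbT.
have e20 : 0 < e / 2 by rewrite divr_gt0.
have [n n0 thn] := exists_small_power th0 th1 e20.
have n0R : 0 < n%:R :> R by rewrite ltr0n.
have en0 : 0 < e / 2 / n%:R by exact: divr_gt0.
have [_ [x _ <-] xm] := inf_adherent en0 iX; rewrite -/m in xm.
have enle : e / 2 / n%:R <= e / 2.
  by rewrite ler_piMr ?(ltW e20)// invf_le1 ?ltr0n// ler1n.
have xfar w : S w -> t < cmod (x - w).
  move=> Sw; rewrite ltNge; apply/negP => xw.
  by have := near x w Sw xw; lra.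
have xS : ~ S x by move=> /xfar; rewrite subrr cmod0; lra.
have [dl dl0 [dlS nearS]] := closed_distance
  (frostman_set_closed (fm := fm) (fd := fd) mu_eq (lexx _))
  (frostman_set_nonempty preper_julia mu_eq (lexx _)) xS.
have tdl : t <= dl.
  apply/ler_addgt0Pr => e' e'0; have [w Sw xw] := nearS e' e'0.
  by rewrite (le_trans (ltW (xfar w Sw)))// ltW.
have dlD : dl < D.
  rewrite -[dl]lnK ?posrE// ltr_expR.
  by rewrite (le_lt_trans (log_pot_ge_ln preper_julia mu_eq dl0 dlS))//; lra.
have t40 : 0 < t / 4 by rewrite divr_gt0.
have [y Sy xy] := nearS (t / 4) t40.
pose a := cmod (x - y); have ta : t < a by exact: xfar.
rewrite -/a in xy; clearbody th.
have a0 : 0 < a by exact: lt_trans ta.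
have ta1 : t / (2 * a) <= 1 by rewrite ler_pdivrMr ?mulr_gt0//; lra.
have ta0 : 0 < t / (2 * a) by rewrite divr_gt0// mulr_gt0.
(* [x + v] is at distance [t / 2] from [y], while [cmod v <= dl - t / 4]. *)
pose v := (y - x) * (1 - t / (2 * a))%:C%C.
have va : cmod v = a - t / 2.
  rewrite /v cmod_scale cmodBC -/a ger0_norm ?subr_ge0//.
  by field; rewrite gt_eqF.
have vth : cmod v <= th * dl.
  have h1 : (1 - t / (4 * D)) * dl <= th * dl.
    by rewrite ler_pM2r.
  apply: le_trans h1; rewrite va mulrBl mul1r.
  have : t / (4 * D) * dl <= t / 4.
    have -> : t / (4 * D) * dl = t / 4 * (dl / D) by field; rewrite gt_eqF.
    by rewrite ler_piMr ?(ltW t40)// ler_pdivrMr// mul1r ltW.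
  lra.
have xv : V - e <= log_pot (x + v).
  apply: (near _ y Sy).
  have -> : x + v - y = (x - y) * (t / (2 * a))%:C%C.
    by rewrite /v rmorphB rmorph1; ring.
  rewrite cmod_scale -/a ger0_norm ?(ltW ta0)//.
  have -> : a * (t / (2 * a)) = t / 2 by field; rewrite gt_eqF.
  lra.
have [ss [sss vss h]] := log_pot_mean_value fm fd preper_julia mu_eq
  (measurable_frostman_set fm fd mu (2 * B + 2))
  (frostman_set_full preper_julia mu_eq (lexx _)) (@frostman_set_julia _ _ _ _)
  dl0 th0 vth dlS n0.
have : n%:R * m + e <= \sum_(s <- ss) log_pot (x + s).
  rewrite (big_rem v)//= -sss.
  have -> : size ss = (size (rem v ss)).+1.
    by rewrite size_rem// prednK//; case: (ss) vss.
  have : (size (rem v ss))%:R * m <= \sum_(s <- rem v ss) log_pot (x + s).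
    elim: (rem v ss) => [|s rs IH]; first by rewrite big_nil mul0r.
    by rewrite big_cons -[size (s :: rs)]/(size rs).+1 -natr1 mulrDl mul1r addrC lerD.
  rewrite -natr1; lra.
have : n%:R * log_pot x < n%:R * m + e / 2.
  have : n%:R * log_pot x < n%:R * (m + e / 2 / n%:R) by rewrite ltr_pM2l.
  by rewrite mulrDr [_ * (e / 2 / _)]mulrC divfK// gt_eqF.
lra.
Qed.

End FrostmanBound.

(** * Invariance of the potential *)

Section Invariance.
Variables (R : realType) (f : {poly int}).
Hypotheses (fm : f \is monic) (fd : (2 <= (size f).-1)%N).
Hypothesis preper_julia : [set z : R[i] | preperiodic f z] `<=` julia f.
Variable mu : probability (borelC R) R.
Hypothesis mu_eq : is_equilibrium_measure f mu.
Implicit Types (z w v : R[i]).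
Local Notation F := (@poly_fun R f).
Local Notation d := (size f).-1.
Local Notation J := (julia f : set (borelC R)).
Local Notation K := (@filled_julia R f).
Local Notation B := (escape_bound R fm fd).
Local Notation V := (robin f mu).
Local Notation log_pot := (log_pot f mu).

Let mJ : measurable J := measurable_julia fm fd.
Let muJ1 : mu J = 1%E := muJ mu_eq.
Let B1 : 1 <= B. Proof. exact: escape_bound_ge1. Qed.

Let d2 : 2 <= d%:R :> R. Proof. by rewrite (ler_nat R 2). Qed.

Lemma log_pot_poly_fun z : V = 0 -> log_pot (F z) = d%:R * log_pot z.
Proof.
move=> V0; pose M := cmod z + cmod (F z) + B.
have z0 := cmod_ge0 z; have Fz0 := cmod_ge0 (F z).
have zM : cmod z + B <= M by rewrite /M; lra.
have M1 : 1 <= M by move: B1; rewrite /M; lra.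
have FzM : cmod (F z) + B <= M ^+ d.
  apply: (@le_trans _ _ M); first by rewrite /M; lra.
  by rewrite -[leLHS]expr1 ler_weXn2l// deg_gt0.
have := pot_invariant preper_julia mu_eq V0 M1 zM FzM.
rewrite (pot_log_pot preper_julia mu_eq zM) (pot_log_pot preper_julia mu_eq FzM).
rewrite -EFinM => -[h0].
have h : ln M - log_pot z = d%:R^-1 * (d%:R * ln M - log_pot (F z)).
  by rewrite mulr_natl -lnXn ?(lt_le_trans ltr01).
have d0 : d%:R != 0 :> R by rewrite gt_eqF// (lt_le_trans _ d2).
have : d%:R * (ln M - log_pot z) = d%:R * ln M - log_pot (F z).
  by rewrite h mulVKf.
lra.
Qed.

Lemma log_pot_iter n z : V = 0 -> log_pot (iter n F z) = d%:R ^+ n * log_pot z.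
Proof.
move=> V0; elim: n => [|n IH]; first by rewrite expr0 mul1r.
by rewrite iterS log_pot_poly_fun// IH exprS mulrA.
Qed.

(** Along the orbit of [z] the potential is multiplied by [d] at each step, yet it
    is bounded above on the filled Julia set. *)
Lemma log_pot_filled_julia_le0 z : V = 0 -> K z -> log_pot z <= 0.
Proof.
move=> V0 Kz; rewrite leNgt; apply/negP => z0.
have bd n : d%:R ^+ n * log_pot z <= ln (2 * B).
  rewrite -log_pot_iter//; apply: (log_pot_le preper_julia mu_eq).
  have := (filled_juliaP fm fd z).1 Kz n; lra.
have h n : n%:R * log_pot z <= ln (2 * B).
  apply: le_trans (bd n); rewrite ler_pM2r// (@le_trans _ _ (2 ^+ n))//.
    by rewrite -natrX ler_nat ltnW// ltn_expl.
  by rewrite lerXn2r// nnegrE.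
have := h (Num.truncn (ln (2 * B) / log_pot z)).+1.
by rewrite leNgt -ltr_pdivrMr// truncnS_gt.
Qed.

Lemma log_pot_gt0_far w : B + 1 < cmod w -> 0 < log_pot w.
Proof.
move=> Bw; apply: (@lt_le_trans _ _ (ln (cmod w - B))); first by rewrite ln_gt0; lra.
apply: (log_pot_ge_ln preper_julia mu_eq); first lra.
move=> s /frostman_set_julia/(julia_bounded fm fd) sB.
have := cmod_triangle (w - s) s; rewrite subrK; lra.
Qed.

(** The potential vanishes along the orbit of [z], whereas it is positive far away. *)
Lemma log_pot_eq0_filled_julia z : V = 0 -> log_pot z = 0 -> K z.
Proof.
move=> V0 z0; have bd n : cmod (iter n F z) <= B + 1.
  rewrite leNgt; apply/negP => /log_pot_gt0_far.
  by rewrite log_pot_iter// z0 mulr0 ltxx.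
move=> /cvgryPge/(_ (B + 2))[n _ /(_ n (leqnn n))] /=.
by have := bd n; lra.
Qed.

(** Otherwise the potential, which vanishes at [z], would by the discrete mean value
    inequality vanish on the whole disc, which would then lie in the filled Julia
    set. *)
Lemma julia_ball_mass z (r : R) : V = 0 -> J z -> 0 < r ->
  mu [set w : R[i] | cmod (w - z) < r] != 0%E.
Proof.
move=> V0 Jz r0; apply/eqP => mu0.
pose A := J `\` [set w : R[i] | cmod (w - z) < r].
have mBall : measurable ([set w : R[i] | cmod (w - z) < r] : set (borelC R)).
  by apply: open_borelC; exact: open_ballC.
have mA : measurable A by exact: measurableD.
have muA : mu A = 1%E.
  have : mu J = (mu A + mu (J `&` [set w : R[i] | (cmod (w - z) < r)%R]))%E.
    exact: (measureDI mu mJ mBall).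
  rewrite muJ1 (_ : mu (J `&` _) = 0%E) ?adde0//.
  by apply: (subset_measure0 _ _ _ mu0) => //; exact: measurableI.
have AJ : A `<=` J by move=> w [].
have Ar w : A w -> r <= cmod (z - w).
  by move=> [_ /= /negP]; rewrite -leNgt cmodBC.
have z0 : log_pot z = 0.
  apply/eqP; rewrite eq_le -{2}V0 (log_pot_ge_robin fm fd)// andbT.
  by apply: log_pot_filled_julia_le0 => //; exact: (julia_filled fm fd).
have upot0 w : 0 <= log_pot w by rewrite -V0 (log_pot_ge_robin fm fd).
move: Jz => /(juliaP fm fd)[_ /(_ r r0)[w wz nKw]].
apply: nKw; apply: log_pot_eq0_filled_julia => //.
pose v := w - z; pose th := cmod v / r.
have th0 : 0 <= th by rewrite divr_ge0 ?cmod_ge0// ltW.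
have th1 : th < 1 by rewrite ltr_pdivrMr// mul1r.
have vth : cmod v <= th * r by rewrite divfK// gt_eqF.
apply/eqP; rewrite eq_le upot0 andbT; apply/ler_addgt0Pr => e e0; rewrite add0r.
have [n n0 thn] := exists_small_power th0 th1 e0.
have [ss [sss vss h]] := log_pot_mean_value fm fd preper_julia mu_eq mA muA AJ r0 th0 vth Ar n0.
rewrite z0 mulr0 add0r in h; apply: (le_trans _ (ltW thn)); apply: le_trans h.
have zv : z + v = w by rewrite /v addrC subrK.
rewrite (big_rem v)//= zv lerDl.
by apply: sumr_ge0.
Qed.

End Invariance.

(** * Jensen's formula *)

Section LogPolynomials.
Local Open Scope ereal_scope.

Lemma lneM_ge0 (R : realType) (x y : R) : (0 <= x)%R -> (0 <= y)%R ->
  lne (x * y)%:E = lne x%:E + lne y%:E.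
Proof.
rewrite !le_eqVlt => /predU1P[<-|x0] /predU1P[<-|y0].
- by rewrite mul0r le0_lneNy.
- by rewrite mul0r (le0_lneNy (lexx _)) lne_EFin// addNye.
- by rewrite mulr0 (le0_lneNy (lexx _)) lne_EFin// addeNy.
- by rewrite !lne_EFin ?mulr_gt0// lnM// EFinD.
Qed.

Lemma prob1_integrable_bounded_above d (T : measurableType d) (R : realType)
    (s : probability T R) A (h : T -> \bar R) (c : R) :
  measurable A -> s A = 1 -> measurable_fun A h -> (0 <= c)%R ->
  (forall t, A t -> h t <= c%:E) ->
  \int[s]_(t in A) h t \is a fin_num -> s.-integrable A h.
Proof.
move=> mA sA mh c0 hc hfin.
have hE := prob1_integral_bounded_above mA sA mh c0 hc.
have sA1 : (s : {measure set T -> \bar R}) A = 1 := sA.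
have ci : s.-integrable A (cst c%:E).
  apply/integrableP; split; first exact: measurable_cst.
  by under eq_integral do rewrite /= ger0_norm//; rewrite (integral_cst s mA) sA1 mule1 ltry.
have chi : s.-integrable A (fun t => c%:E - h t).
  apply/integrableP; split; first by apply: emeasurable_funB.
  under eq_integral => t /[!inE] At do rewrite gee0_abs ?sube_ge0 ?hc ?orbT//.
  move: hfin; rewrite hE; case: (\int[s]_(t in A) (c%:E - h t)) => [r| |]// _.
    by rewrite ltry.
apply: (eq_integrable mA (fun t => c%:E - (c%:E - h t))); last exact: integrableB.
move=> t /[!inE] At; have := hc t At.
by case: (h t) => [r| |]//= _; rewrite -EFinB; congr (_%:E); lra.
Qed.

End LogPolynomials.

Section JensenFormula.
Local Open Scope ereal_scope.
Variables (R : realType) (f : {poly int}).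
Hypotheses (fm : f \is monic) (fd : (2 <= (size f).-1)%N).
Hypothesis preper_julia : [set z : R[i] | preperiodic f z] `<=` julia f.
Variable mu : probability (borelC R) R.
Hypothesis mu_eq : is_equilibrium_measure f mu.
Implicit Types (z w v : R[i]).
Local Notation J := (julia f : set (borelC R)).
Local Notation B := (escape_bound R fm fd).
Local Notation cdist z w := (cmod ((z : R[i]) - (w : R[i]))%R).
Local Notation log_pot := (log_pot f mu).

Let mJ : measurable J := measurable_julia fm fd.
Let muJ1 : mu J = 1 := muJ mu_eq.

Lemma measurable_log_dist z : measurable_fun J (fun w : R[i] => lne (cdist w z)%:E).
Proof.
apply: measurable_funTS; apply: measurable_lne_EFin.
exact: (@measurable_cmodB R _ (borelC R) id (cst (z : borelC R))).
Qed.

Lemma log_dist_integrable z : mu.-integrable J (fun w : R[i] => lne (cdist w z)%:E).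
Proof.
have zM := lexx (cmod z + B)%R; have M1 := far_bound_ge1 zM.
apply: (prob1_integrable_bounded_above (c := ln (cmod z + B)) mJ muJ1).
- exact: measurable_log_dist.
- by rewrite ln_ge0.
- move=> w Jw; have := far_bound_dist zM Jw; rewrite cmodBC => wM.
  have [w0|w0] := leP (cdist w z) 0%R; first by rewrite le0_lneNy// leNye.
  by rewrite lne_EFin// lee_fin ler_ln// posrE (lt_le_trans ltr01).
- under eq_integral do rewrite cmodBC.
  by rewrite (log_integral fm fd preper_julia mu_eq).
Qed.

Lemma log_poly_prod (rs : seq R[i]) :
  mu.-integrable J (fun w : R[i] => lne (\prod_(r <- rs) cdist w r)%R%:E) /\
  \int[mu]_(w in J) lne (\prod_(r <- rs) cdist w r)%R%:E =
    (\sum_(r <- rs) log_pot r)%R%:E.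
Proof.
elim: rs => [|r rs [IH1 IH2]].
  have e : (fun w : R[i] => lne (\prod_(r <- [::]) cdist w r)%R%:E) = cst 0 :> (_ -> \bar R).
    by apply/funext => w; rewrite big_nil lne1.
  rewrite e big_nil; split; first exact: integrable0.
  by rewrite integral0.
have e : (fun w : R[i] => lne (\prod_(s <- r :: rs) cdist w s)%R%:E) =
    (fun w : R[i] => lne (cdist w r)%:E + lne (\prod_(s <- rs) cdist w s)%R%:E).
  apply/funext => w; rewrite big_cons lneM_ge0 ?cmod_ge0//.
  by apply: prodr_ge0 => s _; exact: cmod_ge0.
rewrite e; split; first by apply: integrableD => //; exact: log_dist_integrable.
rewrite (integralD mJ (log_dist_integrable r) IH1) IH2 big_cons EFinD; congr (_ + _).
under eq_integral do rewrite cmodBC.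
exact: (log_integral fm fd preper_julia mu_eq).
Qed.

(** Jensen's formula, in the form it takes for the equilibrium measure. *)
Lemma log_poly (p : {poly R[i]}) (rs : seq R[i]) : p != 0%R ->
  p = (lead_coef p *: \prod_(r <- rs) ('X - r%:P))%R ->
  mu.-integrable J (fun w : R[i] => lne (cmod p.[w])%:E) /\
  \int[mu]_(w in J) lne (cmod p.[w])%:E =
    (ln (cmod (lead_coef p)) + \sum_(r <- rs) log_pot r)%R%:E.
Proof.
move=> p0 pE; have [h1 h2] := log_poly_prod rs.
have l0 : (0 < cmod (lead_coef p))%R by rewrite cmod_gt0 lead_coef_eq0.
have e : (fun w : R[i] => lne (cmod p.[w])%:E) =
    (fun w : R[i] => (ln (cmod (lead_coef p)))%:E + lne (\prod_(s <- rs) cdist w s)%R%:E).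
  apply/funext => w; rewrite {1}pE hornerZ cmodM horner_prod cmod_prod.
  under eq_bigr do rewrite !hornerE.
  rewrite lneM_ge0 ?cmod_ge0 ?(lne_EFin l0)//.
  by apply: prodr_ge0 => s _; exact: cmod_ge0.
have ci : mu.-integrable J (cst (ln (cmod (lead_coef p)))%:E).
  exact: finite_measure_integrable_cst.
rewrite e; split; first exact: integrableD.
have muJ2 : (mu : {measure set (borelC R) -> \bar R}) J = 1 := muJ1.
by rewrite (integralD mJ ci h1) h2 EFinD (integral_cst mu mJ) muJ2 mule1.
Qed.

End JensenFormula.

(** * Measurability and bounds for bivariate polynomials *)

Section MeasurableEval.
Variable R : realType.

(** Sums and products of complex functions are handled through real and imaginary
    parts, where the measurability of real arithmetic applies. *)
Definition measurable_complex d (T : measurableType d) (g : T -> R[i]) :=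
  measurable_fun setT (fun t => complex.Re (g t)) /\
  measurable_fun setT (fun t => complex.Im (g t)).

Variables (d : measure_display) (T : measurableType d).
Implicit Types g h : T -> R[i].

Lemma measurable_complex_add g h : measurable_complex g -> measurable_complex h ->
  measurable_complex (fun t => g t + h t).
Proof.
move=> [g1 g2] [h1 h2]; split.
  have -> : (fun t => complex.Re (g t + h t)) =
      (fun t => complex.Re (g t) + complex.Re (h t)).
    by apply/funext => t; case: (g t); case: (h t).
  exact: measurable_funD.
have -> : (fun t => complex.Im (g t + h t)) =
    (fun t => complex.Im (g t) + complex.Im (h t)).
  by apply/funext => t; case: (g t); case: (h t).
exact: measurable_funD.
Qed.

Lemma measurable_complex_mul g h : measurable_complex g -> measurable_complex h ->
  measurable_complex (fun t => g t * h t).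
Proof.
move=> [g1 g2] [h1 h2]; split.
  have -> : (fun t => complex.Re (g t * h t)) =
      (fun t => complex.Re (g t) * complex.Re (h t) - complex.Im (g t) * complex.Im (h t)).
    by apply/funext => t; case: (g t); case: (h t).
  by apply: measurable_funB; exact: measurable_funM.
have -> : (fun t => complex.Im (g t * h t)) =
    (fun t => complex.Re (g t) * complex.Im (h t) + complex.Im (g t) * complex.Re (h t)).
  by apply/funext => t; case: (g t) => a b; case: (h t) => a' b' /=; ring.
by apply: measurable_funD; exact: measurable_funM.
Qed.

Lemma measurable_complex_cst (c : R[i]) : measurable_complex (fun _ : T => c).
Proof. by split; exact: measurable_cst. Qed.

Lemma measurable_complex_comp (g : T -> borelC R) : measurable_fun setT g ->
  measurable_complex (g : T -> R[i]).
Proof.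
by move=> mg; split; [exact: (measurableT_comp (@measurable_Re R))|
  exact: (measurableT_comp (@measurable_Im R))].
Qed.

Lemma measurable_cmod g : measurable_complex g ->
  measurable_fun setT (fun t => cmod (g t)).
Proof.
move=> [g1 g2].
have -> : (fun t => cmod (g t)) =
    (fun t => Num.sqrt (complex.Re (g t) ^+ 2 + complex.Im (g t) ^+ 2)).
  by apply/funext => t; case: (g t).
apply: (measurableT_comp (f := @Num.sqrt R)).
  by apply: continuous_measurable_fun; exact: sqrt_continuous.
by apply: measurable_funD; exact: measurable_funX.
Qed.

Lemma measurable_complex_horner (q : {poly int}) g : measurable_complex g ->
  measurable_complex (fun t => (map_poly intr q).[g t]).
Proof.
move=> mg; elim/poly_ind: q => [|q c IH].
  have -> : (fun t => (map_poly intr 0).[g t]) = (fun=> 0).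
    by apply/funext => t; rewrite rmorph0 horner0.
  exact: measurable_complex_cst.
have -> : (fun t => (map_poly intr (q * 'X + c%:P)).[g t]) =
    (fun t => (map_poly intr q).[g t] * g t + c%:~R).
  by apply/funext => t; rewrite rmorphD rmorphM /= map_polyX map_polyC !hornerE.
apply: measurable_complex_add; last exact: measurable_complex_cst.
exact: measurable_complex_mul.
Qed.

Lemma eval2_MXaddC (P : {poly {poly int}}) (c : {poly int}) (x y : R[i]) :
  eval2 (P * 'X + c%:P) x y = eval2 P x y * x + (map_poly intr c).[y].
Proof.
by rewrite !eval2E /specialize rmorphD rmorphM /= map_polyX map_polyC !hornerE.
Qed.

Lemma eval2_0 (x y : R[i]) : eval2 0 x y = 0.
Proof. by rewrite eval2E /specialize rmorph0 horner0. Qed.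

Lemma measurable_complex_eval2 (P : {poly {poly int}}) g h :
  measurable_complex g -> measurable_complex h ->
  measurable_complex (fun t => eval2 P (g t) (h t)).
Proof.
move=> mg mh; elim/poly_ind: P => [|P c IH].
  have -> : (fun t => eval2 0 (g t) (h t)) = (fun=> 0).
    by apply/funext => t; exact: eval2_0.
  exact: measurable_complex_cst.
have -> : (fun t => eval2 (P * 'X + c%:P) (g t) (h t)) =
    (fun t => eval2 P (g t) (h t) * g t + (map_poly intr c).[h t]).
  by apply/funext => t; exact: eval2_MXaddC.
apply: measurable_complex_add; last exact: measurable_complex_horner.
exact: measurable_complex_mul.
Qed.

End MeasurableEval.

Lemma eval2_bounded (R : realType) (P : {poly {poly int}}) (rho : R) : 0 <= rho ->
  exists2 C : R, 1 <= C &
    forall x y : R[i], cmod x <= rho -> cmod y <= rho -> cmod (eval2 P x y) <= C.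
Proof.
move=> rho0.
have hb (q : {poly int}) : exists2 C : R, 0 <= C &
    forall y : R[i], cmod y <= rho -> cmod (map_poly intr q).[y] <= C.
  elim/poly_ind: q => [|q c [C C0 IH]].
    by exists 0 => // y _; rewrite rmorph0 horner0 cmod0.
  exists (C * rho + cmod (c%:~R : R[i])); first by rewrite addr_ge0 ?mulr_ge0 ?cmod_ge0.
  move=> y yr; rewrite rmorphD rmorphM /= map_polyX map_polyC !hornerE.
  by rewrite (le_trans (cmod_triangle _ _))// lerD2r cmodM ler_pM ?cmod_ge0// IH.
suff [C C0 h] : exists2 C : R, 0 <= C &
    forall x y : R[i], cmod x <= rho -> cmod y <= rho -> cmod (eval2 P x y) <= C.
  exists (C + 1); first by rewrite lerDr.
  by move=> x y xr yr; rewrite (le_trans (h x y xr yr))// lerDl.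
elim/poly_ind: P => [|P c [C C0 IH]].
  by exists 0 => // x y _ _; rewrite eval2_0 cmod0.
have [D D0 hD] := hb c.
exists (C * rho + D); first by rewrite addr_ge0// mulr_ge0.
move=> x y xr yr; rewrite eval2_MXaddC (le_trans (cmod_triangle _ _))//.
by rewrite lerD ?hD// cmodM ler_pM ?cmod_ge0// IH.
Qed.

(** * Vanishing Mahler measure *)

Section MahlerMeasure.
Local Open Scope ereal_scope.
Variables (R : realType) (f : {poly int}).
Hypotheses (fm : f \is monic) (fd : (2 <= (size f).-1)%N).
Hypothesis preper_julia : [set z : R[i] | preperiodic f z] `<=` julia f.
Variable mu : probability (borelC R) R.
Hypothesis mu_eq : is_equilibrium_measure f mu.
Implicit Types (z w v : R[i]).
Local Notation J := (julia f : set (borelC R)).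
Local Notation B := (escape_bound R fm fd).
Local Notation log_pot := (log_pot f mu).

Let mJ : measurable J := measurable_julia fm fd.
Let muJ1 : mu J = 1 := muJ mu_eq.
Let B1 : (1 <= B)%R. Proof. exact: escape_bound_ge1. Qed.

Lemma log_pot_ge0 z : (0 <= log_pot z)%R.
Proof.
apply: le_trans (log_pot_ge_robin fm fd preper_julia mu_eq z).
exact: (robin_ge0 fm fd preper_julia mu_eq).
Qed.

Lemma sum_log_pot_eq0 (rs : seq R[i]) : (\sum_(r <- rs) log_pot r <= 0)%R ->
  forall r, r \in rs -> log_pot r = 0%R.
Proof.
move=> h r rrs; apply/eqP; rewrite eq_le log_pot_ge0 andbT; apply: le_trans h.
by rewrite (big_rem r)//= lerDl; apply: sumr_ge0 => s _; exact: log_pot_ge0.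
Qed.

Section InnerIntegral.
Variable P : {poly {poly int}}.

Definition inner_log (y : borelC R) : \bar R :=
  \int[mu]_(x in J) lne (cmod (eval2 P x y))%:E.

(** On the Julia set the integrand is bounded above by some [ln C], so that Tonelli's
    theorem applies to [ln C] minus it. *)
Lemma inner_log_measurable : measurable_fun J inner_log /\
  exists2 c : R, (0 <= c)%R & forall y, J y -> inner_log y <= c%:E.
Proof.
have B0 : (0 <= B)%R by exact: le_trans B1.
have [C C1 PC] := eval2_bounded P B0.
have lnC0 : (0 <= ln C)%R by exact: ln_ge0.
have C0 : (0 < C)%R by exact: lt_le_trans C1.
pose k (yx : borelC R * borelC R) : \bar R :=
  maxe 0 ((ln C)%:E - lne (cmod (eval2 P yx.2 yx.1))%:E).
have k0 yx : 0 <= k yx by rewrite /k le_max lexx.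
have mk : measurable_fun setT k.
  apply: measurable_maxe => //; apply: emeasurable_funB => //.
  apply: measurable_lne_EFin; apply: measurable_cmod.
  apply: measurable_complex_eval2; apply: measurable_complex_comp;
    [exact: measurable_snd|exact: measurable_fst].
have mky y : measurable_fun setT (fun x => k (y, x)).
  by apply: measurableT_comp; [exact: mk|exact: measurable_pair1].
have mF := measurable_fun_fubini_tonelli_F (m2 := mu) k mk k0.
have le_lnC x y : J x -> J y -> lne (cmod (eval2 P x y))%:E <= (ln C)%:E.
  move=> Jx Jy.
  have := PC x y (julia_bounded fm fd Jx) (julia_bounded fm fd Jy).
  move: (cmod _) => p pC; have [p0|p0] := leP p 0%R.
    by rewrite le0_lneNy// leNye.
  by rewrite lne_EFin// lee_fin ler_ln// posrE (lt_le_trans p0).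
have kpos x y : J x -> J y -> 0 <= (ln C)%:E - lne (cmod (eval2 P x y))%:E.
  by move=> Jx Jy; move: (le_lnC x y Jx Jy) => h; rewrite sube_ge0 ?orbT.
have mP y : measurable_fun J (fun x : borelC R => lne (cmod (eval2 P x y))%:E).
  apply: measurable_funTS; apply: measurable_lne_EFin; apply: measurable_cmod.
  apply: measurable_complex_eval2; last exact: measurable_complex_cst.
  exact: (measurable_complex_comp (@measurable_id _ (borelC R) setT)).
have GE y : J y -> inner_log y = (ln C)%:E - \int[mu]_x k (y, x).
  move=> Jy; rewrite /inner_log.
  rewrite (prob1_integral_bounded_above mJ muJ1 (mP y) lnC0); last first.
    by move=> x Jx; exact: le_lnC.
  congr (_ - _); rewrite -(prob1_integral mJ muJ1 (mky y)); last by move=> x; exact: k0.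
  apply: eq_integral => x /[!inE] Jx.
  by rewrite -[RHS]/(maxe 0 _) (max_r (kpos x y Jx Jy)).
split.
  apply: (eq_measurable_fun (fun y => (ln C)%:E - \int[mu]_x k (y, x))).
    by move=> y /[!inE] Jy; rewrite GE.
  by apply: measurable_funTS; apply: emeasurable_funB.
exists (ln C) => // y Jy; rewrite GE//.
have : 0 <= \int[mu]_x k (y, x) by apply: integral_ge0 => x _; exact: k0.
case: (\int[mu]_x k (y, x)) => [r| |]//= r0; last by rewrite leNye.
by rewrite -EFinB lee_fin; move: r0; rewrite lee_fin; lra.
Qed.

Lemma inner_logE y : (map_poly intr (lead_coef P)).[y] != 0%R :> R[i] ->
  exists2 xs : seq R[i], (forall x, (x \in xs) = (eval2 P x y == 0)%R) &
    inner_log y =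
    (ln (cmod (map_poly intr (lead_coef P)).[y]) + \sum_(x <- xs) log_pot x)%R%:E.
Proof.
move=> by0; have [xs xsE] := closed_field_poly_normal (specialize P y).
have sP0 : specialize P y != 0%R.
  by rewrite -lead_coef_eq0 lead_coef_specialize.
exists xs => [x|].
  rewrite eval2E -[RHS]/(root (specialize P y) x) xsE rootZ ?lead_coef_eq0//.
  by rewrite root_prod_XsubC.
have [_ h] := log_poly fm fd preper_julia mu_eq sP0 xsE.
rewrite lead_coef_specialize// in h; rewrite -h.
by apply: eq_integral => x _; rewrite eval2E.
Qed.

Hypothesis P0 : P != 0%R.
Hypothesis mP0 : mahler2 f mu P = 0.
Local Notation b := (map_poly intr (lead_coef P) : {poly R[i]}).

(** The integral over [y] splits as the Mahler measure of the leading coefficient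
    plus the integral of the sum of the potentials of the roots. Both are
    nonnegative, so both vanish. *)
Lemma mahler_zero :
  [/\ `|lead_coef (lead_coef P)|%R = 1%R,
    (forall c : R[i], root b c -> log_pot c = 0%R) &
    exists N : set (borelC R), [/\ measurable N, mu N = 0 &
      forall y, J y -> ~ N y -> b.[y] != 0%R /\
        forall x, eval2 P x y = 0%R -> log_pot x = 0%R]].
Proof.
have b0 : b != 0%R.
  by rewrite map_poly_eq0_id0 ?lead_coef_eq0// intr_eq0 !lead_coef_eq0.
have lb : lead_coef b = (lead_coef (lead_coef P))%:~R.
  by rewrite lead_coef_map_inj ?rmorph0//; exact: intr_inj.
have lP1 : (1 <= `|lead_coef (lead_coef P)|)%R.
  by rewrite -gtz0_ge1 normr_gt0 !lead_coef_eq0.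
have lP1R : (1 <= `|lead_coef (lead_coef P)|%:~R :> R)%R by rewrite ler1z.
have [cs csE] := closed_field_poly_normal b.
have [bi bI] := log_poly fm fd preper_julia mu_eq b0 csE.
rewrite lb cmod_int in bI.
set c0 := (_ + _)%R in bI.
have [mG [c c_ge0 Gc]] := inner_log_measurable.
have IG : \int[mu]_(y in J) inner_log y = 0 by exact: mP0.
have Gi : mu.-integrable J inner_log.
  by apply: (prob1_integrable_bounded_above mJ muJ1 mG c_ge0 Gc); rewrite IG.
pose N0 : set (borelC R) := [set y | b.[y] = 0%R].
have fN0 : finite_set N0.
  apply: (@sub_finite_set _ _ [set` cs]); last exact: finite_seq.
  move=> y /eqP; rewrite -[(_ == _)]/(root b y) csE rootZ ?lead_coef_eq0//.
  by rewrite root_prod_XsubC.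
have mN0 : measurable N0 by exact: finite_set_borelC.
(* The logarithm of [cmod b.[y]] is integrable, so it is [-oo] only on a null set. *)
have N0J0 : mu (J `&` N0) = 0.
  apply: measure_negligible; first exact: measurableI.
  apply: negligibleS (integrable_ae mJ bi) => y [Jy by0] /= /(_ Jy).
  by rewrite by0 cmod0 lexx.
pose D := J `\` (J `&` N0).
have mJN0 : measurable (J `&` N0) by exact: measurableI.
have mD : measurable D by exact: measurableD.
have DJ : D `<=` J by move=> y [].
have Db y : D y -> b.[y] != 0%R by move=> [Jy h]; apply/eqP => hb; apply: h.
have GD := integrableS mJ mD DJ Gi; have bD := integrableS mJ mD DJ bi.
have ID : \int[mu]_(y in D) (inner_log y - lne (cmod b.[y])%:E) = (- c0)%:E.
  rewrite (integralB mD GD bD) /D -(negligible_integral mJN0 mJ Gi N0J0).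
  by rewrite -(negligible_integral mJN0 mJ bi N0J0) IG bI sub0e.
have hE y : D y -> exists2 xs : seq R[i],
    (forall x, (x \in xs) = (eval2 P x y == 0)%R) &
    inner_log y - lne (cmod b.[y])%:E = (\sum_(x <- xs) log_pot x)%R%:E.
  move=> Dy; have [xs xsP ->] := inner_logE (Db y Dy).
  exists xs => //; rewrite lne_EFin ?cmod_gt0 ?Db// -EFinB; congr (_%:E); lra.
have h0 y : D y -> 0 <= inner_log y - lne (cmod b.[y])%:E.
  move=> /hE[xs _ ->]; rewrite lee_fin; apply: sumr_ge0 => x _; exact: log_pot_ge0.
have : 0 <= \int[mu]_(y in D) (inner_log y - lne (cmod b.[y])%:E) by exact: integral_ge0.
rewrite ID lee_fin oppr_ge0 => c0_le0.
have ln0 : (0 <= ln (`|lead_coef (lead_coef P)|%:~R : R))%R by rewrite ln_ge0.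
have sum0 : (0 <= \sum_(r <- cs) log_pot r)%R by apply: sumr_ge0 => r _; exact: log_pot_ge0.
split.
- apply/eqP; rewrite eq_le lP1 andbT leNgt; apply/negP => lt1.
  have : (0 < ln (`|lead_coef (lead_coef P)|%:~R : R))%R by rewrite ln_gt0// ltr1z.
  by move: c0_le0; rewrite /c0; lra.
- move=> z; rewrite csE rootZ ?lead_coef_eq0// root_prod_XsubC => zcs.
  apply: (sum_log_pot_eq0 _ zcs); move: c0_le0; rewrite /c0; lra.
have c00 : c0 = 0%R by apply/eqP; rewrite eq_le c0_le0 addr_ge0.
have mh : measurable_fun D (fun y => inner_log y - lne (cmod b.[y])%:E).
  by apply: measurable_int; exact: (integrableB mD GD bD).
have : \int[mu]_(y in D) `|inner_log y - lne (cmod b.[y])%:E| = 0.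
  transitivity ((- c0)%:E); last by rewrite c00 oppr0.
  rewrite -ID.
  by apply: eq_integral => y /[!inE] Dy; rewrite gee0_abs// h0.
move=> /(ae_eq_integral_abs mu mD mh)[N1 [mN1 N10 hN1]].
exists ((J `&` N0) `|` N1); split.
- exact: measurableU.
- by rewrite measureU0.
move=> y Jy yN; have Dy : D y by split => // yN0; apply: yN; left.
split; first exact: Db.
have [xs xsP hxs] := hE y Dy.
have hy0 : (\sum_(x <- xs) log_pot x)%R = 0%R.
  have : ~ ~ (D y -> inner_log y - lne (cmod b.[y])%:E = cst 0 y).
    by move=> h; apply: yN; right; exact: hN1.
  by move=> /contrapT/(_ Dy); rewrite hxs => -[].
move=> x /eqP; rewrite -xsP; apply: sum_log_pot_eq0; by rewrite hy0.
Qed.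

End InnerIntegral.

End MahlerMeasure.

(** * From almost every fibre to every fibre *)

Section MahlerZero.
Variables (R : realType) (f : {poly int}).
Hypotheses (fm : f \is monic) (fd : (2 <= (size f).-1)%N).
Hypothesis preper_julia : [set z : R[i] | preperiodic f z] `<=` julia f.
Variable mu : probability (borelC R) R.
Hypothesis mu_eq : is_equilibrium_measure f mu.
Implicit Types (z w v : R[i]).
Local Notation J := (julia f : set (borelC R)).
Local Notation K := (@filled_julia R f).
Local Notation B := (escape_bound R fm fd).
Local Notation V := (robin f mu).
Local Notation log_pot := (log_pot f mu).
Variable P : {poly {poly int}}.
Local Notation b := (map_poly intr (lead_coef P) : {poly R[i]}).
Variable N : set (borelC R).
Hypotheses (mN : measurable N) (muN : mu N = 0%E) (V0 : V = 0).
Hypothesis PN : forall y, J y -> ~ N y -> b.[y] != 0 /\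
  forall x, eval2 P x y = 0 -> log_pot x = 0.

Let mJ : measurable J := measurable_julia fm fd.

Lemma julia_generic_near y (r : R) : J y -> 0 < r ->
  exists w, [/\ J w, ~ N w & cmod (w - y) < r].
Proof.
move=> Jy r0; apply: contrapT => h.
have /eqP := julia_ball_mass fm fd preper_julia mu_eq V0 Jy r0; apply.
have mBall : measurable ([set w : R[i] | cmod (w - y) < r] : set (borelC R)).
  by apply: open_borelC; exact: open_ballC.
have CJ0 : mu (~` J) = 0%E by exact: prob1_negligible mJ (muJ mu_eq).
have mCJ := measurableC mJ.
have U0 : mu (~` J `|` N) = 0%E by exact: (etrans (measureU0 mCJ mN muN)).
apply: (subset_measure0 mBall (measurableU _ _ mCJ mN) _ U0) => w wy.
have [Jw|] := pselect (J w); last by left.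
by right; apply: contrapT => Nw; apply: h; exists w.
Qed.

Lemma eval2_cmod x w (xs : seq R[i]) : b.[w] != 0 ->
  specialize P w = lead_coef (specialize P w) *: \prod_(a <- xs) ('X - a%:P) ->
  cmod (eval2 P x w) = cmod b.[w] * \prod_(a <- xs) cmod (x - a).
Proof.
move=> bw xsE; rewrite eval2E {1}xsE hornerZ cmodM lead_coef_specialize//.
rewrite horner_prod cmod_prod; congr (_ * _); apply: eq_bigr => a _.
by rewrite !hornerE.
Qed.

Lemma size_fiber_roots w (xs : seq R[i]) : b.[w] != 0 ->
  specialize P w = lead_coef (specialize P w) *: \prod_(a <- xs) ('X - a%:P) ->
  size xs = (size P).-1.
Proof.
move=> bw xsE; rewrite -(size_specialize bw) xsE size_scale ?size_prod_XsubC//.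
by rewrite lead_coef_eq0 -size_poly_eq0 size_specialize// size_poly_eq0;
  apply: contra_neq bw => ->; rewrite lead_coef0 rmorph0 horner0.
Qed.

Lemma generic_root_filled_julia w x : J w -> ~ N w -> eval2 P x w = 0 -> K x.
Proof.
move=> Jw Nw Px; have [_ h] := PN Jw Nw.
by apply: (log_pot_eq0_filled_julia fm fd preper_julia mu_eq V0); exact: h.
Qed.

(** Roots move continuously, so what holds over generic points holds everywhere. *)
Lemma fiber_root_filled_julia y x : J y -> b.[y] != 0 -> eval2 P x y = 0 -> K x.
Proof.
move=> Jy by0 Pxy; apply: contrapT => nKx.
have [e e0 he] : exists2 e : R, 0 < e & forall w, cmod (w - x) < e -> ~ K w.
  have /closed_openC/open_CplxP := filled_julia_closed (R := R) fm fd.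
  by move=> /(_ x nKx).
pose q := (map_poly (map_poly intr) P).[x%:P] : {poly R[i]}.
have qE w : q.[w] = eval2 P x w by [].
pose n := (size P).-1; pose be := cmod b.[y].
have be0 : 0 < be by rewrite cmod_gt0.
have e1 : 0 < be / 2 * e ^+ n by rewrite mulr_gt0 ?divr_gt0// exprn_gt0.
have [d1 d10 h1] := horner_cmod_continuous q y e1.
have be20 : 0 < be / 2 by rewrite divr_gt0.
have [d2 d20 h2] := horner_cmod_continuous b y be20.
have [|w [Jw Nw wy]] := @julia_generic_near y (Num.min d1 d2) Jy.
  by rewrite lt_min d10.
move: wy; rewrite lt_min => /andP[/h1 w1 /h2 w2].
have [bw hw] := PN Jw Nw.
have [xs xsE] := closed_field_poly_normal (specialize P w).
have sxs : size xs = n := size_fiber_roots bw xsE.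
have bwbe : be / 2 < cmod b.[w].
  have := cmod_triangle (b.[y] - b.[w]) b.[w]; rewrite subrK -/be cmodBC; lra.
rewrite !qE Pxy subr0 (eval2_cmod _ bw xsE) in w1.
(* The product of the distances from [x] to the roots over [w] is small, so one of
   them is close to [x]. *)
have prod_lt : \prod_(a <- xs) cmod (x - a) < e ^+ size xs.
  have p0 : 0 <= \prod_(a <- xs) cmod (x - a).
    by apply: prodr_ge0 => a _; exact: cmod_ge0.
  rewrite sxs -(ltr_pM2l be20); apply: le_lt_trans w1.
  by apply: ler_wpM2r => //; exact: ltW.
have xs0 : (0 < size xs)%N.
  by case: (xs) prod_lt => //; rewrite big_nil expr0 ltxx.
have [a axs xa] : exists2 a, a \in xs & cmod (x - a) < e.
  apply: (near_root xs0 (ltW e0) erefl); rewrite horner_prod cmod_prod.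
  by under eq_bigr do rewrite !hornerE.
apply: (he a); first by rewrite cmodBC.
apply: (generic_root_filled_julia Jw Nw); apply/eqP.
rewrite eval2E -[(_ == _)]/(root (specialize P w) a) xsE rootZ ?root_prod_XsubC//.
by rewrite lead_coef_specialize.
Qed.

(** Over generic points near a zero of the leading coefficient the roots stay
    bounded, so that [P(x, .)] tends to zero there. *)
Lemma leading_root_vertical y : J y -> root b y -> forall x, eval2 P x y = 0.
Proof.
move=> Jy rby x; apply/eqP; rewrite -cmod_eq0 eq_le cmod_ge0 andbT.
pose q := (map_poly (map_poly intr) P).[x%:P] : {poly R[i]}.
have qE w : q.[w] = eval2 P x w by [].
pose n := (size P).-1; pose c := cmod x + B.
have c0 : 0 < c by rewrite ltr_wpDl ?cmod_ge0// (lt_le_trans ltr01)// escape_bound_ge1.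
apply/ler_addgt0Pr => e e0; rewrite add0r.
have e20 : 0 < e / 2 by rewrite divr_gt0.
have [d1 d10 h1] := horner_cmod_continuous q y e20.
have e3 : 0 < e / 2 / c ^+ n by rewrite divr_gt0// exprn_gt0.
have [d2 d20 h2] := horner_cmod_continuous b y e3.
have [|w [Jw Nw wy]] := @julia_generic_near y (Num.min d1 d2) Jy.
  by rewrite lt_min d10.
move: wy; rewrite lt_min => /andP[/h1 w1 /h2].
rewrite (rootP rby) subr0 => w2; have [bw hw] := PN Jw Nw.
have [xs xsE] := closed_field_poly_normal (specialize P w).
have sxs : size xs = n := size_fiber_roots bw xsE.
have xsK a : a \in xs -> cmod (x - a) <= c.
  move=> axs; rewrite (le_trans (cmod_triangle _ _))// cmodN lerD2l.
  apply: (filled_julia_bounded fm fd); apply: (generic_root_filled_julia Jw Nw).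
  apply/eqP; rewrite eval2E -[(_ == _)]/(root (specialize P w) a) xsE.
  by rewrite rootZ ?root_prod_XsubC// lead_coef_specialize.
have prod_le : \prod_(a <- xs) cmod (x - a) <= c ^+ n.
  rewrite -sxs; elim: (xs) xsK => [|a as_ IH] h; first by rewrite big_nil expr0.
  rewrite big_cons exprS ler_pM ?cmod_ge0 ?h ?mem_head//.
    by apply: prodr_ge0 => s _; exact: cmod_ge0.
  by apply: IH => s sas; apply: h; rewrite inE sas orbT.
have small : cmod (eval2 P x w) <= e / 2.
  rewrite (eval2_cmod _ bw xsE) (le_trans (ler_wpM2l (cmod_ge0 _) prod_le))//.
  by rewrite -ler_pdivlMr ?exprn_gt0// ltW.
rewrite !qE in w1; have := cmod_triangle (eval2 P x y - eval2 P x w) (eval2 P x w).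
by rewrite subrK cmodBC; lra.
Qed.

End MahlerZero.

Theorem theorem8p1 (R : realType) (f : {poly int})
    (f_monic : f \is monic) (f_deg : (2 <= (size f).-1)%N)
    (preper_julia : [set z : R[i] | preperiodic f z] `<=` julia f)
    (mu : probability (borelC R) R) (mu_eq : is_equilibrium_measure f mu)
    (P : {poly {poly int}}) (P_nonconst : forall c : int, P <> c%:P%:P)
    (mP : mahler2 f mu P = 0%E) :
  infinite_set [set ab : R[i] * R[i] |
    eval2 P ab.1 ab.2 = 0 /\ preperiodic f ab.1 /\ preperiodic f ab.2].
Proof.
have P0 : P != 0 by apply/eqP => P0; apply: (P_nonconst 0); rewrite P0 !polyC0.
have [lc1 lroots [N [mN muN PN]]] :=
  mahler_zero f_monic f_deg preper_julia mu_eq P0 mP.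
set b := map_poly intr (lead_coef P) in lroots PN.
have sb : size b = size (lead_coef P).
  by rewrite /b size_map_inj_poly ?rmorph0//; exact: intr_inj.
have lP0 : lead_coef P != 0 by rewrite lead_coef_eq0.
have lead_const : (size (lead_coef P) <= 1)%N -> exists2 c, lead_coef P = c%:P & `|c| = 1.
  move=> s1; exists (lead_coef P)`_0; first exact: size1_polyC.
  by rewrite {1}(size1_polyC s1) lead_coefC in lc1.
have sP1 : (size (lead_coef P) <= 1)%N -> (1 < size P)%N.
  move=> /lead_const[c lPc _]; rewrite ltnNge; apply/negP => sP.
  apply: (P_nonconst c); rewrite -lPc [P in LHS](size1_polyC sP).
  by rewrite {2}(size1_polyC sP) lead_coefC.
have root_b : (1 < size (lead_coef P))%N -> exists y, root b y.
  by move=> s1; apply/closed_rootP; rewrite sb; case: (size _) s1 => [|[]].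
have root_fiber y : (1 < size P)%N -> b.[y] != 0 -> exists x, eval2 P x y = 0.
  move=> s1 by0; have /closed_rootP[x] : size (specialize P y) != 1%N.
    by rewrite size_specialize//; case: (size P) s1 => [|[]].
  by move=> /rootP xP; exists x; rewrite eval2E.
(* The potential vanishes somewhere: at a root of [b], or, when [b] is constant, at
   a root of [P] over a generic Julia point. *)
have V0 : robin f mu = 0.
  have [z z0] : exists z, log_pot f mu z = 0.
    have [s1|/root_b[y yb]] := leqP (size (lead_coef P)) 1; last by exists y; exact: lroots.
    have [y [Jy Ny]] : exists y, julia f y /\ ~ N y.
      apply: contrapT => h.
      have : (mu (julia f : set (borelC R)) <= mu N)%E.
        apply: le_measure; rewrite ?inE//; first exact: measurable_julia.
        by move=> y Jy; apply: contrapT => Ny; apply: h; exists y.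
      by rewrite (muJ mu_eq) muN leNgt lte01.
    have [by0 hy] := PN y Jy Ny.
    by have [x Pxy] := root_fiber y (sP1 s1) by0; exists x; exact: hy.
  apply/eqP; rewrite eq_le (robin_ge0 f_monic f_deg preper_julia mu_eq) andbT -z0.
  exact: (log_pot_ge_robin f_monic f_deg preper_julia mu_eq).
have inf := infinite_preperiodic (R := R) f_monic f_deg.
have [s1|s1] := leqP (size (lead_coef P)) 1.
  have lcP := lead_const s1.
  have by0 y : b.[y] != 0.
    have [c lPc c1] := lcP; rewrite /b lPc map_polyC hornerC intr_eq0.
    by apply/eqP => c0; rewrite c0 normr0 in c1.
  move=> fin; apply: inf.
  apply: (@sub_finite_set _ _ (snd @` [set ab : R[i] * R[i] |
    eval2 P ab.1 ab.2 = 0 /\ preperiodic f ab.1 /\ preperiodic f ab.2])).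
    move=> y /= py.
    have [|x [Pxy px]] := preperiodic_fiber f_monic f_deg (sP1 s1) lcP _ py.
      move=> x z pz; apply: (fiber_root_filled_julia f_monic f_deg preper_julia
        mu_eq mN muN V0 PN) => //.
        exact: preper_julia.
      exact: by0.
    by exists (x, y).
  by apply: finite_image; exact: fin.
have [y yb] := root_b s1.
have py : preperiodic f y.
  apply: (kronecker_filled_julia f_monic f_deg lc1) => // z /lroots z0.
  exact: (log_pot_eq0_filled_julia f_monic f_deg preper_julia mu_eq V0 z0).
have vert := leading_root_vertical f_monic f_deg preper_julia mu_eq mN muN V0 PN
  (preper_julia y py) yb.
move=> fin; apply: inf.
apply: (@sub_finite_set _ _ (fst @` [set ab : R[i] * R[i] |
  eval2 P ab.1 ab.2 = 0 /\ preperiodic f ab.1 /\ preperiodic f ab.2])).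
  by move=> x /= px; exists (x, y).
by apply: finite_image; exact: fin.
Qed.
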